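(* Let $d\ge 2$, let $\Omega\subset\mathbb{R}^d$ be a bounded, smooth and strictly convex set, and let $\Sigma\subset\partial\Omega$ be any nonempty (relatively) open subset of its boundary. If $f\in\mathcal{E}'(\mathbb{R}^d)$ is supported in $\overline{\Omega}$ and its X-ray transform $Xf$ vanishes on all lines that meet $\Sigma$, then $f=0$.
   Context: ''Smooth'' for $\Omega$ means that its boundary $\partial\Omega$ is smooth. $\mathcal{E}$ denotes smooth functions, $\mathcal{D}$ compactly supported smooth functions, and $\mathcal{E}'(\mathbb{R}^d)$ the compactly supported distributions on $\mathbb{R}^d$. X-ray transform: let $\Gamma$ be the manifold of oriented lines in $\mathbb{R}^d$, parametrized by $\{(z,\theta):\theta\in S^{d-1},\ z\in\theta^\perp\}$ (identified with $TS^{d-1}$). For $\varphi\in\mathcal{D}(\mathbb{R}^d)$, $X\varphi(z,\theta)=\int_{\mathbb{R}}\varphi(z+s\theta)\,ds$; for $\psi\in\mathcal{E}(\Gamma)$, $X^*\psi(x)=\int_{S^{d-1}}\psi(x-(x\cdot\theta)\theta,\theta)\,d\theta$. For $f\in\mathcal{E}'(\mathbb{R}^d)$, $Xf\in\mathcal{E}'(\Gamma)$ is defined by $\langle Xf,\eta\rangle=\langle f,X^*\eta\rangle$ for all $\eta\in\mathcal{E}(\Gamma)$. ''$Xf$ vanishes on all lines of a set $L\subset\Gamma$'' means that no line of $L$ belongs to the support of the distribution $Xf$, i.e. every line in $L$ has an open neighborhood in $\Gamma$ on which $Xf=0$ as a distribution. (For open $L$ this is the same as $Xf|_L=0$.)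 Here $L$ is the set of all lines meeting $\Sigma$, including lines tangent to $\partial\Omega$ at points of $\Sigma$. *)

(* Defs.v *)
From HB Require Import structures.
From mathcomp Require Import all_boot all_order all_algebra.
From mathcomp Require Import all_classical all_reals all_analysis.
From mathcomp Require Import complex.

Set Implicit Arguments.
Unset Strict Implicit.
Unset Printing Implicit Defensive.

Import Order.TTheory GRing.Theory Num.Theory.
Import numFieldNormedType.Exports.

Local Open Scope classical_set_scope.
Local Open Scope ring_scope.

Section Smooth.
Context {R : realType} {V : normedModType R}.
Implicit Types (U : set V) (g : V -> R) (phi : V -> R[i]).

(* For open [U] in a finite-dimensional [V], quantifying over all directions
   [v] is the same as quantifying over the vectors of a basis. *)
Fixpoint Ck_on (k : nat) U g : Prop :=
  (forall x, U x -> {for x, continuous g}) /\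
  if k is k'.+1 then
    forall v, (forall x, U x -> derivable g x v) /\ Ck_on k' U ('D_v g)
  else True.

Definition smooth_on U g : Prop := forall k, Ck_on k U g.

Definition csmooth_on U phi : Prop :=
  smooth_on U (fun x => complex.Re (phi x)) /\
  smooth_on U (fun x => complex.Im (phi x)).

End Smooth.

Section Euclidean.
Context {R : realType} {d : nat}.
Implicit Types (x y : 'rV[R]_d) (Omega S : set 'rV[R]_d).

Definition dot x y : R := \sum_i x 0 i * y 0 i.

(* The norm [`|x|] of the library is the maximum norm on ['rV[R]_d]. *)
Definition enorm x : R := Num.sqrt (dot x x).

Definition boundary Omega : set 'rV[R]_d := closure Omega `\` Omega°.

Definition smooth_hypersurface S : Prop := forall p, S p ->
  exists (W : set 'rV[R]_d) (rho : 'rV[R]_d -> R),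
    [/\ open W /\ W p, smooth_on W rho, exists v, 'D_v rho p != 0 &
        S `&` W = [set x | W x /\ rho x = 0]].

Definition strictly_convex Omega : Prop := forall x y (t : R),
  closure Omega x -> closure Omega y -> x != y -> 0 < t -> t < 1 ->
  Omega° ((1 - t) *: x + t *: y).

Definition relatively_open_in S T : Prop :=
  exists U : set 'rV[R]_d, open U /\ T = S `&` U.

End Euclidean.

Section SphereIntegral.
Context {R : realType}.

(* Lebesgue integral over R^n, written as an iterated integral. *)
Fixpoint iter_integral (n : nat) : ('rV[R]_n -> R) -> R :=
  if n is n'.+1 return ('rV[R]_n -> R) -> R then
    fun g => \int[lebesgue_measure]_t
      iter_integral (fun y : 'rV[R]_n' => g (row_mx (t%:M : 'rV[R]_1) y))
  else fun g => g 0.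

(* Integral over the unit sphere for the (unnormalized) surface measure, which
   gives a Borel set A of the sphere d times the volume of the cone
   {r theta | theta in A, 0 < r <= 1}.  Only the values of [g] on the sphere
   matter. *)
Definition sphere_integral (d : nat) (g : 'rV[R]_d -> R) : R :=
  d%:R * iter_integral (fun x : 'rV[R]_d =>
    if 0 < enorm x <= 1 then g ((enorm x)^-1 *: x) else 0).

Definition sphere_cintegral (d : nat) (g : 'rV[R]_d -> R[i]) : R[i] :=
  Complex (sphere_integral (fun theta => complex.Re (g theta)))
          (sphere_integral (fun theta => complex.Im (g theta))).

End SphereIntegral.

Section CompactlySupportedDistributions.
Context {R : realType} {d : nat}.
Implicit Types (phi psi : 'rV[R]_d -> R[i]) (K W : set 'rV[R]_d).

Definition test_fun phi : Prop := csmooth_on setT phi.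

Definition partial (s : seq 'I_d) (g : 'rV[R]_d -> R) : 'rV[R]_d -> R :=
  foldr (fun i h => 'D_(delta_mx 0 i) h) g s.

Definition cpartial (s : seq 'I_d) phi : 'rV[R]_d -> R[i] := fun x =>
  Complex (partial s (fun y => complex.Re (phi y)) x)
          (partial s (fun y => complex.Im (phi y)) x).

(* The derivatives of order k are indexed by the words of length k in the
   coordinates rather than by multi-indices. *)
Definition Cn_seminorm K (N : nat) phi : R :=
  \sum_(k < N.+1) \sum_(s : k.-tuple 'I_d)
    sup [set Normc.normc (cpartial s phi x) | x in K].

(* Compactly supported distributions as the continuous linear forms on the
   Frechet space of smooth functions.  The values of the underlying map on
   functions that are not smooth carry no information. *)
Record cdistribution := CDistribution {
  pairing :> ('rV[R]_d -> R[i]) -> R[i];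
  pairing_linear : forall (a : R[i]) phi psi, test_fun phi -> test_fun psi ->
    pairing (fun x => a * phi x + psi x) = a * pairing phi + pairing psi;
  pairing_continuous : exists (K : set 'rV[R]_d) (N : nat) (C : R),
    compact K /\
    forall phi, test_fun phi ->
      Normc.normc (pairing phi) <= C * Cn_seminorm K N phi
}.

Definition cdist_eq0 (f : cdistribution) : Prop :=
  forall phi, test_fun phi -> f phi = 0.

Definition dsupport (f : cdistribution) : set 'rV[R]_d :=
  ~` [set x | exists W, [/\ open W, W x &
        forall phi, test_fun phi ->
          compact (closure [set y | phi y != 0]) ->
          closure [set y | phi y != 0] `<=` W -> f phi = 0]].

End CompactlySupportedDistributions.

Section XrayTransform.
Context {R : realType} {d : nat}.

(* The oriented line through z with direction theta, where z is orthogonal to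
   theta, is the pair (z, theta). *)
Definition Lines : set ('rV[R]_d * 'rV[R]_d) :=
  [set l | enorm l.2 = 1 /\ dot l.1 l.2 = 0].

Definition line_pts (l : 'rV[R]_d * 'rV[R]_d) : set 'rV[R]_d :=
  [set l.1 + s *: l.2 | s in [set: R]].

Definition lines_meeting (S : set 'rV[R]_d) : set ('rV[R]_d * 'rV[R]_d) :=
  [set l | Lines l /\ (line_pts l `&` S) !=set0].

Implicit Types (eta : 'rV[R]_d * 'rV[R]_d -> R[i]).

(* Functions on [Lines] are represented by functions on the ambient space, of
   which only the values on [Lines] are used; smoothness on this embedded
   submanifold is local smooth extendability. *)
Definition Lines_test_fun eta : Prop := forall l, Lines l ->
  exists (W : set ('rV[R]_d * 'rV[R]_d)) (F : 'rV[R]_d * 'rV[R]_d -> R[i]),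
    [/\ open W, W l, csmooth_on W F &
        forall m, W m -> Lines m -> eta m = F m].

Definition Lines_fun_support eta : set ('rV[R]_d * 'rV[R]_d) :=
  closure [set l | Lines l /\ eta l != 0].

Definition Xray_adjoint eta : 'rV[R]_d -> R[i] := fun x =>
  sphere_cintegral (fun theta => eta (x - dot x theta *: theta, theta)).

Definition Xray (f : @cdistribution R d) :
    ('rV[R]_d * 'rV[R]_d -> R[i]) -> R[i] :=
  fun eta => f (Xray_adjoint eta).

(* Since [Lines] is closed, closures and compactness may be taken in the
   ambient space. *)
Definition Lines_dsupport (g : ('rV[R]_d * 'rV[R]_d -> R[i]) -> R[i]) :
    set ('rV[R]_d * 'rV[R]_d) :=
  Lines `\` [set l | exists W, [/\ open W, W l &
    forall eta, Lines_test_fun eta -> compact (Lines_fun_support eta) ->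
      Lines_fun_support eta `<=` W -> g eta = 0]].

End XrayTransform.

(* Main.v *)
Require Import Defs.
From mathcomp Require Import all_boot all_order all_algebra.
From mathcomp Require Import all_classical all_reals all_analysis.
From mathcomp Require Import measurable_realfun.
From mathcomp Require Import complex.
From mathcomp Require Import ring lra zify.

Set Implicit Arguments.
Unset Strict Implicit.
Unset Printing Implicit Defensive.

Import Order.TTheory GRing.Theory Num.Theory.
Import numFieldNormedType.Exports.

Local Open Scope classical_set_scope.
Local Open Scope ring_scope.

(* Let [C] be the closure of [Omega].  Seen from a suitable point [x0] outside
   [C] and close to a point of [Sigma], every line that passes near [x0] and
   meets [C] meets [Sigma]; the lines that miss [C] miss the support of [f].
   Hence [Xf] vanishes near all lines passing close to [x0].  Let [height] be
   an affine form vanishing at [x0] and bounded below by a positive constant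
   on [C], and give a nonhorizontal line the coordinates (u, v), where [u] is
   its foot at height 0 and [v] its slope.  Testing [Xf] against a weighted
   product of functions [h_i(u_i) a_i(v_i)], with [h_i] supported near 0,
   shows that [f] kills the product over [i] of the integrals of
   [h_i(side_i - height v) a_i(v) dv].  When [a_i] is a monomial and [h_i] has
   prescribed moments, this product is a multiple of
   [side^b height^-k], for any large [k].  With [r = 1 - (k/height)^K] and
   [0 <= r < 1], the decomposition
   [1 = (1 - r) sum_(i < j) r^i + r^j] turns negative powers of
   [height] into nonnegative ones, so [f] kills all polynomials; these are
   dense in the smooth functions. *)

(** * Iterated integrals *)

(** The weight in the test functions is the power of the direction's [nform] that turns surface
    measure on the sphere into Lebesgue measure in the slopes; this is what makes the adjoint
    transform a product over [i]. Prescribing the moments of [h_i] imitates, with smooth functions,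
    a derivative of the point mass at foot 0. Smallness is required of the feet only: slopes are
    unrestricted, so that [a_i] may be a monomial truncated beyond the slopes that lines from a foot
    near 0 to [C] can have. Two obstacles shape the rest. Inverse powers of [height] are reached
    only from a threshold on, which depends on [b]. And [f] is controlled through derivatives up to
    some order on a compact set that need not lie in [C], where [height] may vanish. Hence [height]
    is replaced away from [C] by a function bounded below, which the support of [f] permits, and
    [r^j] has to tend to 0 together with its derivatives. *)

Section AffineChange.
Context {R : realType}.
Notation mu := (@lebesgue_measure R).

Lemma measurable_affine (c e : R) :
  measurable_fun [set: measurableTypeR R] (fun x : R => c * x + e : measurableTypeR R).
Proof. by apply: measurable_funD => //; exact: measurable_funM. Qed.

(** Lebesgue measure and [|c|] times its image under [x |-> c * x + e] agree on half-open intervals,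
    hence everywhere; the formula is then integration against an image measure. *)
Lemma ge0_integral_affine (c e : R) (f : R -> \bar R) : c != 0 ->
  measurable_fun setT f -> (forall x, 0 <= f x)%E ->
  (\int[mu]_x f x = `|c|%:E * \int[mu]_x f (c * x + e)%R)%E.
Proof.
move=> c0 mf f0.
pose phi : measurableTypeR R -> measurableTypeR R := fun x : R => c * x + e.
have mphi : measurable_fun [set: measurableTypeR R] phi by exact: measurable_affine.
pose nu0 :
    {measure set (measurableTypeR R) -> \bar R} :=
  mscale (NngNum (normr_ge0 c)) (pushforward mu phi).
pose nu' := nu0 mphi.
have munu A : measurable A -> mu A = nu' A.
  suff : forall X, ocitv X -> mu X = nu' X by move=> /lebesgue_measure_unique; exact.
  move=> X /ocitvP[->|[[a b] /= ab ->]]; first by rewrite !measure0.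
  rewrite /nu' /mscale /= /pushforward.
  have cP := normr_ge0 c.
  have [c_gt0|] := ltP 0 c; last rewrite le_eqVlt (negbTE c0) /= => c_lt0.
    have -> : phi @^-1` `]a, b]%classic = `]((a - e) / c), ((b - e) / c)]%classic.
      apply/seteqP; split=> x /=; rewrite !in_itv /= /phi ltr_pdivrMr// ler_pdivlMr// mulrC;
      by rewrite ltrBlDr lerBrDr.
    rewrite !lebesgue_measure_itv /= !lte_fin ltr_pM2r ?invr_gt0// ltrD2r ab.
    rewrite -!EFinB -EFinM gtr0_norm//; congr EFin; field.
    by rewrite gt_eqF.
  have -> : phi @^-1` `]a, b]%classic = `[((b - e) / c), ((a - e) / c)[%classic.
    apply/seteqP; split=> x /=; rewrite !in_itv /= /phi ltr_ndivlMr// ler_ndivrMr// mulrC;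
    by rewrite ltrBlDr lerBrDr andbC.
  rewrite !lebesgue_measure_itv /= !lte_fin ltr_nM2r ?invr_lt0// ltrD2r ab.
  rewrite -!EFinB -EFinM ltr0_norm//; congr EFin; field.
  by rewrite lt_eqF.
rewrite (eq_measure_integral nu') => [|A mA _]; last exact: munu.
rewrite ge0_integral_mscale//.
congr (_ * _)%E.
by rewrite (ge0_integral_pushforward mphi).
Qed.

Lemma Rintegral_affine (c e : R) (f : R -> R) : c != 0 ->
  mu.-integrable setT (EFin \o f) ->
  \int[mu]_x f x = `|c| * \int[mu]_x f (c * x + e).
Proof.
move=> c0 fi.
have mf : measurable_fun setT (EFin \o f) by case/integrableP: fi.
have mfp := measurable_funepos mf.
have mfn := measurable_funeneg mf.
have /= ip := integrable_fin_num measurableT (integrable_funepos measurableT fi).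
have /= ineg := integrable_fin_num measurableT (integrable_funeneg measurableT fi).
rewrite /Rintegral integralE [in RHS]integralE.
have Ep := ge0_integral_affine e c0 mfp (funepos_ge0 _).
have En := ge0_integral_affine e c0 mfn (funeneg_ge0 _).
have Ep' : (\int[mu]_x ((fun x => (f (c * x + e))%:E)^\+ x) =
  (`|c|^-1)%:E * \int[mu]_x ((EFin \o f)^\+ x))%E.
  rewrite Ep muleA -EFinM mulVf ?normr_eq0// mul1e.
  by apply: eq_integral => x _; rewrite !funeposE.
have En' : (\int[mu]_x ((fun x => (f (c * x + e))%:E)^\- x) =
  (`|c|^-1)%:E * \int[mu]_x ((EFin \o f)^\- x))%E.
  rewrite En muleA -EFinM mulVf ?normr_eq0// mul1e.
  by apply: eq_integral => x _; rewrite !funenegE.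
rewrite Ep' En' -muleBr//; last exact: fin_num_adde_defr.
rewrite fineM//; last by rewrite fin_numB ip ineg.
by rewrite mulrA mulfV ?normr_eq0// mul1r.
Qed.

(** Bounded, boundedly supported, measurable: the class in which integrability is automatic. One [M]
    serves as bound and as radius of the support. *)
Definition bsm (f : R -> R) := measurable_fun setT f /\
  exists M : R, forall x, `|f x| <= M /\ (f x != 0 -> `|x| <= M).

Lemma bsm_integrable (f : R -> R) : bsm f -> mu.-integrable setT (EFin \o f).
Proof.
move=> [mf [M fM]].
have M0 : 0 <= M by apply: le_trans (fM 0).1.
rewrite (_ : EFin \o f = (EFin \o f) \_ `[- M, M]%classic); last first.
  apply/funext=> x; rewrite patchE; case: ifPn => //.
  rewrite notin_setE /= in_itv /= -ler_norml => /negP xM.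
  by have [->|/(fM x).2 h] := eqVneq (f x) 0; rewrite // h in xM.
have mI : measurable (`[- M, M]%classic : set R) by [].
have H := (integrable_mkcond (mu:=mu) (EFin \o f) mI). apply (H.1).
apply: measurable_bounded_integrable => //.
- exact/compact_finite_measure/segment_compact.
- exact: measurable_funTS.
- exists M; split; first by rewrite num_real.
  by move=> x Mx y _; apply: le_trans (ltW Mx); apply: (fM y).1.
Qed.

Lemma le_norm_Rintegral (f : R -> R) (M L : R) : measurable_fun setT f -> 0 <= L ->
  (forall x, `|f x| <= M) -> (forall x, f x != 0 -> `|x| <= L) ->
  `|\int[mu]_x f x| <= M * (L *+ 2).
Proof.
move=> mf L0 fM fL.
have M0 : 0 <= M by apply: le_trans (fM 0).
have fi : mu.-integrable setT (EFin \o f).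
  apply: bsm_integrable; split=> //; exists (Num.max M L) => x; split.
    by rewrite le_max fM.
  by move=> /fL h; rewrite le_max h orbT.
apply: (le_trans (le_normr_Rintegral measurableT fi)).
have E : \int[mu]_x `|f x| = \int[mu]_(x in `[- L, L]) `|f x|.
  rewrite [RHS]Rintegral_mkcond; apply: eq_Rintegral => x _.
  rewrite patchE; case: ifPn => //.
  rewrite notin_setE /= in_itv /= -ler_norml => /negP xM.
  by have [->|/fL h] := eqVneq (f x) 0; [rewrite normr0|rewrite h in xM].
have mLL : measurable (`[- L, L]%classic : set R) by [].
rewrite E; apply: (@le_trans _ _ (\int[mu]_(x in `[- L, L]) M)).
  apply: le_Rintegral => //.
  - apply: (integrableS measurableT) => //.
    exact: (integrable_norm fi).
  - apply: measurable_bounded_integrable => //.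
    + exact/compact_finite_measure/segment_compact.
    + by exists M; split; [rewrite num_real|move=> x Mx y _ /=; rewrite ger0_norm// ltW].
rewrite Rintegral_cst// [X in fine X](_ : _ = (L *+ 2)%:E)//.
apply: (etrans (lebesgue_measure_itv _)); rewrite /= lte_fin.
case: ltP => [_|h]; first by rewrite opprK -EFinD.
by rewrite (_ : L = 0) ?mul0rn//; lra.
Qed.
End AffineChange.

Section IteratedIntegral.
Context {R : realType}.
Notation mu := (@lebesgue_measure R).

(* Joint measurability in the parameter and in all coordinates, phrased by
   adjoining the coordinates to the parameter one after the other. *)
Fixpoint mrV (n : nat) : forall d (T : measurableType d),
    (T -> 'rV[R]_n -> R) -> Prop :=
  if n is n'.+1 return forall d (T : measurableType d), (T -> 'rV[R]_n -> R) -> Prop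
  then fun d T F => mrV (fun (tx : T * measurableTypeR R) (y : 'rV[R]_n') =>
                           F tx.1 (row_mx (tx.2%:M : 'rV[R]_1) y))
  else fun d T F => measurable_fun setT (fun t => F t 0).

Lemma mrV_pre n d d' (T : measurableType d) (T' : measurableType d')
    (phi : T' -> T) (F : T -> 'rV[R]_n -> R) :
  measurable_fun setT phi -> mrV F -> mrV (fun t => F (phi t)).
Proof.
elim: n d d' T T' phi F => [|n IH] d d' T T' phi F mphi /= mF.
  exact: (measurableT_comp mF mphi).
pose psi (tx : T' * measurableTypeR R) := (phi tx.1, tx.2).
apply: (IH _ _ _ _ psi _ _ mF).
by apply: measurable_fun_pair => //; exact: (measurableT_comp mphi measurable_fst).
Qed.

Lemma mrV_cst n d (T : measurableType d) (g : T -> R) :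
  measurable_fun setT g -> mrV (fun t (_ : 'rV[R]_n) => g t).
Proof.
elim: n d T g => [|n IH] d T g mg //=.
apply: (IH _ _ (fun tx : T * measurableTypeR R => g tx.1)).
exact: (measurableT_comp mg measurable_fst).
Qed.

Lemma mrV_op2 n d (T : measurableType d) (op : R * R -> R) (F G : T -> 'rV[R]_n -> R) :
  measurable_fun setT op -> mrV F -> mrV G -> mrV (fun t y => op (F t y, G t y)).
Proof.
move=> mop; elim: n d T F G => [|n IH] d T F G /= mF mG; last exact: IH.
exact: (measurableT_comp mop (measurable_fun_pair mF mG)).
Qed.

Definition consV n (t : R) (y : 'rV[R]_n) : 'rV[R]_n.+1 := row_mx (t%:M : 'rV[R]_1) y.

Lemma consV0 n t (y : 'rV[R]_n) : consV t y 0 ord0 = t.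
Proof.
rewrite /consV; have -> : ord0 = lshift n (ord0 : 'I_1) by apply/val_inj.
by apply: etrans (row_mxEl _ _ _ _) _; rewrite mxE eqxx.
Qed.

Lemma consVS n t (y : 'rV[R]_n) i : consV t y 0 (lift ord0 i) = y 0 i.
Proof.
rewrite /consV; have -> : lift ord0 i = rshift 1 i by apply/val_inj.
exact: row_mxEr.
Qed.

Lemma mrV_coord n d (T : measurableType d) (i : 'I_n) :
  mrV (fun (t : T) (y : 'rV[R]_n) => y 0 i).
Proof.
elim: n d T i => [|n IH] d T; first by case.
move=> i /=; case: (unliftP ord0 i) => [j|] ->.
  rewrite (_ : (fun _ _ => _) = (fun (tx : T * measurableTypeR R) (y : 'rV[R]_n) => y 0 j)).
    exact: IH.
  by apply/funext=> tx; apply/funext=> y; rewrite -/(consV _ _) consVS.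
rewrite (_ : (fun _ _ => _) = (fun (tx : T * measurableTypeR R) (_ : 'rV[R]_n) => tx.2)).
  by apply: mrV_cst.
by apply/funext=> tx; apply/funext=> y; rewrite -/(consV _ _) consV0.
Qed.

Lemma mrVD n d (T : measurableType d) (F G : T -> 'rV[R]_n -> R) :
  mrV F -> mrV G -> mrV (fun t y => F t y + G t y).
Proof.
apply: (@mrV_op2 _ _ _ (fun p => p.1 + p.2)).
exact: measurable_funD measurable_fst measurable_snd.
Qed.

Lemma mrVM n d (T : measurableType d) (F G : T -> 'rV[R]_n -> R) :
  mrV F -> mrV G -> mrV (fun t y => F t y * G t y).
Proof.
apply: (@mrV_op2 _ _ _ (fun p => p.1 * p.2)).
exact: measurable_funM measurable_fst measurable_snd.
Qed.

Lemma mrV_comp n d (T : measurableType d) (h : R -> R) (F : T -> 'rV[R]_n -> R) :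
  measurable_fun setT h -> mrV F -> mrV (fun t y => h (F t y)).
Proof.
move=> mh mF; apply: (@mrV_op2 _ _ _ (fun p => h p.1)) mF (mF).
exact: measurableT_comp mh measurable_fst.
Qed.

Lemma mrV_sum n d (T : measurableType d) I (r : seq I) (F : I -> T -> 'rV[R]_n -> R) :
  (forall i, mrV (F i)) -> mrV (fun t y => \sum_(i <- r) F i t y).
Proof.
move=> mF; elim: r => [|a r IH].
  by under eq_fun do under eq_fun do rewrite big_nil; apply: mrV_cst.
by under eq_fun do under eq_fun do rewrite big_cons; apply: mrVD.
Qed.

Lemma mrV_prod n d (T : measurableType d) I (r : seq I) (F : I -> T -> 'rV[R]_n -> R) :
  (forall i, mrV (F i)) -> mrV (fun t y => \prod_(i <- r) F i t y).
Proof.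
move=> mF; elim: r => [|a r IH].
  by under eq_fun do under eq_fun do rewrite big_nil; apply: mrV_cst.
by under eq_fun do under eq_fun do rewrite big_cons; apply: mrVM.
Qed.

Lemma measurable_Rintegral d (T : measurableType d) (f : T * measurableTypeR R -> R) :
  measurable_fun setT f -> measurable_fun setT (fun t => \int[mu]_x f (t, x)).
Proof.
move=> mf; rewrite /Rintegral.
have mE : measurable_fun setT (EFin \o f) by exact/measurable_EFinP.
apply: (measurableT_comp (fine_measurable measurableT)).
rewrite (_ : (fun _ => _) = (fun t => (\int[mu]_x (EFin \o f)^\+ (t, x)) -
   \int[mu]_x (EFin \o f)^\- (t, x))%E); last first.
  apply/funext=> t; rewrite integralE; congr (_ - _)%E; apply: eq_integral=> x _.
    by rewrite !funeposE.
  by rewrite !funenegE.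
apply: emeasurable_funB.
  apply: (measurable_fun_fubini_tonelli_F (m2 := mu)) => //; exact: measurable_funepos.
apply: (measurable_fun_fubini_tonelli_F (m2 := mu)) => //; exact: measurable_funeneg.
Qed.

Definition bbs n (T : Type) (M L : R) (F : T -> 'rV[R]_n -> R) :=
  forall t y, `|F t y| <= M /\ (F t y != 0 -> forall i, `|y 0 i| <= L).

Lemma bbs_cons n (T : Type) M L (F : T -> 'rV[R]_n.+1 -> R) : bbs M L F ->
  bbs M L (fun (tx : T * R) (y : 'rV[R]_n) => F tx.1 (consV tx.2 y)).
Proof.
move=> bF t y; split; first exact: (bF _ _).1.
by move=> /(bF _ _).2 h i; rewrite -(consVS t.2 y) h.
Qed.

Lemma iter_integral0 n : iter_integral (fun _ : 'rV[R]_n => 0) = 0.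
Proof.
elim: n => //= n IH; rewrite IH.
by rewrite /Rintegral integral0.
Qed.

(** Both conclusions go through one induction: bounding the outer integral requires the inner one to
    be measurable. Each integration over a segment of half-length [L] multiplies the bound by
    [2 L]. *)
Lemma iter_integral_nice n d (T : measurableType d) (F : T -> 'rV[R]_n -> R) M L :
  0 <= L -> mrV F -> bbs M L F ->
  measurable_fun setT (fun t => iter_integral (F t)) /\
  forall t, `|iter_integral (F t)| <= M * (L *+ 2) ^+ n.
Proof.
move=> L0; elim: n d T F => [|n IH] d T F /= mF bF.
  by split=> // t; rewrite expr0 mulr1; apply: (bF _ _).1.
have [mI bI] := IH _ _ _ mF (bbs_cons bF).
split; first exact: (measurable_Rintegral mI).
move=> t; rewrite exprSr mulrA; apply: le_norm_Rintegral => //.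
- exact: (measurableT_comp mI (measurable_pair1 t)).
- by move=> x; apply: (bI (t, x)).
- move=> x; apply: contraNT => xL.
  rewrite (_ : (fun y => _) = (fun=> 0)) ?iter_integral0//.
  apply/funext=> y; apply/eqP; apply: contraNT xL => /(bF _ _).2 /(_ ord0).
  by rewrite -/(consV _ _) consV0.
Qed.

Lemma iter_integral_supp n (F : R -> 'rV[R]_n -> R) L :
  (forall s y, F s y != 0 -> `|s| <= L) ->
  forall s, iter_integral (F s) != 0 -> `|s| <= L.
Proof.
move=> FL s; apply: contraNT => sL.
rewrite (_ : F s = (fun=> 0)) ?iter_integral0//.
by apply/funext=> y; apply/eqP; apply: contraNT sL => /FL.
Qed.

(** Integrability on the plane comes from Tonelli: the integral of [|f|] in [x] is bounded with
    bounded support in [s]. *)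
Lemma Rintegral_swap (f : R * R -> R) M L : 0 <= L ->
  measurable_fun [set: measurableTypeR R * measurableTypeR R] f ->
  (forall p, `|f p| <= M) ->
  (forall s x, f (s, x) != 0 -> `|s| <= L /\ `|x| <= L) ->
  \int[mu]_s \int[mu]_x f (s, x) = \int[mu]_x \int[mu]_s f (s, x).
Proof.
move=> L0 mf fM fL.
have mE : measurable_fun [set: measurableTypeR R * measurableTypeR R] (EFin \o f).
  exact/measurable_EFinP.
have bsm1 s : bsm (fun x => f (s, x)).
  split; first exact: (measurableT_comp mf (measurable_pair1 s)).
  exists (Num.max M L) => x; split; first by rewrite le_max fM.
  by move=> /fL[_ h]; rewrite le_max h orbT.
have bsm2 x : bsm (fun s => f (s, x)).
  split; first exact: (measurableT_comp mf (measurable_pair2 x)).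
  exists (Num.max M L) => s; split; first by rewrite le_max fM.
  by move=> /fL[h _]; rewrite le_max h orbT.
have mabs : measurable_fun [set: measurableTypeR R * measurableTypeR R] (fun p => `|f p|).
  exact: measurableT_comp.
have bsma : bsm (fun s => \int[mu]_x `|f (s, x)|).
  split; first exact: (measurable_Rintegral mabs).
  exists (Num.max (M * (L *+ 2)) L) => s; split.
    rewrite le_max; apply/orP; left; apply: le_norm_Rintegral => //.
    - exact: (measurableT_comp mabs (measurable_pair1 s)).
    - by move=> x; rewrite normr_id.
    - by move=> x; rewrite normr_eq0 => /fL[].
  move=> h; rewrite le_max; apply/orP; right; apply: contraNT h => sL.
  rewrite (_ : (fun _ => _) = (fun=> 0)) ?/Rintegral ?integral0//.
  by apply/funext=> x; apply/eqP; rewrite normr_eq0; apply: contraNT sL => /fL[].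
have fi : (mu \x mu)%E.-integrable setT (EFin \o f).
  apply/integrable12ltyP => //.
  have /integrableP[_ h] := bsm_integrable bsma.
  apply: le_lt_trans h; apply: ge0_le_integral => //.
  - by move=> s _; apply: integral_ge0.
  - apply: (measurable_fun_fubini_tonelli_F (m2 := mu) (fun p => `|(f p)%:E|%E)) => //.
    exact: measurableT_comp.
  - apply/measurable_EFinP; apply: measurableT_comp => //.
    exact: (measurable_Rintegral mabs).
  - move=> s _ /=; rewrite ger0_norm; last exact: Rintegral_ge0.
    rewrite /Rintegral fineK//.
    apply: integrable_fin_num => //.
    exact: (integrable_norm (bsm_integrable (bsm1 s))).
have := Fubini fi; rewrite /Rintegral => h.
transitivity (fine (\int[mu]_x \int[mu]_y (EFin \o f) (x, y))%E).
  congr fine; apply: eq_integral => s _; rewrite fineK//.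
  exact: (integrable_fin_num measurableT (bsm_integrable (bsm1 s))).
rewrite h; congr fine; apply: eq_integral => x _; rewrite fineK//.
exact: (integrable_fin_num measurableT (bsm_integrable (bsm2 x))).
Qed.

(** The integral over the parameter passes the coordinates one at a time. *)
Lemma iter_integral_Fubini n (F : R -> 'rV[R]_n -> R) M L : 0 <= L ->
  mrV (F : measurableTypeR R -> _) -> bbs M L F -> (forall s y, F s y != 0 -> `|s| <= L) ->
  \int[mu]_s iter_integral (F s) = iter_integral (fun y => \int[mu]_s F s y).
Proof.
move=> L0; elim: n F => [|n IH] F //= mF bF FL.
have [mI bI] := iter_integral_nice L0 mF (bbs_cons bF).
pose f (p : R * R) := iter_integral (fun y : 'rV[R]_n => F p.1 (consV p.2 y)).
rewrite (@Rintegral_swap f (M * (L *+ 2) ^+ n) L) //.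
- apply: eq_Rintegral => x _; apply: IH.
  + have mp : measurable_fun setT (fun s : measurableTypeR R => (s, x : measurableTypeR R)) by exact: measurable_pair2.
    exact: (mrV_pre mp mF).
  + move=> t y; exact: (bbs_cons bF (t, x) y).
  + by move=> s y; apply: FL.
- move=> s x h; split.
    by move: h; apply: (iter_integral_supp (F := fun s y => F s (consV x y))) => ? ?; apply: FL.
  move: h; apply: (iter_integral_supp (F := fun x y => F s (consV x y))) => x' y.
  by move=> /(bF _ _).2/(_ ord0); rewrite consV0.
Qed.

End IteratedIntegral.

Section FTC.
Context {R : realType}.
Notation mu := (@lebesgue_measure R).

Lemma Rintegral_derive (F f : R -> R) (a b : R) : a < b ->
  (forall x : R, is_derive x 1 F (f x)) -> continuous f ->
  \int[mu]_(x in `[a, b]) f x = F b - F a.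
Proof.
move=> ab dF cf; rewrite /Rintegral (continuous_FTC2 (F := F) ab)//.
- exact: continuous_subspaceT.
- have cF : continuous F.
    by move=> x; apply: differentiable_continuous; apply/derivable1_diffP; have [] := dF x.
  split.
  + by move=> x _; have [] := dF x.
  + exact/cvg_at_right_filter/cF.
  + exact/cvg_at_left_filter/cF.
- by move=> x _; rewrite derive1E; have [_ ->] := dF x.
Qed.

Lemma Rintegral_exprn_oc n (a : R) : 0 < a ->
  \int[mu]_(x in `]0, a]) (x ^+ n) = a ^+ n.+1 / n.+1%:R.
Proof.
move=> a0; rewrite Rintegral_itv_obnd_cbnd; last first.
  apply: (@integrableS _ _ _ mu `[0, a]%classic) => //.
    by apply: subset_itvr; rewrite bnd_simp.
  apply: continuous_compact_integrable; first exact: segment_compact.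
  by apply: continuous_subspaceT; exact: exprn_continuous.
have dF (x : R) : is_derive x (1 : R) (fun x : R => n.+1%:R^-1 * x ^+ n.+1) (x ^+ n).
  have dX : is_derive x (1 : R) (fun x : R => x ^+ n.+1) (n.+1%:R * x ^+ n).
    apply: DeriveDef; first exact: exprn_derivable.
    by rewrite exp_derive [_ *: 1]mulr1.
  apply: (is_derive_eq (is_deriveZ n.+1%:R^-1 dX)).
  by rewrite [LHS]mulrA mulVf ?pnatr_eq0// mul1r.
rewrite (Rintegral_derive a0 dF); last exact: exprn_continuous.
by rewrite expr0n mulr0 subr0 mulrC.
Qed.
End FTC.

Section IterIntegralRules.
Context {R : realType}.
Notation mu := (@lebesgue_measure R).

Lemma consVZ n s t (y : 'rV[R]_n) : s *: consV t y = consV (s * t) (s *: y).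
Proof.
apply/rowP=> i; rewrite [LHS]mxE; case: (unliftP ord0 i) => [j|] ->.
  by rewrite !consVS mxE.
by rewrite !consV0.
Qed.

Lemma bsm_iter_integral n d (T : measurableType d) (F : T -> 'rV[R]_n.+1 -> R) M L t :
  0 <= L -> mrV F -> bbs M L F ->
  bsm (fun x => iter_integral (fun y : 'rV[R]_n => F t (consV x y))).
Proof.
move=> L0 /= mF bF; have [mI bI] := iter_integral_nice L0 mF (bbs_cons bF).
split; first exact: (measurableT_comp mI (measurable_pair1 t)).
exists (Num.max (M * (L *+ 2) ^+ n) L) => x; split.
  by rewrite le_max; apply/orP; left; apply: (bI (t, x)).
move=> h; rewrite le_max; apply/orP; right.
move: h; apply: (iter_integral_supp (F := fun x y => F t (consV x y))) => x' y.
by move=> /(bF _ _).2/(_ ord0); rewrite consV0.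
Qed.

Lemma iter_integralZ n d (T : measurableType d) (F : T -> 'rV[R]_n -> R) M L a t :
  0 <= L -> mrV F -> bbs M L F ->
  iter_integral (fun y => a * F t y) = a * iter_integral (F t).
Proof.
move=> L0; elim: n d T F t => [|n IH] d T F t //= mF bF.
rewrite -RintegralZl//; last exact: (bsm_integrable (bsm_iter_integral t L0 mF bF)).
by apply: eq_Rintegral => x _; rewrite (IH _ _ _ (t, (x : measurableTypeR R)) mF (bbs_cons bF)).
Qed.

Lemma iter_integral_scale n d (T : measurableType d) (F : T -> 'rV[R]_n -> R) M L s t :
  s != 0 -> 0 <= L -> mrV F -> bbs M L F ->
  iter_integral (F t) = `|s| ^+ n * iter_integral (fun y => F t (s *: y)).
Proof.
move=> s0 L0; elim: n d T F t => [|n IH] d T F t /= mF bF.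
  by rewrite expr0 mul1r scaler0.
pose f x := iter_integral (fun y : 'rV[R]_n => F t (consV x y)).
have bf : bsm f by exact: (bsm_iter_integral t L0 mF bF).
rewrite [LHS](Rintegral_affine 0 s0 (bsm_integrable bf)) exprS -mulrA; congr (_ * _).
have gi (x : R) : f (s * x + 0) =
   `|s| ^+ n * iter_integral (fun y : 'rV[R]_n => F t (s *: consV x y)).
  rewrite addr0 /f (IH _ _ _ (t, (s * x : measurableTypeR R)) mF (bbs_cons bF)); congr (_ * iter_integral _).
  by apply/funext=> y /=; rewrite consVZ.
under eq_Rintegral do rewrite gi.
rewrite RintegralZl//.
have [mf [K fK]] := bf.
have sn0 : `|s| ^+ n != 0 by rewrite expf_neq0// normr_eq0.
apply: bsm_integrable.
rewrite (_ : (fun _ => _) = (fun x => (`|s| ^+ n)^-1 * f (s * x + 0))); last first.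
  by apply/funext=> x; rewrite gi mulrA mulVf// mul1r.
split.
  apply: measurable_funM => //; apply: (measurableT_comp mf); exact: measurable_affine.
exists (Num.max ((`|s| ^+ n)^-1 * K) (K / `|s|)) => x; split.
  rewrite normrM le_max; apply/orP; left.
  by rewrite ger0_norm ?invr_ge0 ?exprn_ge0// ler_wpM2l ?invr_ge0 ?exprn_ge0//; apply: (fK _).1.
rewrite mulf_eq0 negb_or => /andP[_ /(fK _).2]; rewrite addr0 normrM => h.
rewrite le_max; apply/orP; right.
by rewrite ler_pdivlMr ?normr_gt0// mulrC.
Qed.

Lemma iter_integral_prod n (B : 'I_n -> R -> R) c : (forall i, bsm (B i)) ->
  iter_integral (fun v : 'rV[R]_n => c * \prod_i B i (v 0 i)) = c * \prod_i \int[mu]_x B i x.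
Proof.
elim: n B c => [|n IH] B c bB /=; first by rewrite !big_ord0.
transitivity (\int[mu]_t ((c * \prod_i \int[mu]_x B (lift ord0 i) x) * B ord0 t)).
  apply: eq_Rintegral => t _.
  rewrite [RHS]mulrAC -(IH (fun i => B (lift ord0 i)))//.
  congr iter_integral; apply/funext => y; rewrite big_ord_recl /=.
  rewrite -/(consV _ _) consV0 mulrA; congr (_ * _).
  by apply: eq_bigr => i _; rewrite consVS.
rewrite RintegralZl//; last exact/bsm_integrable.
by rewrite big_ord_recl -mulrA; congr (_ * _); exact: mulrC.
Qed.

(** Parameter and variables are confined together, so that either may be integrated first. *)
Definition nice n (F : R -> 'rV[R]_n -> R) :=
  mrV (F : measurableTypeR R -> _) /\ exists M L, [/\ 0 <= L, bbs M L F &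
    forall s y, F s y != 0 -> `|s| <= L].

Lemma nice_Fubini n (F : R -> 'rV[R]_n -> R) : nice F ->
  \int[mu]_s iter_integral (F s) = iter_integral (fun y => \int[mu]_s F s y).
Proof. by move=> [mF [M [L [L0 bF FL]]]]; exact: (iter_integral_Fubini L0 mF bF FL). Qed.

Lemma nice_bsm n (F : R -> 'rV[R]_n -> R) y : nice F -> bsm (F^~ y).
Proof.
move=> [mF [M [L [L0 bF FL]]]]; split; last first.
  exists (Num.max M L) => x; split; first by rewrite le_max (bF _ _).1.
  by move=> /FL h; rewrite le_max h orbT.
(* The parameter space is generalized because the recursion of [mrV] adjoins coordinates to it. *)
suff : forall d (T : measurableType d) (G : T -> 'rV[R]_n -> R), mrV G ->
  measurable_fun setT (G^~ y) by move=> H; exact: (H _ _ _ mF).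
move=> {F mF bF FL}; elim: n y => [|n IH] y d T G /= mG.
  by rewrite (_ : y = 0)//; apply/rowP => -[].
pose y' : 'rV[R]_n := \row_i y 0 (lift ord0 i).
have /(_ y') h := IH _ _ _ _ mG.
have -> : G^~ y = (fun t => (fun tx : T * measurableTypeR R => G tx.1 (consV tx.2 y')) (t, y 0 ord0)).
  apply/funext=> t; congr G; apply/rowP=> i; case: (unliftP ord0 i) => [j|] ->.
    by rewrite consVS mxE.
  by rewrite consV0.
exact: (measurableT_comp h (measurable_pair2 _)).
Qed.
End IterIntegralRules.

(** * Sphere integrals in slope coordinates *)

Section SphereFormula.
Context {R : realType} (n : nat).
Notation mu := (@lebesgue_measure R).
Variables (c : R) (m : 'I_n -> R) (B : 'I_n -> R -> R) (M L : R).
Hypotheses (c0 : c != 0) (M0 : 0 <= M) (L0 : 0 <= L).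
Hypothesis mB : forall i, measurable_fun setT (B i).
Hypothesis BM : forall i v, `|B i v| <= M.
Hypothesis BL : forall i v, B i v != 0 -> `|v| <= L.

(* The zero value for [s <= 0] selects one of the two orientations of a line. *)
Definition posinv (s : R) : R := if 0 < s then s^-1 else 0.

Lemma posinv_gt0 s : 0 < s -> posinv s = s^-1.
Proof. by rewrite /posinv => ->. Qed.

Lemma measurable_posinv : measurable_fun setT posinv.
Proof.
rewrite (_ : posinv = fun s => if 0 < s then s `^ (-1) else 0); last first.
  by apply/funext=> s; rewrite /posinv; case: ifP => // s0; rewrite -powR_inv1 ?ltW.
apply: measurable_fun_if => //; first exact: measurable_fun_ltr.
by apply: measurable_funTS; exact: measurable_powR.
Qed.

(* On the unit ball, [cutroot] of the squared norm is the power of the norm that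
   [posinv] of a linear form produces when evaluated at [x / |x|]. *)
Definition cutroot (r : R) : R := if r <= 1 then Num.sqrt r ^+ n.+1 else 0.

Lemma measurable_cutroot : measurable_fun setT cutroot.
Proof.
apply: measurable_fun_if => //; first exact: measurable_fun_ler.
apply: measurable_funTS; apply: (@measurable_funX _ _ _ _ (@Num.sqrt R)).
by apply: continuous_measurable_fun; exact: sqrt_continuous.
Qed.

(** The integrand of the sphere integral on the unit ball, with the first coordinate [a], the other
    coordinates [Y] and the value [s] of the linear form kept as independent arguments: one
    expression then serves before and after each substitution. *)
Definition Psi (a s : R) (Y : 'I_n -> R) : R :=
  cutroot (a ^+ 2 + \sum_i Y i ^+ 2) * posinv s ^+ n.+1 * \prod_i B i (Y i * posinv s).

Lemma mrV_Psi d (T : measurableType d) (a s : T -> 'rV[R]_n -> R)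
    (Y : 'I_n -> T -> 'rV[R]_n -> R) :
  mrV a -> mrV s -> (forall i, mrV (Y i)) ->
  mrV (fun t y => Psi (a t y) (s t y) (fun i => Y i t y)).
Proof.
move=> ma ms mY.
have mX k (F : T -> 'rV[R]_n -> R) : mrV F -> mrV (fun t y => F t y ^+ k).
  by apply: (mrV_comp (exprn_measurable k)).
have mp : mrV (fun t y => posinv (s t y)) by apply: mrV_comp ms; exact: measurable_posinv.
apply: mrVM; first apply: mrVM.
- apply: (mrV_comp measurable_cutroot); apply: mrVD; first exact: mX.
  by apply: mrV_sum => i; apply: mX.
- exact: mX.
- by apply: mrV_prod => i; apply: (mrV_comp (mB i)); apply: mrVM.
Qed.

Lemma Psi_neq0 a s Y : Psi a s Y != 0 ->
  [/\ 0 < s, a ^+ 2 + \sum_i Y i ^+ 2 <= 1 & forall i, `|Y i| <= L * s].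
Proof.
rewrite /Psi !mulf_eq0 !negb_or => /andP[/andP[w0 p0] B0].
have s0 : 0 < s by move: p0; rewrite /posinv; case: ifP => // _; rewrite expr0n eqxx.
split=> //; first by move: w0; rewrite /cutroot; case: ifP => //; rewrite eqxx.
move=> i; rewrite -ler_pdivrMr//; move: B0; rewrite (bigD1 i)//= mulf_eq0 negb_or.
by move=> /andP[/BL + _]; rewrite posinv_gt0// normrM [`|s^-1|]gtr0_norm ?invr_gt0.
Qed.

Lemma sqrt_sum_le (a : R) (Y : 'I_n -> R) :
  Num.sqrt (a ^+ 2 + \sum_i Y i ^+ 2) <= `|a| + \sum_i `|Y i|.
Proof.
have S0 : 0 <= \sum_i `|Y i| by exact: sumr_ge0.
rewrite -(ler_sqr (x := Num.sqrt _)) ?nnegrE ?sqrtr_ge0 ?addr_ge0//.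
rewrite sqr_sqrtr ?addr_ge0 ?sqr_ge0 ?sumr_ge0// => [|i _]; last exact: sqr_ge0.
have [H _] : \sum_i Y i ^+ 2 <= (\sum_i `|Y i|) ^+ 2 /\ 0 <= \sum_i `|Y i|.
  elim/big_ind2 : _ => [|x1 x2 y1 y2 [h1 h2] [h3 h4]|i _]; first by rewrite expr0n.
    split; last exact: addr_ge0.
    rewrite sqrrD; apply: lerD => //; apply: (le_trans h1).
    by rewrite lerDl mulrn_wge0 ?mulr_ge0.
  by rewrite real_normK ?num_real.
rewrite sqrrD real_normK ?num_real//; apply: lerD => //.
by rewrite lerDl mulrn_wge0 ?mulr_ge0.
Qed.

(** If all slopes are at most [L], the norm of a point is at most [Q] times the value [s] of the
    linear form: its first coordinate is recovered from [s] and the others. *)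
Let Q := (1 + \sum_i `|m i| * L) / `|c| + \sum_(i < n) L.

(** The power of [posinv s] blows up at [s = 0], but only points of a cone on which the norm is at
    most [Q * s] contribute, and there [cutroot] compensates it. *)
Lemma Psi_bound a Y : `|Psi a (c * a + \sum_i m i * Y i) Y| <= Q ^+ n.+1 * M ^+ n.
Proof.
set s := _ + _.
have Q0 : 0 <= Q.
  apply: addr_ge0; last exact: sumr_ge0.
  by rewrite divr_ge0// addr_ge0// sumr_ge0// => i _; rewrite mulr_ge0.
have [->|/Psi_neq0[s0 r1 YL]] := eqVneq (Psi a s Y) 0.
  by rewrite normr0 mulr_ge0 ?exprn_ge0.
rewrite /Psi /cutroot r1 posinv_gt0// -exprMn normrM normrX.
have HP : `|\prod_i B i (Y i * s^-1)| <= M ^+ n.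
  rewrite normr_prod; apply: (@le_trans _ _ (\prod_(i < n) M)).
    by apply: ler_prod => i _; rewrite normr_ge0 BM.
  by rewrite prodr_const card_ord.
apply: ler_pM => //.
rewrite ler_pXn2r ?nnegrE// ger0_norm ?mulr_ge0 ?sqrtr_ge0 ?invr_ge0 ?(ltW s0)//.
rewrite ler_pdivrMr//; apply: (le_trans (sqrt_sum_le _ _)).
rewrite mulrDl; apply: lerD.
  rewrite mulrAC ler_pdivlMr ?normr_gt0// mulrC -normrM.
  have -> : c * a = s - \sum_i m i * Y i by rewrite /s addrK.
  rewrite (le_trans (ler_normB _ _))// mulrDl mul1r gtr0_norm// lerD2l.
  rewrite (le_trans (ler_norm_sum _ _ _))// mulr_suml ler_sum// => i _.
  by rewrite normrM -mulrA ler_wpM2l.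
by rewrite mulr_suml ler_sum.
Qed.

Lemma nice_intro (F : R -> 'rV[R]_n -> R) K S : mrV (F : measurableTypeR R -> _) ->
  0 <= S -> (forall s y, `|F s y| <= K) ->
  (forall s y, F s y != 0 -> `|s| <= S /\ forall i, `|y 0 i| <= S) -> nice F.
Proof.
move=> mF S0 FK FS; split=> //; exists K, S; split=> //.
  by move=> s y; split=> // /FS[].
by move=> s y /FS[].
Qed.

Let S := 1 + `|c| + \sum_i `|m i|.

Lemma Psi_supp a Y : Psi a (c * a + \sum_i m i * Y i) Y != 0 ->
  [/\ `|a| <= 1, forall i, `|Y i| <= 1 & `|c * a + \sum_i m i * Y i| <= `|c| + \sum_i `|m i|].
Proof.
move=> /Psi_neq0[_ h _].
have sq1 (x : R) : x ^+ 2 <= 1 -> `|x| <= 1 by rewrite -{1}[x ^+ 2]real_normK ?num_real// expr_le1.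
have a1 : `|a| <= 1.
  by apply/sq1/(le_trans _ h); rewrite lerDl sumr_ge0// => i _; exact: sqr_ge0.
have Y1 i : `|Y i| <= 1.
  apply/sq1/(le_trans _ h); rewrite (bigD1 i)//= addrCA lerDl addr_ge0 ?sqr_ge0//.
  by rewrite sumr_ge0// => j _; exact: sqr_ge0.
split=> //; apply: (le_trans (ler_normD _ _)); apply: lerD.
  by rewrite normrM ler_piMr.
apply: (le_trans (ler_norm_sum _ _ _)); apply: ler_sum => i _.
by rewrite normrM ler_piMr.
Qed.

Let lin (y : 'rV[R]_n) := \sum_i m i * y 0 i.

Lemma mrV_lin d (T : measurableType d) : mrV (fun (_ : T) => lin).
Proof.
apply: (@mrV_sum _ _ _ T _ _ (fun i (_ : T) (y : 'rV[R]_n) => m i * y 0 i)) => i.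
by apply: mrVM; [exact: mrV_cst|exact: mrV_coord].
Qed.

(** Three stages of the integrand: Cartesian coordinates; then the first coordinate replaced by the
    value [s] of the linear form, with Jacobian [|c|^-1]; then the other coordinates divided by [s],
    with Jacobian [s ^+ n]. In the last one [y] is the vector of slopes and [k y] the first
    coordinate of the direction on which the form is 1. *)
Let F1 x0 (y : 'rV[R]_n) := Psi x0 (c * x0 + lin y) (fun i => y 0 i).
Let F2 s (y : 'rV[R]_n) := `|c|^-1 * Psi ((s - lin y) / c) s (fun i => y 0 i).
Let k (y : 'rV[R]_n) := (1 - lin y) / c.
Let F3 s (y : 'rV[R]_n) := s ^+ n * (`|c|^-1 * Psi (s * k y) s (fun i => s * y 0 i)).

Let F21 s y : F2 s y = `|c|^-1 * F1 ((s - lin y) / c) y.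
Proof. by rewrite /F1 /F2 [c * _]mulrC divfK// subrK. Qed.

Let linZ s y : lin (s *: y) = s * lin y.
Proof. by rewrite /lin mulr_sumr; apply: eq_bigr => i _; rewrite mxE mulrCA. Qed.

Let F32 s y : F3 s y = s ^+ n * F2 s (s *: y).
Proof.
rewrite /F3 /F2 linZ; congr (_ * (_ * Psi _ _ _)).
  by rewrite /k mulrA mulrBr mulr1.
by apply/funext => i; rewrite mxE.
Qed.

Let S0 : 0 <= S.
Proof. by rewrite !addr_ge0// sumr_ge0. Qed.

Let S1 : 1 <= S.
Proof. by rewrite /S -addrA lerDl addr_ge0// sumr_ge0. Qed.

Let SS x : x <= `|c| + \sum_i `|m i| -> x <= S.
Proof. by move=> h; rewrite (le_trans h)// /S -addrA lerDr. Qed.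

Let nice1 : nice F1.
Proof.
apply: (nice_intro (K := Q ^+ n.+1 * M ^+ n) _ S0).
- apply: (@mrV_Psi _ (measurableTypeR R) (fun t _ => t) (fun t y => c * t + lin y) (fun i _ y => y 0 i)).
  + by apply: mrV_cst.
  + apply: mrVD; last exact: mrV_lin.
    by apply: mrV_cst; apply: measurable_funM.
  + by move=> i; apply: mrV_coord.
- by move=> s y; exact: Psi_bound.
- move=> s y /Psi_supp[h1 h2 _]; split; first exact: le_trans h1 S1.
  by move=> i; apply: le_trans (h2 i) S1.
Qed.

Let F2_supp s y : F2 s y != 0 -> `|s| <= S /\ forall i, `|y 0 i| <= S.
Proof.
rewrite F21 mulf_eq0 negb_or => /andP[_ /Psi_supp[_ h2]]; rewrite mulrC divfK// subrK => /SS h; split=> // i.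
exact: le_trans (h2 i) S1.
Qed.

Let mF2 : mrV (F2 : measurableTypeR R -> _).
Proof.
apply: (@mrVM _ _ _ (measurableTypeR R) (fun _ _ => `|c|^-1) _); first exact: mrV_cst.
apply: (@mrV_Psi _ (measurableTypeR R) (fun t y => (t - lin y) / c) (fun t _ => t) (fun i _ y => y 0 i)).
- apply: (@mrVM _ _ _ (measurableTypeR R) (fun t y => t - lin y) _); last exact: mrV_cst.
  apply: (@mrVD _ _ _ (measurableTypeR R) _ (fun _ y => - lin y)); first exact: mrV_cst.
  by apply: (mrV_comp _ (mrV_lin _)); exact: oppr_measurable.
- by apply: mrV_cst.
- by move=> i; apply: mrV_coord.
Qed.

Let nice2 : nice F2.
Proof.
apply: (nice_intro (K := `|c|^-1 * (Q ^+ n.+1 * M ^+ n)) mF2 S0) => // s y.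
by rewrite F21 normrM [`|_^-1|]ger0_norm ?invr_ge0// ler_wpM2l ?invr_ge0//; exact: Psi_bound.
Qed.

Let nice3 : nice F3.
Proof.
apply: (nice_intro (K := S ^+ n * (`|c|^-1 * (Q ^+ n.+1 * M ^+ n))) (S := S + L)).
- apply: (@mrVM _ _ _ (measurableTypeR R) (fun t _ => t ^+ n) _).
    by apply: mrV_cst; exact: exprn_measurable.
  apply: (@mrVM _ _ _ (measurableTypeR R) (fun _ _ => `|c|^-1) _); first exact: mrV_cst.
  apply: (@mrV_Psi _ (measurableTypeR R) (fun t y => t * k y) (fun t _ => t) (fun i t y => t * y 0 i)).
  + apply: mrVM; first exact: mrV_cst.
    apply: (@mrVM _ _ _ (measurableTypeR R) (fun _ y => 1 - lin y) _); last exact: mrV_cst.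
    apply: (@mrVD _ _ _ (measurableTypeR R) _ (fun _ y => - lin y)); first exact: mrV_cst.
    by apply: (mrV_comp _ (mrV_lin _)); exact: oppr_measurable.
  + exact: mrV_cst.
  + by move=> i; apply: mrVM; [exact: mrV_cst|exact: mrV_coord].
- by rewrite addr_ge0.
- move=> s y; have [->|] := eqVneq (F3 s y) 0.
    by rewrite normr0 !mulr_ge0 ?invr_ge0 ?exprn_ge0// addr_ge0// ?sumr_ge0// divr_ge0// addr_ge0//
      sumr_ge0// => i _; rewrite mulr_ge0.
  rewrite F32 mulf_eq0 negb_or => /andP[_ /F2_supp[sS _]].
  rewrite normrM normrX F21; apply: ler_pM; rewrite ?exprn_ge0//.
    by rewrite lerXn2r ?nnegrE.
  rewrite normrM [`|_^-1|]ger0_norm ?invr_ge0// ler_wpM2l ?invr_ge0//; exact: Psi_bound.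
- move=> s y F0; have := F0; rewrite F32 mulf_eq0 negb_or => /andP[_ /F2_supp[sS _]].
  split; first by rewrite (le_trans sS)// lerDl.
  have [s0 _ h i] : [/\ 0 < s, (s * k y) ^+ 2 + \sum_i (s * y 0 i) ^+ 2 <= 1 &
      forall i, `|s * y 0 i| <= L * s].
    apply: Psi_neq0; apply: contra_neq F0; rewrite /F3 => ->; rewrite !mulr0//.
  have := h i; rewrite normrM gtr0_norm// mulrC ler_pM2r// => hh.
  by rewrite (le_trans hh)// lerDr.
Qed.

(** Along the ray of slopes [y] the norm is [s * q], so the integrand is a constant times
    [q ^+ n.+1 * s ^+ n] on []0, q^-1]]. The integral no longer depends on [q], and its factor
    [n.+1%:R^-1] will cancel the dimension in [sphere_integral]. *)
Let F3_integral y : \int[mu]_s F3 s y = (n.+1%:R^-1 * `|c|^-1) * \prod_i B i (y 0 i).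
Proof.
pose q2 := k y ^+ 2 + \sum_i y 0 i ^+ 2.
(* The point with coordinates [k y] and [y] is not 0, since the linear form takes the value 1
   there. *)
have q20 : 0 < q2.
  rewrite lt_neqAle addr_ge0 ?sqr_ge0 ?sumr_ge0// => [|i _]; last exact: sqr_ge0.
  rewrite andbT eq_sym; apply/negP; rewrite paddr_eq0 ?sqr_ge0//; last first.
    by rewrite sumr_ge0// => i _; exact: sqr_ge0.
  rewrite psumr_eq0 => [|i _]; last exact: sqr_ge0.
  rewrite sqrf_eq0 mulf_eq0 invr_eq0 (negbTE c0) orbF => /andP[/eqP h1 /allP h2].
  suff : lin y = 0 by move=> h; move: h1; rewrite h subr0 => /eqP; rewrite oner_eq0.
  apply: big1 => i _; have := h2 i (mem_index_enum _); rewrite /= sqrf_eq0 => /eqP ->.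
  by rewrite mulr0.
pose q := Num.sqrt q2.
have q0 : 0 < q by rewrite sqrtr_gt0.
pose P := `|c|^-1 * \prod_i B i (y 0 i).
have F3E s : F3 s y = ((fun s => (q ^+ n.+1 * P) * s ^+ n) \_ `]0, q^-1]%classic) s.
  rewrite patchE mem_setE in_itv /= /F3 /Psi.
  have [s0|s0] /= := boolP (0 < s); last first.
    by rewrite /posinv (negbTE s0) expr0n !(mulr0, mul0r).
  rewrite posinv_gt0// (_ : _ + _ = s ^+ 2 * q2); last first.
    rewrite exprMn /q2 mulrDr; congr (_ + _); rewrite mulr_sumr.
    by apply: eq_bigr => i _; rewrite exprMn.
  rewrite /cutroot.
  have -> : (s ^+ 2 * q2 <= 1) = (s <= q^-1).
    rewrite -[RHS](ler_pM2r q0) mulVf ?gt_eqF// -[RHS](expr_le1 (n := 2))//; last first.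
      by rewrite mulr_ge0// ltW.
    by rewrite exprMn sqr_sqrtr// ltW.
  case: ifP => _; last by rewrite !mul0r !mulr0.
  rewrite (_ : \prod_(i < n) _ = \prod_i B i (y 0 i)); last first.
    by apply: eq_bigr => i _; rewrite mulrAC mulfV ?mul1r// gt_eqF.
  have -> : Num.sqrt (s ^+ 2 * q2) = s * q by rewrite sqrtrM ?sqr_ge0// sqrtr_sqr gtr0_norm.
  rewrite exprMn /P.
  have : s ^+ n.+1 * s^-1 ^+ n.+1 = 1 by rewrite -exprMn mulfV ?expr1n// gt_eqF.
  move: (s ^+ n.+1) (s^-1 ^+ n.+1) (q ^+ n.+1) (s ^+ n) (`|c|^-1) (\prod_i _) => s1 s2 q1 s3 c1 p1 E.
  have -> : s1 * q1 * s2 = q1 by rewrite mulrAC E mul1r.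
  by rewrite [LHS]mulrC; congr (_ * _); exact: mulrCA.
have qi : 0 < q^-1 by rewrite invr_gt0.
transitivity (\int[mu]_s ((fun s => (q ^+ n.+1 * P) * s ^+ n) \_ `]0, q^-1]%classic) s).
  by apply: eq_Rintegral => s _; exact: F3E.
rewrite -Rintegral_mkcond RintegralZl//; last first.
  apply: (@integrableS _ _ _ mu `[0, q^-1]%classic) => //.
    by apply: subset_itvr; rewrite bnd_simp.
  apply: continuous_compact_integrable; first exact: segment_compact.
  by apply: continuous_subspaceT; exact: exprn_continuous.
rewrite Rintegral_exprn_oc// /P mulrC.
have : q^-1 ^+ n.+1 * q ^+ n.+1 = 1 by rewrite -exprMn mulVf ?expr1n// gt_eqF.
move: (q^-1 ^+ n.+1) (q ^+ n.+1) (n.+1%:R^-1) (`|c|^-1) (\prod_i _) => s1 s2 q1 c1 p1 E.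
rewrite mulrACA E mul1r mulrA; congr (_ * _).
Qed.

Let bsmB i : bsm (B i).
Proof.
split=> //; exists (Num.max M L) => x; split; first by rewrite le_max BM.
by move=> /BL h; rewrite le_max h orbT.
Qed.

(* The first coordinate is traded for the value [s] of the linear form, the
   other coordinates are rescaled by [s], and [s] is integrated out. *)
Lemma iter_Psi : n.+1%:R * (\int[mu]_x0 iter_integral (F1 x0)) =
  `|c|^-1 * \prod_i \int[mu]_x B i x.
Proof.
have F12 : (fun y => \int[mu]_s F1 s y) = (fun y => \int[mu]_s F2 s y).
  apply/funext=> y.
  rewrite [RHS](Rintegral_affine (lin y) c0 (bsm_integrable (nice_bsm y nice2))).
  under [in RHS]eq_Rintegral do rewrite F21 addrK mulrAC mulfV// mul1r.
  rewrite RintegralZl//; last exact: (bsm_integrable (nice_bsm y nice1)).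
  by rewrite mulrA mulfV ?normr_eq0// mul1r.
have sF3 s : iter_integral (F2 s) = iter_integral (F3 s).
  have [s0|s0] := ltP 0 s; last first.
    congr iter_integral; apply/funext=> y; rewrite /F2 /F3 /Psi /posinv ltNge s0 /=.
    by rewrite expr0n !(mulr0, mul0r).
  have [mF [K [S' [S'0 bF _]]]] := nice2.
  have sn0 : s != 0 by rewrite gt_eqF.
  pose G (t : measurableTypeR R) (y : 'rV[R]_n) := F2 s y.
  have mG : mrV G by exact: (mrV_pre (measurable_cst (s : measurableTypeR R)) mF).
  have bG : bbs K S' G by move=> t y; apply: (bF s).
  rewrite -[LHS]/(iter_integral (G s)) (iter_integral_scale (s : measurableTypeR R) sn0 S'0 mG bG).
  have -> : (fun y => G s (s *: y)) = (fun y => s ^- n * F3 s y).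
    by apply/funext=> y; rewrite F32 mulrA mulVf ?mul1r// expf_neq0.
  have [mF3 [K3 [S3 [S30 bF3 _]]]] := nice3.
  rewrite (iter_integralZ _ (s : measurableTypeR R) S30 mF3 bF3).
  by rewrite gtr0_norm// mulrA mulfV ?mul1r// expf_neq0.
rewrite (nice_Fubini nice1) F12 -(nice_Fubini nice2).
transitivity (n.+1%:R * \int[mu]_s iter_integral (F3 s)).
  by congr (_ * _); apply: eq_Rintegral => s _; exact: sF3.
rewrite (nice_Fubini nice3).
have -> : (fun y => \int[mu]_s F3 s y) =
    (fun y => n.+1%:R^-1 / `|c| * \prod_i B i (y 0 i)) by apply/funext=> y.
by rewrite iter_integral_prod// !mulrA mulfV ?mul1r// pnatr_eq0.
Qed.

(** On the half sphere [N > 0] the surface measure is [N ^ (n + 1) / |c|] times Lebesgue measure in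
    the slopes, the quotients of the other coordinates by [N]. The weight removes the power of [N],
    and the integrand then separates. *)
Lemma sphere_integral_prod (g : 'rV[R]_n.+1 -> R) :
  let N (x : 'rV[R]_n.+1) := c * x 0 ord0 + \sum_i m i * x 0 (lift ord0 i) in
  (forall x, enorm x = 1 -> g x =
     posinv (N x) ^+ n.+1 * \prod_i B i (x 0 (lift ord0 i) * posinv (N x))) ->
  sphere_integral g = `|c|^-1 * \prod_i \int[mu]_x B i x.
Proof.
move=> N gE; rewrite -iter_Psi; congr (_ * _).
apply: eq_Rintegral => x0 _; congr iter_integral; apply/funext=> y.
rewrite -/(consV x0 y) /F1 /Psi; set x := consV x0 y.
have eE : enorm x = Num.sqrt (x0 ^+ 2 + \sum_i y 0 i ^+ 2).
  congr Num.sqrt; rewrite /dot big_ord_recl consV0; congr (_ + _).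
  by apply: eq_bigr => i _; rewrite consVS.
set r2 := _ + _ in eE *.
have NE : N x = c * x0 + lin y.
  by rewrite /N consV0; congr (_ + _); apply: eq_bigr => i _; rewrite consVS.
rewrite -NE /cutroot -eE.
have r20 : 0 <= r2 by rewrite addr_ge0 ?sqr_ge0// sumr_ge0// => i _; exact: sqr_ge0.
have -> : (r2 <= 1) = (enorm x <= 1) by rewrite eE -[in RHS]sqrtr1 ler_psqrt ?nnegrE.
have [r0|] /= := ltP 0 (enorm x); last first.
  rewrite le_eqVlt ltNge sqrtr_ge0 orbF => /eqP ->.
  by rewrite expr0n /= if_same !mul0r.
case: ifP => r1; last by rewrite !mul0r.
have NZ a z : N (a *: z) = a * N z.
  rewrite /N mulrDr mulr_sumr !mxE mulrCA; congr (_ + _).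
  by apply: eq_bigr => i _; rewrite mxE mulrCA.
have pE : posinv (N ((enorm x)^-1 *: x)) = enorm x * posinv (N x).
  by rewrite NZ /posinv pmulr_rgt0 ?invr_gt0//; case: ifP; rewrite ?mulr0// invfM invrK.
rewrite gE.
  rewrite pE exprMn; congr (_ * _); apply: eq_bigr => i _.
  by rewrite mxE consVS mulrACA mulVf ?mul1r ?gt_eqF.
have dZ : dot ((enorm x)^-1 *: x) ((enorm x)^-1 *: x) = (enorm x)^-2 * dot x x.
  by rewrite /dot mulr_sumr; apply: eq_bigr => i _; rewrite !mxE mulrACA expr2 invfM.
rewrite /enorm dZ.
have -> : dot x x = enorm x ^+ 2.
  by rewrite sqr_sqrtr// sumr_ge0// => i _; rewrite -expr2 sqr_ge0.
by rewrite mulVf ?sqrtr1// expf_neq0// gt_eqF.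
Qed.
End SphereFormula.

(** * Smooth functions *)

Section DirectionalDerivatives.
Context {R : realType} {V : normedModType R}.
Implicit Types (U W : set V) (f g : V -> R) (x v : V).

(** Restriction to a line turns directional derivatives into ordinary ones, to which the chain rule,
    the mean value theorem and differentiation under the integral apply. *)
Lemma is_derive_line g x v (r a : R) :
  is_derive (r *: v + x) v g a <-> is_derive r 1 (fun s : R => g (s *: v + x)) a.
Proof.
have E : (fun h : R => h^-1 *: ((g \o shift (r *: v + x)) (h *: v) - g (r *: v + x))) =
   (fun h : R => h^-1 *: (((fun s : R => g (s *: v + x)) \o shift r) (h *: (1 : R)) - g (r *: v + x))).
  apply/funext=> h /=; congr (_ *: (g _ - _)).
  by rewrite [_ *: (1 : R)]mulr1 scalerDl addrA.
split=> -[d da]; apply: DeriveDef.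
- by rewrite /derivable -E.
- by rewrite /derive -E.
- by rewrite /derivable E.
- by rewrite /derive E.
Qed.

Lemma is_derive_affine g x v (a : R) :
  (forall h : R, g (h *: v + x) = h * a + g x) -> is_derive x v g a.
Proof.
move=> ga; have : is_derive (0 : R) 1 (fun s : R => a * s + g x) a.
  apply: (is_derive_eq (is_deriveD (is_deriveZ a (is_derive_id (0 : R) (1 : R)))
    (is_derive_cst (g x) (0 : R) (1 : R)))).
  by rewrite addr0; apply: mulr1.
rewrite (_ : (fun s => _) = (fun s : R => g (s *: v + x))); last first.
  by apply/funext=> s; rewrite ga mulrC.
by move=> /is_derive_line; rewrite scale0r add0r.
Qed.

Lemma is_derive_comp1 (h : R -> R) g x v (a b : R) :
  is_derive x v g a -> is_derive (g x) 1 h b -> is_derive x v (h \o g) (b * a).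
Proof.
move=> dg dh.
have dg0 : is_derive (0 : R) 1 (fun s : R => g (s *: v + x)) a.
  by apply/is_derive_line; rewrite scale0r add0r.
have dh0 : is_derive ((fun s : R => g (s *: v + x)) 0) 1 h b by rewrite scale0r add0r.
have D : is_derive (0 : R) 1 (fun s : R => (h \o g) (s *: v + x)) (b * a).
  exact: (is_derive_eq (is_derive1_comp dh0 dg0)).
by move/is_derive_line : D; rewrite scale0r add0r.
Qed.

Lemma is_deriveV g x v (a : R) : g x != 0 -> is_derive x v g a ->
  is_derive x v (fun y => (g y)^-1) (- (g x) ^- 2 * a).
Proof. by move=> gx [dg <-]; apply: DeriveDef; [exact: derivableV|rewrite deriveV]. Qed.

Lemma is_derive_mul f g x v (a b : R) : is_derive x v f a -> is_derive x v g b ->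
  is_derive x v (fun y => f y * g y) (f x * b + g x * a).
Proof. by move=> df dg; apply: is_derive_eq (is_deriveM df dg) _. Qed.

Lemma is_derive_add f g x v (a b : R) : is_derive x v f a -> is_derive x v g b ->
  is_derive x v (fun y => f y + g y) (a + b).
Proof. by move=> df dg; exact: is_deriveD. Qed.

Lemma is_derive_scale (c : R) f x v (a : R) : is_derive x v f a ->
  is_derive x v (fun y => c * f y) (c * a).
Proof. by move=> df; exact: is_deriveZ. Qed.

Lemma is_derive_on_ext U f g x v a : open U -> U x -> (forall y, U y -> f y = g y) ->
  is_derive x v f a -> is_derive x v g a.
Proof.
move=> oU Ux fg; apply: near_eq_is_derive.
by apply: filterS (open_nbhs_nbhs (conj oU Ux)) => y /fg.
Qed.

Lemma continuous_on_ext U f g x : open U -> U x -> (forall y, U y -> f y = g y) ->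
  {for x, continuous f} -> {for x, continuous g}.
Proof.
move=> oU Ux fg fx; have gx : g x = f x by rewrite fg.
rewrite /prop_for /continuous_at gx; apply: cvg_trans fx.
apply: near_eq_cvg; apply: filterS (open_nbhs_nbhs (conj oU Ux)) => y /fg //.
Qed.
End DirectionalDerivatives.

Section SmoothFunctions.
Context {R : realType} {V : normedModType R}.
Implicit Types (U W : set V) (f g : V -> R) (x v : V).

Lemma Ck_onW k U g : Ck_on k.+1 U g -> Ck_on k U g.
Proof.
elim: k g => [|k IH] g [gc gD]; first by split.
by split=> // v; have [h /IH] := gD v.
Qed.

Lemma Ck_on_ext k U f g : open U -> (forall y, U y -> f y = g y) -> Ck_on k U f -> Ck_on k U g.
Proof.
move=> oU; elim: k f g => [|k IH] f g fg [fc fD].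
  by split=> // x Ux; apply: continuous_on_ext fg _ => //; exact: fc.
split=> [x Ux|v]; first by apply: continuous_on_ext fg _ => //; exact: fc.
have [df cf] := fD v.
have dg x : U x -> is_derive x v g ('D_v f x).
  by move=> Ux; apply: (is_derive_on_ext oU Ux fg); exact/derivableP/df.
split=> [x /dg[]//|].
by apply: IH cf => y /dg [_ ->].
Qed.

Lemma Ck_onD k U f g : open U -> Ck_on k U f -> Ck_on k U g -> Ck_on k U (fun x => f x + g x).
Proof.
move=> oU; elim: k f g => [|k IH] f g [fc fD] [gc gD].
  by split=> // x Ux; apply: cvgD; [exact: fc|exact: gc].
split=> [x Ux|v]; first by apply: cvgD; [exact: fc|exact: gc].
have [df cf] := fD v; have [dg cg] := gD v.
have dfg x : U x -> is_derive x v (fun x => f x + g x) ('D_v f x + 'D_v g x).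
  by move=> Ux; apply: is_derive_add; [exact/derivableP/df|exact/derivableP/dg].
split=> [x /dfg[]//|].
by apply: (Ck_on_ext oU _ (IH _ _ cf cg)) => x /dfg[_ ->].
Qed.

Lemma Ck_onM k U f g : open U -> Ck_on k U f -> Ck_on k U g -> Ck_on k U (fun x => f x * g x).
Proof.
move=> oU; elim: k f g => [|k IH] f g.
  by move=> [fc fD] [gc gD]; split=> // x Ux; apply: cvgM; [exact: fc|exact: gc].
move=> Cf Cg; have [[fc fD] [gc gD]] := (Cf, Cg).
split=> [x Ux|v]; first by apply: cvgM; [exact: fc|exact: gc].
have [df cf] := fD v; have [dg cg] := gD v.
have dfg x : U x -> is_derive x v (fun x => f x * g x) (f x * 'D_v g x + g x * 'D_v f x).
  by move=> Ux; apply: is_derive_mul; [exact/derivableP/df|exact/derivableP/dg].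
split=> [x /dfg[]//|].
by apply: (Ck_on_ext oU _ (Ck_onD oU (IH _ _ (Ck_onW Cf) cg) (IH _ _ (Ck_onW Cg) cf))) =>
  x /dfg[_ ->].
Qed.

(** Smoothness by coinduction, for families whose derivatives have a closed form within the family:
    the induction on the order of differentiability is made once and for all. *)
Lemma smooth_coind (P : (V -> R) -> Prop) U : open U ->
  (forall g, P g -> (forall x, U x -> {for x, continuous g}) /\
     forall v, exists2 g', P g' & forall x, U x -> is_derive x v g (g' x)) ->
  forall g, P g -> smooth_on U g.
Proof.
move=> oU PH g Pg k; elim: k g Pg => [|k IH] g Pg; first by have [h _] := PH _ Pg.
have [gc gD] := PH _ Pg; split=> // v; have [g' Pg' gg'] := gD v.
split=> [x /gg'[]//|].
by apply: (Ck_on_ext oU _ (IH _ Pg')) => x /gg'[_ ->].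
Qed.

Lemma smooth_continuous U g x : smooth_on U g -> U x -> {for x, continuous g}.
Proof. by move=> /(_ 0%N)[h _]; exact: h. Qed.

Lemma smooth_is_derive U g x v : smooth_on U g -> U x -> is_derive x v g ('D_v g x).
Proof. by move=> /(_ 1%N)[_ /(_ v)[h _]] Ux; exact/derivableP/h. Qed.

Lemma smooth_derive U g v : smooth_on U g -> smooth_on U ('D_v g).
Proof. by move=> gs k; have [_ /(_ v)[]] := gs k.+1. Qed.

Lemma smooth_ext U f g : open U -> (forall y, U y -> f y = g y) ->
  smooth_on U f -> smooth_on U g.
Proof. by move=> oU fg sf k; exact: Ck_on_ext fg (sf k). Qed.

Lemma smoothD U f g : open U -> smooth_on U f -> smooth_on U g ->
  smooth_on U (fun x => f x + g x).
Proof. by move=> oU sf sg k; exact: Ck_onD. Qed.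

Lemma smoothM U f g : open U -> smooth_on U f -> smooth_on U g ->
  smooth_on U (fun x => f x * g x).
Proof. by move=> oU sf sg k; exact: Ck_onM. Qed.

Lemma smooth_affine U g : open U -> (forall x, {for x, continuous g}) ->
  (forall v, exists a, forall x, is_derive x v g a) -> smooth_on U g.
Proof.
move=> oU gc gD.
pose P f := f = g \/ exists a : R, f = cst a.
apply: (@smooth_coind P) => //; last by left.
move=> f [->|[a ->]]; split=> //.
- by move=> v; have [a ga] := gD v; exists (cst a) => //; right; exists a.
- by move=> x _; exact: cst_continuous.
- by move=> v; exists (cst 0); [right; exists 0|move=> x _; exact: is_derive_cst].
Qed.

Lemma smooth_cst U (a : R) : open U -> smooth_on U (fun=> a).
Proof.
move=> oU; apply: smooth_affine => // [x|v]; first exact: cst_continuous.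
by exists 0 => x; exact: is_derive_cst.
Qed.

Lemma smoothZ U (a : R) g : open U -> smooth_on U g -> smooth_on U (fun x => a * g x).
Proof. by move=> oU sg; apply: smoothM => //; exact: smooth_cst. Qed.

Lemma smoothN U g : open U -> smooth_on U g -> smooth_on U (fun x => - g x).
Proof. by move=> oU sg; apply: (smooth_ext oU _ (smoothZ (-1) oU sg)) => x _; rewrite mulN1r. Qed.

Lemma smoothB U f g : open U -> smooth_on U f -> smooth_on U g ->
  smooth_on U (fun x => f x - g x).
Proof. by move=> oU sf sg; apply: smoothD => //; exact: smoothN. Qed.

Lemma smoothX U g n : open U -> smooth_on U g -> smooth_on U (fun x => g x ^+ n).
Proof.
move=> oU sg; elim: n => [|n IH]; first exact: smooth_cst.
by apply: (smooth_ext oU _ (smoothM oU sg IH)) => x _; rewrite exprS.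
Qed.

Lemma smooth_sum U I (r : seq I) (F : I -> V -> R) : open U ->
  (forall i, smooth_on U (F i)) -> smooth_on U (fun x => \sum_(i <- r) F i x).
Proof.
move=> oU sF; elim: r => [|i r IH].
  by apply: (smooth_ext oU _ (smooth_cst 0 oU)) => x _; rewrite big_nil.
by apply: (smooth_ext oU _ (smoothD oU (sF i) IH)) => x _; rewrite big_cons.
Qed.

Lemma smooth_prod U I (r : seq I) (F : I -> V -> R) : open U ->
  (forall i, smooth_on U (F i)) -> smooth_on U (fun x => \prod_(i <- r) F i x).
Proof.
move=> oU sF; elim: r => [|i r IH].
  by apply: (smooth_ext oU _ (smooth_cst 1 oU)) => x _; rewrite big_nil.
by apply: (smooth_ext oU _ (smoothM oU (sF i) IH)) => x _; rewrite big_cons.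
Qed.

Lemma smoothV U g : open U -> (forall x, U x -> g x != 0) -> smooth_on U g ->
  smooth_on U (fun x => (g x)^-1).
Proof.
move=> oU g0 sg k; elim: k => [|k IH].
  by split=> // x Ux; apply: cvgV; [exact: g0|exact: smooth_continuous sg Ux].
split=> [x Ux|v]; first by apply: cvgV; [exact: g0|exact: smooth_continuous sg Ux].
have dg x : U x -> is_derive x v (fun x => (g x)^-1) (- (g x) ^- 2 * 'D_v g x).
  by move=> Ux; apply: is_deriveV; [exact: g0|exact: smooth_is_derive sg Ux].
split=> [x /dg[]//|].
have C := Ck_onM oU (Ck_onM oU IH IH) (smoothN oU (smooth_derive v sg) k).
by apply: (Ck_on_ext oU _ C) => x /dg [_ ->]; rewrite mulrN mulNr expr2 invfM.
Qed.
End SmoothFunctions.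

Section SmoothComposition.
Context {R : realType} {V : normedModType R}.

Lemma smooth_comp (U : set V) (W : set R) (h : R -> R) (g : V -> R) : open U ->
  (forall x, U x -> W (g x)) -> smooth_on W h -> smooth_on U g ->
  smooth_on U (fun x => h (g x)).
Proof.
move=> oU UW sh sg k; elim: k h sh => [|k IH] h sh.
  split=> // x Ux; apply: (@continuous_comp _ _ _ g h); first exact: smooth_continuous sg Ux.
  by apply: (smooth_continuous sh); exact: UW.
split=> [x Ux|v].
  apply: (@continuous_comp _ _ _ g h); first exact: smooth_continuous sg Ux.
  by apply: (smooth_continuous sh); exact: UW.
have dg x : U x -> is_derive x v (fun x => h (g x)) ('D_(1 : R) h (g x) * 'D_v g x).
  move=> Ux; apply: (is_derive_comp1 (smooth_is_derive v sg Ux)).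
  by apply: (smooth_is_derive _ sh); exact: UW.
split=> [x /dg[]//|].
have C := Ck_onM oU (IH _ (smooth_derive (1 : R) sh)) (smooth_derive v sg k).
by apply: (Ck_on_ext oU _ C) => x /dg [_ ->].
Qed.
End SmoothComposition.

(** * Flat functions and smooth steps on the line *)

Section OneVariable.
Context {R : realType}.
Implicit Types (x v : R).

Lemma is_derive_dir (h : R -> R) x v a : is_derive x (1 : R) h a -> is_derive x v h (a * v).
Proof. by move=> dh; exact: (is_derive_comp1 (is_derive_id x v) dh). Qed.

Lemma smooth_id (U : set R) : open U -> smooth_on U (fun x : R => x).
Proof.
move=> oU; apply: smooth_affine => // [x|v]; first exact: cvg_id.
by exists v => x; exact: is_derive_id.
Qed.

(* [x^-k exp (-1/x)], extended by 0: the derivatives of [exp (-1/x)] are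
   combinations of these. *)
Definition flat (k : nat) (x : R) : R := if 0 < x then x^-1 ^+ k * expR (- x^-1) else 0.

Lemma flat_le0 k x : x <= 0 -> flat k x = 0.
Proof. by rewrite /flat ltNge => ->. Qed.

Lemma flat_ge0 k x : 0 <= flat k x.
Proof.
rewrite /flat; case: ifP => // x0.
by rewrite mulr_ge0 ?expR_ge0// exprn_ge0// invr_ge0 ltW.
Qed.

Lemma flat0_gt0 x : (0 < flat 0 x) = (0 < x).
Proof. by rewrite /flat; case: ifP => [_|]; rewrite ?ltxx// expr0 mul1r expR_gt0. Qed.

(** The inequality [1 + t <= exp t] at [t = y / (k + 1)], raised to the power [k + 1], bounds
    [y ^ (k + 1)] by a multiple of [exp y], where [y = 1 / x]. *)
Lemma flat_bound k x : `|flat k x| <= k.+1%:R ^+ k.+1 * `|x|.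
Proof.
rewrite ger0_norm ?flat_ge0// /flat; case: ifP => x0; last first.
  by rewrite mulr_ge0// exprn_ge0.
set y := x^-1; have y0 : 0 < y by rewrite invr_gt0.
have E1 : y <= k.+1%:R * expR (y / k.+1%:R).
  rewrite mulrC -ler_pdivrMr ?ltr0n//; apply: le_trans (expR_ge1Dx _).
  by rewrite lerDr.
have : y ^+ k.+1 <= k.+1%:R ^+ k.+1 * expR y.
  rewrite -[X in expR X](divfK (x := k.+1%:R)) ?pnatr_eq0//.
  by rewrite expRM_natr -exprMn lerXn2r// nnegrE ?(ltW y0)//.
rewrite expRN -ler_pdivrMr ?expR_gt0// => h.
have xE : x = y^-1 by rewrite invrK.
by rewrite gtr0_norm// [X in _ <= _ * X]xE ler_pdivlMr// mulrAC -exprSr.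
Qed.

Lemma cvg_flat0 k : flat k x @[x --> 0^'] --> (0 : R).
Proof.
apply/cvgr0Pnorm_lt => e e0.
have C0 : 0 < (k.+1%:R : R) ^+ k.+1 by rewrite exprn_gt0.
near=> x; rewrite (le_lt_trans (flat_bound _ _))// mulrC -ltr_pdivlMr//.
near: x; apply: dnbhs0_lt; exact: divr_gt0.
Unshelve. all: by end_near. Qed.

(** At 0 the difference quotient of [flat k] is [flat k.+1], which tends to 0. *)
Lemma is_derive_flat k x :
  is_derive x (1 : R) (flat k) (- k%:R * flat k.+1 x + flat k.+2 x).
Proof.
have [x0|x0|->] := ltgtP x 0.
- apply: (@is_derive_on_ext R R [set y | y < 0] (cst 0)) => //.
  + by move=> y /= /ltW y0; rewrite flat_le0.
  + rewrite !flat_le0 ?ltW// mulr0 addr0; exact: is_derive_cst.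
- apply: (@is_derive_on_ext R R [set y | 0 < y] (fun y => y^-1 ^+ k * expR (- y^-1))) => //.
  + by move=> y /= y0; rewrite /flat y0.
  + have dV : is_derive x (1 : R) (fun y : R => y^-1) (- x ^- 2 * 1).
      by apply: is_deriveV (is_derive_id x 1); rewrite gt_eqF.
    have dX : is_derive x (1 : R) (fun y : R => y^-1 ^+ k) ((k%:R * x^-1 ^+ k.-1) * (- x ^- 2 * 1)).
      apply: (@is_derive_comp1 _ _ (fun y => y ^+ k) _ _ _ _ _ dV).
      by apply: DeriveDef; [exact: exprn_derivable|rewrite exp_derive [_ *: 1]mulr1].
    have dN : is_derive x (1 : R) (fun y : R => - y^-1) (x ^- 2).
      by apply: (is_derive_eq (is_deriveN dV)); rewrite mulr1 opprK.
    have dE : is_derive x (1 : R) (fun y : R => expR (- y^-1)) (expR (- x^-1) * x ^- 2).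
      exact: (@is_derive_comp1 _ _ expR _ _ _ _ _ dN).
    apply: (is_derive_eq (is_derive_mul dX dE)).
    rewrite /flat x0 -!exprVn; move: (x^-1) (expR _) => y e.
    case: k {dX} => [|k]; first by rewrite !expr0 !mul0r; ring.
    by rewrite -pred_Sn !exprS; ring.
- rewrite !flat_le0// mulr0 addr0.
  have F : (fun h : R => h^-1 *: ((flat k \o shift 0) (h *: 1) - flat k 0)) @ 0^' --> (0 : R).
    apply: cvg_trans (cvg_flat0 k.+1); apply: near_eq_cvg; near=> h.
    rewrite /= addr0 [_ *: 1]mulr1 [X in _ - X]flat_le0// subr0 /flat.
    have h0 : h != 0 by near: h; exact: nbhs_dnbhs_neq.
    case: ifP => h1; last by rewrite scaler0.
    by rewrite exprS -mulrA.
  by apply: DeriveDef; [apply/cvg_ex; exists 0|exact/cvg_lim].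
Unshelve. all: by end_near. Qed.

Lemma smooth_flat k : smooth_on setT (flat k).
Proof.
move=> N; elim: N k => [|N IH] k.
  split=> // x _; apply: differentiable_continuous; apply/derivable1_diffP.
  by have [] := is_derive_flat k x.
split=> [x _|v].
  apply: differentiable_continuous; apply/derivable1_diffP.
  by have [] := is_derive_flat k x.
have D x : is_derive x v (flat k) (v * (- k%:R * flat k.+1 x + flat k.+2 x)).
  by rewrite mulrC; exact/is_derive_dir/is_derive_flat.
split=> [x _|]; first by have [] := D x.
have oT : open [set: R] by exact: openT.
have C := Ck_onM oT (smooth_cst v oT N) (Ck_onD oT (Ck_onM oT (smooth_cst (- k%:R) oT N) (IH k.+1)) (IH k.+2)).
by apply: (Ck_on_ext oT _ C) => x _; have [_ ->] := D x.
Qed.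

Definition sstep (x : R) : R := flat 0 x / (flat 0 x + flat 0 (1 - x)).

Lemma sstep_den x : 0 < flat 0 x + flat 0 (1 - x).
Proof.
have [x0|x0] := ltP 0 x; first by rewrite ltr_pwDl ?flat_ge0// flat0_gt0.
by rewrite ltr_wpDl ?flat_ge0// flat0_gt0; lra.
Qed.

Lemma sstep0 x : x <= 0 -> sstep x = 0.
Proof. by move=> x0; rewrite /sstep flat_le0// mul0r. Qed.

Lemma sstep1 x : 1 <= x -> sstep x = 1.
Proof.
move=> x1; rewrite /sstep (@flat_le0 _ (1 - x)) ?subr_le0// addr0 mulfV// gt_eqF//.
by rewrite flat0_gt0; lra.
Qed.

Lemma sstep_ge0 x : 0 <= sstep x.
Proof. by rewrite divr_ge0 ?flat_ge0// ltW// sstep_den. Qed.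

Lemma sstep_gt0 x : 0 < x -> 0 < sstep x.
Proof. by move=> x0; rewrite divr_gt0 ?sstep_den// flat0_gt0. Qed.

Lemma smooth_affine1 (a b : R) : smooth_on setT (fun x : R => a * x + b).
Proof.
have oT : open [set: R] by exact: openT.
by apply: smoothD => //; [apply: smoothZ => //; exact: smooth_id|exact: smooth_cst].
Qed.

Lemma smooth_sstep : smooth_on setT sstep.
Proof.
have oT : open [set: R] by exact: openT.
have s1 : smooth_on setT (fun x : R => flat 0 (1 - x)).
  apply: (smooth_comp (W := setT) oT _ (smooth_flat 0)) => //.
  by apply: (smooth_ext oT _ (smooth_affine1 (-1) 1)) => x _; rewrite mulN1r addrC.
apply: smoothM => //; first exact: smooth_flat.
apply: smoothV => // [x _|]; first by rewrite gt_eqF// sstep_den.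
by apply: smoothD => //; exact: smooth_flat.
Qed.
End OneVariable.

Notation smooth := (smooth_on setT).

(** * Mean values and symmetry of mixed derivatives *)

Section MeanValue.
Context {R : realType} {V : normedModType R}.
Implicit Types (g : V -> R) (x u v : V).

Lemma smooth_mvt g x v (h : R) : smooth g -> 0 <= h ->
  exists2 k, 0 <= k <= h & g (h *: v + x) - g x = 'D_v g (k *: v + x) * h.
Proof.
move=> sg h0.
have D (r : R) : is_derive r 1 (fun s : R => g (s *: v + x)) ('D_v g (r *: v + x)).
  exact: ((is_derive_line g x v r _).1 (smooth_is_derive v sg (I : [set: V] (r *: v + x)))).
have [|k kh] := @MVT_segment R (fun s => g (s *: v + x)) (fun s => 'D_v g (s *: v + x)) 0 h h0 (fun r _ => D r).
  apply: continuous_subspaceT => r; apply: differentiable_continuous.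
  by apply/derivable1_diffP; have [] := D r.
by rewrite subr0 scale0r add0r => ->; exists k => //; move: kh; rewrite in_itv.
Qed.

(** The second difference of [g] over a parallelogram of sides [h u] and [h v] equals [h ^ 2] times
    either mixed derivative at some nearby point, by two applications of the mean value theorem;
    continuity of both derivatives concludes. *)
Lemma smooth_schwarz g u v : smooth g -> 'D_u ('D_v g) = 'D_v ('D_u g).
Proof.
move=> sg; apply/funext=> x.
have second a b (h : R) : 0 < h -> exists k l : R, [/\ 0 <= k <= h, 0 <= l <= h &
    g (h *: a + (h *: b + x)) - g (h *: a + x) - (g (h *: b + x) - g x) =
    'D_b ('D_a g) (l *: b + (k *: a + x)) * h * h].
  move=> h0; pose G y := g (h *: b + y) - g y.
  have oT : open [set: V] by exact: openT.
  have sgb : smooth (fun y => g (h *: b + y)).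
    apply: (@smooth_coind _ _ (fun f => exists2 f', smooth f' & f = fun y => f' (h *: b + y))) => //.
      move=> f [f' sf' ->]; split=> [y _|w].
        apply: continuous_comp; last exact: (smooth_continuous sf').
        by apply: cvgD; [exact: cvg_cst|exact: cvg_id].
      exists (fun y => 'D_w f' (h *: b + y)) => [|y _].
        by exists ('D_w f') => //; exact: smooth_derive.
      have H := (is_derive_line f' (h *: b + y) w 0 _).1
        (smooth_is_derive w sf' (I : [set: V] (0 *: w + (h *: b + y)))).
      have : is_derive (0 *: w + y) w (fun y => f' (h *: b + y)) ('D_w f' (0 *: w + (h *: b + y))).
        apply: (is_derive_line (fun y => f' (h *: b + y)) y w 0 _).2.
        rewrite (_ : (fun s => _) = (fun s : R => f' (s *: w + (h *: b + y)))) //.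
        by apply/funext=> s; rewrite addrCA.
      by rewrite scale0r !add0r.
    by exists g.
  have sG : smooth G by exact: smoothB.
  have [k kh E] := smooth_mvt x a sG (ltW h0).
  have DG y : 'D_a G y = 'D_a g (h *: b + y) - 'D_a g y.
    have H1 := smooth_is_derive a sg (I : [set: V] y).
    have H2 := (is_derive_line g (h *: b + y) a 0 _).1
      (smooth_is_derive a sg (I : [set: V] (0 *: a + (h *: b + y)))).
    have H3 : is_derive (0 *: a + y) a (fun y => g (h *: b + y)) ('D_a g (0 *: a + (h *: b + y))).
      apply: (is_derive_line (fun y => g (h *: b + y)) y a 0 _).2.
      rewrite (_ : (fun s => _) = (fun s : R => g (s *: a + (h *: b + y)))) //.
      by apply/funext=> s; rewrite addrCA.
    rewrite !scale0r !add0r in H3.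
    by have [_ ->] := is_deriveB H3 H1.
  have [l lh E'] := smooth_mvt (k *: a + x) b (smooth_derive a sg) (ltW h0).
  exists k, l; split=> //; rewrite -E' -DG -E /G.
  by rewrite [h *: b + (_ + _)]addrCA; lra.
apply/eqP; rewrite -subr_eq0 -normr_le0; apply/ler_addgt0Pr => e e0.
rewrite add0r.
have e20 : 0 < e / 2 by rewrite divr_gt0.
have c1 := smooth_continuous (smooth_derive u (smooth_derive v sg)) (I : [set: V] x).
have c2 := smooth_continuous (smooth_derive v (smooth_derive u sg)) (I : [set: V] x).
move/cvgrPdist_lt : c1 => /(_ _ e20) N1.
move/cvgrPdist_lt : c2 => /(_ _ e20) N2.
have N12 : nbhs x (fun y => `|'D_u ('D_v g) x - 'D_u ('D_v g) y| < e / 2 /\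
    `|'D_v ('D_u g) x - 'D_v ('D_u g) y| < e / 2) by exact: filterI N1 N2.
have [r /= r0 Hr] := (nbhs_ballP _ _).1 N12.
pose h := r / 2 / (`|u| + `|v| + 1).
have D0 : 0 < `|u| + `|v| + 1 by rewrite ltr_wpDl// addr_ge0.
have h0 : 0 < h by rewrite !divr_gt0.
have hb (k l : R) a b : `|a| + `|b| <= `|u| + `|v| -> 0 <= k <= h -> 0 <= l <= h -> ball x r (l *: b + (k *: a + x)).
  move=> ab /andP[k0 kh] /andP[l0 lh].
  rewrite -ball_normE /= addrA opprD addrCA subrr addr0 normrN.
  rewrite (le_lt_trans (ler_normD _ _))// !normrZ !ger0_norm//.
  have : l * `|b| + k * `|a| <= h * (`|a| + `|b|).
    by rewrite mulrDr addrC lerD// ler_wpM2r.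
  move=> /le_lt_trans; apply.
  apply: (@le_lt_trans _ _ (h * (`|u| + `|v| + 1))).
    rewrite ler_wpM2l ?(ltW h0)// (le_trans ab)// lerDl//.
  by rewrite /h divfK ?gt_eqF// ltr_pdivrMr//; lra.
have [k [l [kh lh E1]]] := second u v h h0.
have [k' [l' [kh' lh' E2]]] := second v u h h0.
have [_ H2] := Hr _ (hb k l u v (lexx _) kh lh).
have vu : `|v| + `|u| <= `|u| + `|v| by rewrite addrC.
have [H1 _] := Hr _ (hb k' l' v u vu kh' lh').
have EE : 'D_v ('D_u g) (l *: v + (k *: u + x)) = 'D_u ('D_v g) (l' *: u + (k' *: v + x)).
  have hn0 : h != 0 by rewrite gt_eqF.
  apply: (mulIf hn0); apply: (mulIf hn0).
  apply: (etrans (esym E1)); apply: (etrans _ E2).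
  rewrite [h *: v + (h *: u + _)]addrCA.
  move: (g (h *: u + (h *: v + x))) (g (h *: u + x)) (g (h *: v + x)) (g x) => a b c e'.
  by rewrite !opprD !opprK addrACA.
rewrite {}EE in H2; move: H1 H2.
generalize ('D_u ('D_v g) (l' *: u + (k' *: v + x))) ('D_u ('D_v g) x) ('D_v ('D_u g) x).
move=> p q q' H1 H2.
have -> : q - q' = (q - p) - (q' - p) by rewrite opprB addrA subrK.
apply: (le_trans (ler_normB _ _)); rewrite (splitr e).
by apply: lerD; apply: ltW.
Qed.
End MeanValue.

Section Coordinates.
Context {R : realType} {d : nat}.
Implicit Types (g : 'rV[R]_d -> R) (i : 'I_d) (U K B : set 'rV[R]_d).

Lemma is_derive_coord (x v : 'rV[R]_d) i : is_derive x v (fun y : 'rV[R]_d => y 0 i) (v 0 i).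
Proof. by apply: is_derive_affine => h; rewrite !mxE. Qed.

Lemma continuous_coord i : continuous (fun y : 'rV[R]_d => y 0 i).
Proof. exact: coord_continuous. Qed.

Lemma smooth_coord U i : open U -> smooth_on U (fun x : 'rV[R]_d => x 0 i).
Proof.
move=> oU; apply: smooth_affine => // [x|v]; first exact: continuous_coord.
by exists (v 0 i) => x; exact: is_derive_coord.
Qed.

Let oT : open [set: 'rV[R]_d] := @openT _.

Lemma smooth_partial s g : smooth g -> smooth (partial s g).
Proof. by move=> sg; elim: s => //= i s IH; exact: smooth_derive. Qed.

Lemma partial_rcons s i g : partial (rcons s i) g = partial s ('D_(delta_mx 0 i) g).
Proof. by rewrite /partial foldr_rcons. Qed.

Lemma derive_add v f g : smooth f -> smooth g ->
  'D_v (fun x => f x + g x) = (fun x => 'D_v f x + 'D_v g x).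
Proof.
move=> sf sg; apply/funext=> x.
have Df := smooth_is_derive v sf (I : [set: 'rV[R]_d] x).
have Dg := smooth_is_derive v sg (I : [set: 'rV[R]_d] x).
by have [_ ->] := is_derive_add Df Dg.
Qed.

Lemma derive_mul v f g : smooth f -> smooth g ->
  'D_v (fun x => f x * g x) = (fun x => 'D_v f x * g x + f x * 'D_v g x).
Proof.
move=> sf sg; apply/funext=> x.
have Df := smooth_is_derive v sf (I : [set: 'rV[R]_d] x).
have Dg := smooth_is_derive v sg (I : [set: 'rV[R]_d] x).
by have [_ ->] := is_derive_mul Df Dg; rewrite addrC mulrC.
Qed.

Lemma partialD s f g : smooth f -> smooth g ->
  partial s (fun x => f x + g x) = (fun x => partial s f x + partial s g x).
Proof.
move=> sf sg; elim: s => //= i s ->.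
by rewrite derive_add//; exact: smooth_partial.
Qed.

Lemma partial_on_eq0 s g U : open U -> (forall x, U x -> g x = 0) ->
  forall x, U x -> partial s g x = 0.
Proof.
move=> oU; elim: s => //= i s IH g0 x Ux.
have : is_derive x (delta_mx 0 i) (partial s g) 0.
  have E y : U y -> cst 0 y = partial s g y by move=> Uy; rewrite IH.
  exact: (is_derive_on_ext oU Ux E (is_derive_cst 0 x _)).
by case.
Qed.

(** Uniform bounds stand in for the suprema of [Cn_seminorm] in all estimates below. *)
Definition bounded_partials (N : nat) B g (e : R) : Prop :=
  forall s, (size s <= N)%N -> forall x, B x -> `|partial s g x| <= e.

Lemma bounded_partialsW N N' B g e : (N <= N')%N ->
  bounded_partials N' B g e -> bounded_partials N B g e.
Proof. by move=> NN' H s sN; apply: H; exact: leq_trans NN'. Qed.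

Lemma bounded_partials_derive N B g e i : bounded_partials N.+1 B g e ->
  bounded_partials N B ('D_(delta_mx 0 i) g) e.
Proof. by move=> H s sN x Bx; rewrite -partial_rcons; apply: H => //; rewrite size_rcons. Qed.

(** Leibniz rule: each differentiation splits a product in two, whence the factor [2 ^+ N]. *)
Lemma bounded_partialsM N B f g e e' : smooth f -> smooth g -> 0 <= e ->
  bounded_partials N B f e -> bounded_partials N B g e' ->
  bounded_partials N B (fun x => f x * g x) (2 ^+ N * (e * e')).
Proof.
move=> sf sg e0; elim: N f g sf sg => [|N IH] f g sf sg Hf Hg s sN x Bx.
  move: sN; rewrite leqn0 size_eq0 => /eqP -> /=; rewrite expr0 mul1r normrM.
  by apply: ler_pM => //; [exact: (Hf [::])|exact: (Hg [::])].
have e'0 : 0 <= e' by apply: le_trans (Hg [::] _ x Bx).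
case: (lastP s) sN => [_ /=|{}s i].
  rewrite normrM (@le_trans _ _ (e * e'))//.
    by apply: ler_pM => //; [exact: (Hf [::])|exact: (Hg [::])].
  by rewrite ler_peMl ?mulr_ge0// exprn_ege1// ler1n.
rewrite size_rcons ltnS => sN; rewrite partial_rcons derive_mul// partialD.
- rewrite (le_trans (ler_normD _ _))// exprS -mulrA mulr_natl mulr2n; apply: lerD.
    by apply: IH => //; [exact: smooth_derive|exact: bounded_partials_derive|exact: bounded_partialsW Hg].
  by apply: IH => //; [exact: smooth_derive|exact: bounded_partialsW Hf|exact: bounded_partials_derive].
- by apply: smoothM => //; exact: smooth_derive.
- by apply: smoothM => //; exact: smooth_derive.
Qed.

Lemma smooth_bounded_partials N B g : compact B -> smooth g ->
  exists2 e, 0 <= e & bounded_partials N B g e.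
Proof.
move=> cB sg.
have H s : exists2 e, 0 <= e & forall x, B x -> `|partial s g x| <= e.
  have [[x0 Bx0]|B0] := pselect (B !=set0); last by exists 0 => // x Bx; case: B0; exists x.
  have cn : {within B, continuous (fun x => `|partial s g x|)}.
    apply: continuous_subspaceT => x; apply: continuous_comp; last exact: norm_continuous.
    exact: (smooth_continuous (smooth_partial s sg)).
  have [c cB' H] := compact_EVT_max (ex_intro _ x0 Bx0) cB cn.
  by exists `|partial s g c| => // x Bx; apply: H; rewrite inE.
elim: N g sg H => [|N IH] g sg H.
  have [e e0 He] := H [::].
  by exists e => // s; rewrite leqn0 size_eq0 => /eqP ->.
have HD i : exists e, 0 <= e /\ bounded_partials N B ('D_(delta_mx 0 i) g) e.
  have [|e e0 He] := IH _ (smooth_derive (delta_mx 0 i) sg); last by exists e.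
  by move=> s; rewrite -partial_rcons.
have [E HE] := choice HD; have [e e0 He] := H [::].
exists (e + \sum_i E i) => [|s sN x Bx].
  by rewrite addr_ge0// sumr_ge0// => i _; have [] := HE i.
case: (lastP s) sN => [_ |{}s i].
  by rewrite (le_trans (He _ Bx))// lerDl sumr_ge0// => i _; have [] := HE i.
rewrite size_rcons ltnS partial_rcons => sN.
have [Ei HEi] := HE i; rewrite (le_trans (HEi _ sN _ Bx))//.
rewrite (bigD1 i)//= addrCA lerDl addr_ge0// sumr_ge0// => j _.
by have [] := HE j.
Qed.
End Coordinates.

(** * Distributions *)

Section RealPart.
Context {R : realType} {d : nat} (f : @cdistribution R d).
Implicit Types (g h : 'rV[R]_d -> R).
Let oT : open [set: 'rV[R]_d] := @openT _.

(** By complex linearity [f] is determined by its values on real functions, as [rpairing_cdist_eq0]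
    records; all computations are made with these. *)
Definition rpairing g : R[i] := f (fun x => Complex (g x) 0).

Lemma test_fun_real g : smooth g -> test_fun (fun x => Complex (g x) 0).
Proof. by move=> sg; split=> //=; exact: smooth_cst. Qed.

Lemma rpairing_lin (a : R) g h : smooth g -> smooth h ->
  rpairing (fun x => a * g x + h x) = Complex a 0 * rpairing g + rpairing h.
Proof.
move=> sg sh; rewrite /rpairing -(pairing_linear f) //; [|exact: test_fun_real..].
congr (f _); apply/funext=> x.
by apply/eqP; rewrite eq_complex /= !(mul0r, mulr0, subr0, addr0) !eqxx.
Qed.

Lemma rpairing0 : rpairing (fun=> 0) = 0.
Proof.
have := rpairing_lin 1 (smooth_cst 0 oT) (smooth_cst 0 oT).
rewrite (_ : (fun=> 1 * 0 + 0) = (fun=> 0)); last by apply/funext=> x; rewrite mulr0 addr0.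
rewrite (_ : Complex 1 0 = 1)// mul1r => E.
by apply: (addrI (rpairing (fun=> 0))); rewrite addr0 -E.
Qed.

Lemma rpairingD g h : smooth g -> smooth h ->
  rpairing (fun x => g x + h x) = rpairing g + rpairing h.
Proof.
move=> sg sh; have := rpairing_lin 1 sg sh; rewrite (_ : Complex 1 0 = 1)// mul1r => <-.
by congr rpairing; apply/funext=> x; rewrite mul1r.
Qed.

Lemma rpairingZ (a : R) g : smooth g ->
  rpairing (fun x => a * g x) = Complex a 0 * rpairing g.
Proof.
move=> sg; have := rpairing_lin a sg (smooth_cst 0 oT); rewrite rpairing0 addr0 => <-.
by congr rpairing; apply/funext=> x; rewrite addr0.
Qed.

Lemma rpairing_sum I (r : seq I) (G : I -> 'rV[R]_d -> R) : (forall i, smooth (G i)) ->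
  rpairing (fun x => \sum_(i <- r) G i x) = \sum_(i <- r) rpairing (G i).
Proof.
move=> sG; elim: r => [|i r IH].
  by rewrite big_nil -rpairing0; congr rpairing; apply/funext=> x; rewrite big_nil.
rewrite big_cons -IH -rpairingD//; last exact: smooth_sum.
by congr rpairing; apply/funext=> x; rewrite big_cons.
Qed.

Lemma rpairing_continuous : exists (K : set 'rV[R]_d) (N : nat) (C : R),
  [/\ compact K, 0 <= C & forall g e, smooth g -> 0 <= e -> bounded_partials N K g e ->
     Normc.normc (rpairing g) <= C * e].
Proof.
have [K [N [C [cK HC]]]] := pairing_continuous f.
exists K, N, (`|C| * \sum_(k < N.+1) \sum_(s : k.-tuple 'I_d) 1); split=> //.
  by rewrite mulr_ge0// sumr_ge0// => k _; rewrite sumr_ge0.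
move=> g e sg e0 Hg; rewrite (le_trans (HC _ (test_fun_real sg)))//.
(* Over an empty set, or one without upper bound, [sup] takes the value 0; otherwise it dominates a
   modulus. *)
have S0 (s : seq 'I_d) : 0 <= sup [set Normc.normc (cpartial s (fun x => Complex (g x) 0) x) | x in K].
  have [[x0 Kx0]|K0] := pselect (K !=set0); last first.
    by rewrite (_ : [set _ | _ in K] = set0) ?sup0//; apply/seteqP; split=> // y [x Kx _]; case: K0; exists x.
  have [hs|/sup_out ->//] := pselect (has_sup [set Normc.normc (cpartial s (fun x => Complex (g x) 0) x) | x in K]).
  apply: (@le_trans _ _ (Normc.normc (cpartial s (fun x => Complex (g x) 0) x0))).
    exact: sqrtr_ge0.
  by apply: sup_upper_bound => //; exists x0.
have SL : Cn_seminorm K N (fun x => Complex (g x) 0) <= (\sum_(k < N.+1) \sum_(s : k.-tuple 'I_d) 1) * e.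
  rewrite /Cn_seminorm mulr_suml; apply: ler_sum => k _.
  rewrite mulr_suml; apply: ler_sum => s _; rewrite mul1r.
  have [[x0 Kx0]|K0] := pselect (K !=set0); last first.
    by rewrite (_ : [set _ | _ in K] = set0) ?sup0//; apply/seteqP; split=> // y [x Kx _]; case: K0; exists x.
  apply: ge_sup; first by exists (Normc.normc (cpartial s (fun x => Complex (g x) 0) x0)); exists x0.
  move=> _ [x Kx <-]; rewrite /cpartial /=.
  have -> : partial s (fun=> 0) x = 0 by exact: (@partial_on_eq0 _ _ s (fun=> 0) setT oT).
  rewrite expr0n addr0 sqrtr_sqr; apply: Hg => //.
  by rewrite size_tuple -ltnS ltn_ord.
have S1 : 0 <= Cn_seminorm K N (fun x => Complex (g x) 0).
  by rewrite /Cn_seminorm sumr_ge0// => k _; rewrite sumr_ge0.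
apply: (@le_trans _ _ (`|C| * Cn_seminorm K N (fun x => Complex (g x) 0))).
  by rewrite ler_wpM2r// ler_norm.
by rewrite -mulrA ler_wpM2l.
Qed.

Lemma rpairing_vanish (K : set 'rV[R]_d) N C g :
  (forall g e, smooth g -> 0 <= e -> bounded_partials N K g e ->
     Normc.normc (rpairing g) <= C * e) ->
  (exists2 U, open U & K `<=` U /\ forall x, U x -> g x = 0) -> smooth g -> rpairing g = 0.
Proof.
move=> HK [U oU [KU g0]] sg; apply: Normc.eq0_normc; apply/le_anti/andP; split; last first.
  by case: (rpairing g) => a b; exact: sqrtr_ge0.
rewrite -(mulr0 C); apply: HK => // s _ x Kx.
by rewrite (partial_on_eq0 _ oU g0) ?normr0//; exact: KU.
Qed.

Lemma rpairing_cdist_eq0 : (forall g, smooth g -> rpairing g = 0) -> cdist_eq0 f.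
Proof.
move=> H phi [sre sim].
have := pairing_linear f (Complex 0 1) (test_fun_real sim) (test_fun_real sre).
rewrite -!/(rpairing _) !H// mulr0 addr0 => <-; congr (f _); apply/funext=> x.
by apply/eqP; rewrite eq_complex /= !(mul0r, mulr0, mul1r, subr0, addr0, sub0r, oppr0, add0r) !eqxx.
Qed.
End RealPart.

(** * Partitions of unity of small mesh on the line *)

Section Partition.
Context {R : realType}.
Let oT : open [set: R] := @openT _.

Definition plateau (L x : R) : R := sstep (L + 1 - x) * sstep (x + L + 1).

Lemma smooth_plateau L : smooth (plateau L).
Proof.
apply: smoothM => //; apply: (smooth_comp (W := setT) oT _ smooth_sstep) => //.
  by apply: (smooth_ext oT _ (smooth_affine1 (-1) (L + 1))) => x _; rewrite mulN1r addrC.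
by apply: (smooth_ext oT _ (smooth_affine1 1 (L + 1))) => x _; rewrite mul1r addrA.
Qed.

Lemma plateau1 L x : `|x| <= L -> plateau L x = 1.
Proof. by rewrite ler_norml => /andP[h1 h2]; rewrite /plateau !sstep1 ?mulr1//; lra. Qed.

Lemma plateau_neq0 L x : plateau L x != 0 -> `|x| <= L + 1.
Proof.
apply: contraNT; rewrite ler_norml negb_and -!ltNge /plateau => /orP[h|h].
  by rewrite (@sstep0 _ (x + L + 1)) ?mulr0//; lra.
by rewrite sstep0 ?mul0r//; lra.
Qed.

(** Differences of consecutive translates of a step telescope. With step length [d = e / 2], each of
    them lives on an interval of length [2 * d = e]; the plateau cuts them off outside
    [|x| <= L + 1]. *)
Lemma smooth_partition (L e : R) : 0 < e -> exists (N : nat) (b : 'I_N -> R -> R),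
  [/\ forall i, smooth (b i), forall x, `|x| <= L -> \sum_i b i x = 1,
      forall i x, b i x != 0 -> `|x| <= L + 1 &
      forall i x y, b i x != 0 -> b i y != 0 -> `|x - y| < e].
Proof.
move=> e0; pose d := e / 2; have d0 : 0 < d by rewrite divr_gt0.
(* [a] and [N] are such that on [|x| <= L] step 0 is already 1 and step [N] still 0. *)
pose a := - L - d; pose s k x := sstep ((x - a) / d - k%:R).
pose N := (Num.trunc ((2 * L + d) / d)).+1.
exists N, (fun i x => (s (nat_of_ord i) x - s i.+1 x) * plateau L x).
have ss k : smooth (s k).
  apply: (smooth_comp (W := setT) oT _ smooth_sstep) => //.
  apply: (smooth_ext oT _ (smooth_affine1 d^-1 (- (a / d) - k%:R))) => x _.
  by rewrite addrA; congr (_ - _); rewrite [(x - a) / d]mulrBl mulrC.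
have near0 (i : 'I_N) x : (s (nat_of_ord i) x - s i.+1 x) * plateau L x != 0 ->
    i%:R < (x - a) / d < i%:R + 2.
  move=> h; apply/andP; split; move: h; apply: contraNT; rewrite -leNgt => h.
    by rewrite /s !sstep0 ?subrr ?mul0r// ?subr_le0// -natr1; lra.
  by rewrite /s !sstep1 ?subrr ?mul0r// -?natr1; lra.
split=> [i|x xL|i x|i x y].
- by apply: smoothM => //; [exact: smoothB|exact: smooth_plateau].
- rewrite -mulr_suml plateau1// mulr1.
  rewrite -(big_mkord xpredT (fun i => s i x - s i.+1 x)).
  rewrite (@telescope_sumr_eq _ 0 N (fun i => - s i x) (fun i => s i x - s i.+1 x))//; last first.
    by move=> k _; rewrite opprK addrC.
  rewrite opprK addrC; move: xL; rewrite ler_norml => /andP[xL1 xL2].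
  have -> : s 0%N x = 1 by rewrite /s sstep1// subr0 ler_pdivlMr// /a; lra.
  have -> : s N x = 0; last by rewrite subr0.
  rewrite /s sstep0// subr_le0.
  have : (2 * L + d) / d < N%:R by exact: truncnS_gt.
  by rewrite ltr_pdivrMr// ler_pdivrMr// /a => h; lra.
- by rewrite mulf_eq0 negb_or => /andP[_ /plateau_neq0].
- move=> /near0/andP[h1 h2] /near0/andP[h3 h4].
  move: h1 h2 h3 h4; rewrite ltr_pdivlMr// ltr_pdivrMr// ltr_pdivlMr// ltr_pdivrMr//.
  rewrite mulrDl => h1 h2 h3 h4.
  have -> : e = 2 * d by rewrite /d; field.
  by rewrite ltr_norml; apply/andP; split; lra.
Qed.
End Partition.

Section RowVectors.
Context {R : realType}.

Lemma rV_norm_coord d (x : 'rV[R]_d) i : `|x 0 i| <= `|x|.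
Proof. by rewrite [leRHS]mx_normrE; apply: (le_bigmax _ (fun ij => `|x ij.1 ij.2|) (0, i)). Qed.

Lemma rV_norm_lt d (x : 'rV[R]_d) e : 0 < e -> (forall i, `|x 0 i| < e) -> `|x| < e.
Proof. by move=> e0 h; rewrite [ltLHS]mx_normrE; apply/bigmax_ltP; split=> // -[i j] _; rewrite ord1. Qed.

Lemma rV_norm_le d (x : 'rV[R]_d) e : 0 <= e -> (forall i, `|x 0 i| <= e) -> `|x| <= e.
Proof. by move=> e0 h; rewrite [leLHS]mx_normrE; apply/bigmax_leP; split=> // -[i j] _; rewrite ord1. Qed.

Lemma compact_box d (L : R) : compact [set x : 'rV[R]_d | forall i, `|x 0 i| <= L].
Proof.
rewrite (_ : [set x | _] = [set x : 'rV[R]_d | forall i, `[- L, L]%classic (x 0 i)]).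
  by apply: (@rV_compact R d (fun=> `[- L, L]%classic)) => i; exact: segment_compact.
by apply/seteqP; split=> x /= h i; have := h i; rewrite in_itv /= ler_norml.
Qed.

Lemma compact_norm_bounded {V : normedModType R} (K : set V) : compact K ->
  exists2 L : R, 0 <= L & forall x, K x -> `|x| <= L.
Proof.
move=> /compact_bounded[M [_ H]]; exists (`|M| + 1); first by rewrite addr_ge0.
by move=> x Kx; apply: H => //; rewrite (le_lt_trans (ler_norm _))// ltrDl.
Qed.

(** A Lebesgue number argument: radii below half of one valid at [x] are valid throughout a ball
    around [x], and compactness makes the choice uniform. *)
Lemma uniform_radius {V : normedModType R} (K : set V) (Q : V -> R -> Prop) : compact K ->
  (forall x y e e', Q x e -> `|x - y| + e' <= e -> Q y e') ->
  (forall x, K x -> exists2 e, 0 < e & Q x e) -> exists2 e, 0 < e & forall x, K x -> Q x e.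
Proof.
move=> /compact_near_coveringP cK mQ HQ.
have H : forall x, K x -> \forall x' \near x & e \near (0 : R)^'+, Q x' e.
  move=> x Kx; have [e e0 Qe] := HQ _ Kx.
  have e20 : 0 < e / 2 by rewrite divr_gt0.
  exists (ball x (e / 2), [set r | r < e / 2]) => /=.
    split; first exact: nbhsx_ballx.
    exact: nbhs_right_lt.
  move=> [y r] /= [xy] re.
  apply: mQ Qe _; move: xy; rewrite -ball_normE /= => xy; lra.
have H' := cK _ _ (fun e x => Q x e) _ H.
near (0 : R)^'+ => e; exists e; first by near: e; exact: nbhs_right_gt.
by move=> x Kx; move: x Kx; near: e; exact: H'.
Unshelve. all: by end_near. Qed.

Lemma closure_ball_sub {V : normedModType R} (x : V) (e : R) (A : set V) :
  (forall y, A y -> `|x - y| <= e) -> forall y, closure A y -> `|x - y| <= e.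
Proof.
move=> HA y /(_ _ (nbhsx_ballx _ _ _)) cA; apply/ler_addgt0Pr => r r0.
have [z [/HA Az]] := cA r r0; rewrite -ball_normE /= => yz.
rewrite (_ : x - y = (x - z) - (y - z)); last by rewrite opprB addrA subrK.
by rewrite (le_trans (ler_normB _ _))//; lra.
Qed.

Lemma compact_closure_bounded d (L : R) (A : set 'rV[R]_d) :
  (forall y, A y -> `|y| <= L) -> compact (closure A).
Proof.
move=> HA; apply: (subclosed_compact _ (@compact_box d L)); first exact: closed_closure.
move=> y /(@closure_ball_sub _ 0 L) H i; apply: le_trans (rV_norm_coord _ _) _.
by rewrite -(normrN y) -sub0r; apply: H => z /HA; rewrite sub0r normrN.
Qed.
End RowVectors.

(** * From vanishing near each point to vanishing off the support *)

Section SupportLocalization.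
Context {R : realType} {d : nat} (f : @cdistribution R d).
Implicit Types (g : 'rV[R]_d -> R).
Let oT : open [set: 'rV[R]_d] := @openT _.

Lemma smooth_coord_comp (h : R -> R) i : smooth h -> smooth (fun x : 'rV[R]_d => h (x 0 i)).
Proof. by move=> sh; apply: (smooth_comp (W := setT) oT _ sh) => //; exact: smooth_coord. Qed.

(** The support is defined by test functions concentrated near a point. A partition of unity cuts
    [g] into pieces small enough to be killed one by one: near a point of [C] a small piece vanishes
    because [g] does on [O], and near any other point [f] itself vanishes. The pieces have to cover
    the compact set that controls [f], which need not lie in [C]. *)
Lemma rpairing_support (C O : set 'rV[R]_d) g : dsupport f `<=` C -> open O -> C `<=` O ->
  (forall x, O x -> g x = 0) -> smooth g -> rpairing f g = 0.
Proof.
move=> fC oO CO gO sg; have [K [N [M [cK M0 HK]]]] := rpairing_continuous f.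
have [L L0 KL] := compact_norm_bounded cK.
pose Q (x : 'rV[R]_d) (e : R) := forall g, smooth g -> (forall y, g y != 0 -> `|x - y| < e) ->
  (forall x, O x -> g x = 0) -> rpairing f g = 0.
(* The partition sums to 1 for coordinates up to [L + 1], on a neighborhood of [K], and its members
   reach [L + 1 + 1]. *)
have [|x Bx|e e0 HQ] := @uniform_radius R _ _ Q (@compact_box R d (L + 1 + 1)).
- move=> x y e e' Qx xy h sh hs h0; apply: Qx => // z /hs yz.
  rewrite (_ : x - z = (x - y) + (y - z)); last by rewrite addrA subrK.
  by rewrite (le_lt_trans (ler_normD _ _))//; lra.
- have [Cx|Cx] := pselect (C x).
    have /nbhs_ballP[e /= e0 He] : nbhs x O by exact: open_nbhs_nbhs (conj oO (CO _ Cx)).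
    exists e => // h sh hs h0; rewrite (_ : h = fun=> 0) ?rpairing0//.
    apply/funext=> y; have [//|/hs xy] := eqVneq (h y) 0.
    by apply: h0; apply: He; rewrite -ball_normE.
  have /contrapT[W [oW Wx HW]] : ~ ~ exists W, [/\ open W, W x & forall phi, test_fun phi ->
      compact (closure [set y | phi y != 0]) -> closure [set y | phi y != 0] `<=` W -> f phi = 0].
    by move=> h; apply: Cx; apply: fC.
  have /nbhs_ballP[e /= e0 He] : nbhs x W by exact: open_nbhs_nbhs (conj oW Wx).
  exists (e / 2) => [|h sh hs h0]; first by rewrite divr_gt0.
  have hc y : Complex (h y) 0 != 0 -> `|x - y| <= e / 2.
    by move=> hy; apply/ltW/hs; apply: contraNneq hy => ->.
  apply: HW; first exact: test_fun_real.
    apply: (@compact_closure_bounded _ _ (`|x| + e / 2)) => y /hc xy.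
    rewrite -(subrK x y) (le_trans (ler_normD _ _))// [leLHS]addrC lerD2l distrC//.
  move=> y /(closure_ball_sub hc) xy; apply: He; rewrite -ball_normE /=; lra.
have [n [b [sb b1 bL bc]]] := smooth_partition (L + 1) e0.
pose G (phi : {ffun 'I_d -> 'I_n}) x := g x * \prod_i b (phi i) (x 0 i).
have sG phi : smooth (G phi).
  by apply: smoothM => //; apply: smooth_prod => // i; exact: smooth_coord_comp.
have -> : g = (fun x => (g x - \sum_phi G phi x) + \sum_phi G phi x).
  by apply/funext=> x; rewrite subrK.
rewrite rpairingD ?rpairing_sum//; [|by apply: smoothB => //; exact: smooth_sum|exact: smooth_sum].
rewrite big1 ?addr0 => [|phi _].
  apply: (rpairing_vanish HK); last by apply: smoothB => //; exact: smooth_sum.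
  exists (ball 0 (L + 1)); first exact: ball_open.
  split=> [x /KL xL|x].
    by rewrite -ball_normE /= sub0r normrN; lra.
  rewrite -ball_normE /= sub0r normrN => xL.
  rewrite /G -mulr_sumr -(bigA_distr_bigA (fun i j => b j (x 0 i))) big1 ?mulr1 ?subrr// => i _.
  by apply: b1; rewrite (le_trans (rV_norm_coord _ _))// ltW.
(* A nonzero piece is centered at any point [x0] where it does not vanish. *)
have [G0|/existsNP[x0 /eqP Gx0]] := pselect (forall x, G phi x = 0).
  by rewrite (_ : G phi = fun=> 0) ?rpairing0//; exact/funext.
have Gb y i : G phi y != 0 -> b (phi i) (y 0 i) != 0.
  by rewrite /G (bigD1 i)//= !mulf_eq0 !negb_or => /and3P[].
apply: (HQ x0) => // [i|y Gy|x Ox]; first by apply: bL (Gb _ i Gx0).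
  by apply: rV_norm_lt => // i; rewrite !mxE; apply: bc (Gb _ i Gx0) (Gb _ i Gy).
by rewrite /G gO// mul0r.
Qed.
End SupportLocalization.

(** * Lines in coordinates *)

Section CompactSupport.
Context {R : realType}.
Notation mu := (@lebesgue_measure R).
Let oT : open [set: R] := @openT _.

Definition csupp (h : R -> R) := exists L, forall x, h x != 0 -> `|x| <= L.

Lemma csupp_bounded (h : R -> R) : continuous h -> csupp h ->
  exists2 M, 0 <= M & forall x, `|h x| <= M.
Proof.
move=> ch [L hL]; have [L0|L0] := leP 0 L; last first.
  exists 0 => // x; have [->|/hL xL] := eqVneq (h x) 0; first by rewrite normr0.
  by have := le_lt_trans xL L0; rewrite normr_lt0.
have cn : {within `[- L, L], continuous (fun x => `|h x|)}.
  by apply: continuous_subspaceT => x; apply: continuous_comp; [exact: ch|exact: norm_continuous].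
have [|c cL H] := EVT_max _ cn; first by lra.
exists `|h c| => // x; have [->|/hL xL] := eqVneq (h x) 0; first by rewrite normr0.
by apply: H; rewrite in_itv /= -ler_norml.
Qed.

Lemma csupp_bsm (h : R -> R) : continuous h -> csupp h -> bsm h.
Proof.
move=> ch sh; have [M M0 HM] := csupp_bounded ch sh; have [L hL] := sh.
split; first exact: continuous_measurable_fun.
exists (Num.max M L) => x; split; first by rewrite le_max HM.
by move=> /hL xL; rewrite le_max xL orbT.
Qed.

Lemma csupp_derive (h : R -> R) L : (forall x, h x != 0 -> `|x| <= L) ->
  forall x, 'D_1 h x != 0 -> `|x| <= L.
Proof.
move=> hL x; apply: contraNT; rewrite -ltNge => xL.
have oU : open [set y : R | L < `|y|].
  apply: (@open_comp _ _ (fun y : R => `|y|) [set z | L < z]); last exact: open_gt.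
  by move=> y _; exact: norm_continuous.
have E y : L < `|y| -> cst 0 y = h y.
  by move=> Ly; apply/esym/eqP; apply: contraTT Ly => /hL; rewrite -leNgt.
by have [_ ->] := is_derive_on_ext oU xL E (is_derive_cst 0 x (1 : R)).
Qed.

Lemma smooth_cont (h : R -> R) : smooth h -> continuous h.
Proof. by move=> sh x; exact: (smooth_continuous sh). Qed.

Lemma smooth_lipschitz (h : R -> R) : smooth h -> csupp h ->
  exists2 M, 0 <= M & forall x y, `|h x - h y| <= M * `|x - y|.
Proof.
move=> sh [L hL]; have sd := smooth_derive (1 : R) sh.
have [M M0 HM] := csupp_bounded (smooth_cont sd) (ex_intro _ L (csupp_derive hL)).
exists M => //; suff H x y : y <= x -> `|h x - h y| <= M * `|x - y|.
  move=> x y; have [/H//|/ltW/H] := leP y x.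
  by rewrite distrC [`|y - x|]distrC.
move=> yx; have xy0 : 0 <= x - y by rewrite subr_ge0.
have [k _] := smooth_mvt y (1 : R) sh xy0.
by rewrite [_ *: (1 : R)]mulr1 subrK => ->; rewrite normrM ler_wpM2r.
Qed.

Lemma csupp_mul (a h : R -> R) : csupp h -> csupp (fun x => a x * h x).
Proof. by move=> [L hL]; exists L => x; rewrite mulf_eq0 negb_or => /andP[_ /hL]. Qed.
End CompactSupport.

(** * Integrals over the slopes as smooth functions of the point *)

Section ParametricIntegral.
Context {R : realType} {V : normedModType R}.
Notation mu := (@lebesgue_measure R).
Variables (la ka : V -> R).
Hypothesis (cla : continuous la) (cka : continuous ka).
Hypothesis dla : forall w, exists b, forall (h : R) x, la (h *: w + x) = h * b + la x.
Hypothesis dka : forall w, exists b, forall (h : R) x, ka (h *: w + x) = h * b + ka x.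

(** With [la] a side coordinate and [ka] the height, [la x - ka x * v] is the foot of the line of
    slope [v] through [x]: [h] weights the foot and [a] the slope. *)
Definition lineint (h a : R -> R) (x : V) : R := \int[mu]_v (h (la x - ka x * v) * a v).

Lemma continuous_lineint h a x : smooth h -> csupp h -> continuous a -> csupp a ->
  {for x, continuous (lineint h a)}.
Proof.
move=> sh ch ca sa; have [M M0 HM] := smooth_lipschitz sh ch.
have [Ma Ma0 HMa] := csupp_bounded ca sa; have [L hL] := sa.
have cF y : continuous (fun v => h (la y - ka y * v) * a v).
  move=> v; apply: cvgM; last exact: ca.
  apply: (@continuous_comp _ _ _ (fun v => la y - ka y * v) h); last exact: smooth_cont.
  by apply: cvgB; [exact: cvg_cst|apply: cvgM; [exact: cvg_cst|exact: cvg_id]].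
have iF y : mu.-integrable setT (EFin \o (fun v => h (la y - ka y * v) * a v)).
  by apply/bsm_integrable/csupp_bsm => //; exact: csupp_mul.
pose L' := `|L|; have L'0 : 0 <= L' by exact: normr_ge0.
have bound y : `|lineint h a x - lineint h a y| <=
    (M * (`|la x - la y| + `|ka x - ka y| * L')) * Ma * (L' *+ 2).
  rewrite /lineint -RintegralB//; apply: le_norm_Rintegral => //.
  - by apply: continuous_measurable_fun => v; apply: cvgB; exact: cF.
  - move=> v; rewrite -mulrBl normrM.
    have [->|/hL vL] := eqVneq (a v) 0.
      by rewrite normr0 mulr0 !mulr_ge0// addr_ge0// mulr_ge0.
    apply: ler_pM => //; apply: (le_trans (HM _ _)); apply: ler_wpM2l => //.
    rewrite (_ : _ - _ = (la x - la y) - (ka x - ka y) * v); last by ring.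
    rewrite (le_trans (ler_normB _ _))// lerD2l normrM ler_wpM2l//.
    by rewrite (le_trans vL)// ler_norm.
  - move=> v; rewrite -mulrBl mulf_eq0 negb_or => /andP[_ /hL vL].
    by rewrite (le_trans vL)// ler_norm.
apply/cvgrPdist_le => e e0.
have cb : (M * (`|la x - la y| + `|ka x - ka y| * L')) * Ma * (L' *+ 2) @[y --> x] --> (0 : R).
  rewrite [X in _ --> X](_ : _ = (M * (`|la x - la x| + `|ka x - ka x| * L')) * Ma * (L' *+ 2)); last first.
    by rewrite !subrr normr0 mul0r addr0 mulr0 !mul0r.
  apply: cvgM; last exact: cvg_cst; apply: cvgM; last exact: cvg_cst.
  apply: cvgM; first exact: cvg_cst; apply: cvgD.
    by apply: cvg_norm; apply: cvgB; [exact: cvg_cst|exact: cla].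
  apply: cvgM; last exact: cvg_cst.
  by apply: cvg_norm; apply: cvgB; [exact: cvg_cst|exact: cka].
move/cvgr0Pnorm_le : cb => /(_ _ e0); apply: filterS => y /= Hy.
by apply: le_trans (bound y) _; apply: le_trans (ler_norm _) Hy.
Qed.

(** Differentiating [h] under the integral gives an integral of the same kind, the weight being
    multiplied by the affine function [b - c * v]: this closes the family for [smooth_coind].
    Domination uses a bound on the derivative of [h] and the bounded support of [a]. *)
Lemma is_derive_lineint h a w x b c : smooth h -> csupp h -> continuous a -> csupp a ->
  (forall (r : R) x, la (r *: w + x) = r * b + la x) ->
  (forall (r : R) x, ka (r *: w + x) = r * c + ka x) ->
  is_derive x w (lineint h a) (lineint ('D_1 h) (fun v => (b - c * v) * a v) x).
Proof.
move=> sh ch ca sa lb kc; have [L hL] := sa; have [Lh hLh] := ch.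
have sd := smooth_derive (1 : R) sh.
have [M M0 HM] := csupp_bounded (smooth_cont sd) (ex_intro _ Lh (csupp_derive hLh)).
pose F (s v : R) := h (la (s *: w + x) - ka (s *: w + x) * v) * a v.
have FE s v : F s v = h ((la x - ka x * v) + s * (b - c * v)) * a v.
  by rewrite /F lb kc; congr (h _ * _); ring.
have DF (s v : R) : is_derive s 1 (F ^~ v)
    ('D_1 h ((la x - ka x * v) + s * (b - c * v)) * ((b - c * v) * a v)).
  rewrite (_ : F ^~ v = fun s => a v * h ((la x - ka x * v) + s * (b - c * v))); last first.
    by apply/funext=> r; rewrite FE mulrC.
  have D1 : is_derive s 1 (fun s => la x - ka x * v + s * (b - c * v)) (b - c * v).
    by apply: is_derive_affine => r; rewrite [r *: (1 : R)]mulr1; ring.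
  have D2 := is_derive_comp1 D1 (smooth_is_derive (1 : R) sh I).
  by apply: (is_derive_eq (is_derive_scale (a v) D2)); rewrite mulrC -mulrA.
have cF s : continuous (F s).
  move=> v; apply: cvgM; last exact: ca.
  apply: (@continuous_comp _ _ _ (fun v => la (s *: w + x) - ka (s *: w + x) * v) h); last exact: smooth_cont.
  by apply: cvgB; [exact: cvg_cst|apply: cvgM; [exact: cvg_cst|exact: cvg_id]].
have iF s : mu.-integrable setT (EFin \o F s).
  by apply/bsm_integrable/csupp_bsm => //; exact: csupp_mul.
pose G v := (`|b| + `|c| * `|v|) * M * `|a v|.
have G0 v : 0 <= G v by rewrite /G !mulr_ge0// addr_ge0// mulr_ge0.
have iG : mu.-integrable setT (EFin \o G).
  apply/bsm_integrable/csupp_bsm.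
    move=> v; apply: cvgM; last by apply: cvg_norm; exact: ca.
    apply: cvgM; last exact: cvg_cst; apply: cvgD; first exact: cvg_cst.
    by apply: cvgM; [exact: cvg_cst|exact: norm_continuous].
  by exists L => v; rewrite /G mulf_eq0 negb_or normr_eq0 => /andP[_ /hL].
have dE s v : partial1of2 F s v =
    'D_1 h ((la x - ka x * v) + s * (b - c * v)) * ((b - c * v) * a v).
  by rewrite partial1of2E; have [_ ->] := DF s v.
have Gub s v : `|partial1of2 F s v| <= G v.
  rewrite dE !normrM /G mulrA; apply: ler_wpM2r => //.
  rewrite mulrC; apply: ler_pM => //.
  by apply: (le_trans (ler_normB _ _)); rewrite normrM.
have I0 : (`]-1, 1[%classic : set R) 0 by rewrite /= in_itv /=; lra.
have df s v : derivable (F ^~ v) s 1 by have [] := DF s v.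
have D : is_derive (0 : R) 1 (fun s : R => lineint h a (s *: w + x)) (\int[mu]_v (partial1of2 F 0 v)).
  apply: DeriveDef.
    exact: (@derivable_under_integral R _ _ mu F setT measurableT 0 (-1) 1 I0 (fun s _ => iF s)
      (fun s v _ _ => df s v) G G0 iG (fun s v _ _ => Gub s v)).
  rewrite -derive1E.
  exact: (@differentiation_under_integral R _ _ mu F setT measurableT 0 (-1) 1 I0 (fun s _ => iF s)
      (fun s v _ _ => df s v) G G0 iG (fun s v _ _ => Gub s v)).
have := (is_derive_line (lineint h a) x w 0 _).2 D; rewrite scale0r add0r => H.
apply: (is_derive_eq H); apply: eq_Rintegral => v _.
by rewrite dE mul0r addr0.
Qed.

Lemma smooth_lineint h a : smooth h -> csupp h -> continuous a -> csupp a ->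
  smooth (lineint h a).
Proof.
move=> sh ch ca sa.
apply: (@smooth_coind _ _ (fun g => exists h a, [/\ smooth h, csupp h, continuous a & csupp a] /\
  g = lineint h a)); first exact: openT.
  move=> _ [{}h [{}a [[{}sh {}ch {}ca {}sa] ->]]]; split=> [x _|w].
    exact: continuous_lineint.
  have [b Hb] := dla w; have [c Hc] := dka w.
  exists (lineint ('D_1 h) (fun v => (b - c * v) * a v)).
    exists ('D_1 h), (fun v => (b - c * v) * a v); split=> //; split.
    - exact: smooth_derive.
    - by have [L hL] := ch; exists L; exact: csupp_derive.
    - move=> v; apply: cvgM; last exact: ca.
      by apply: cvgB; [exact: cvg_cst|apply: cvgM; [exact: cvg_cst|exact: cvg_id]].
    - exact: csupp_mul.
  by move=> x _; exact: is_derive_lineint.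
by exists h, a.
Qed.
End ParametricIntegral.

Section LineCoordinates.
Context {R : realType} {n : nat}.
Notation mu := (@lebesgue_measure R).
Notation V := 'rV[R]_n.+1.
Variables (x0 : V) (c : R) (m : 'I_n -> R).
Hypothesis c0 : c != 0.

(** Linear part of the height. With [c != 0] it forms, together with all coordinates but the first,
    a linear coordinate system. *)
Definition nform (x : V) : R := c * x 0 ord0 + \sum_i m i * x 0 (lift ord0 i).
Definition height (x : V) : R := nform x - nform x0.
Definition side (i : 'I_n) (x : V) : R := x 0 (lift ord0 i) - x0 0 (lift ord0 i).

Lemma nform_lin a (x y : V) : nform (a *: x + y) = a * nform x + nform y.
Proof.
rewrite /nform !mxE mulrDr mulrDr mulrCA -!addrA; congr (_ + _).
rewrite addrCA; congr (_ + _); rewrite mulr_sumr -big_split /=; apply: eq_bigr => i _.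
by rewrite !mxE mulrDr mulrCA.
Qed.

Lemma nform_scale a (x : V) : nform (a *: x) = a * nform x.
Proof.
have := nform_lin a x 0; rewrite addr0 => ->.
suff -> : nform 0 = 0 by rewrite addr0.
by rewrite /nform mxE mulr0 add0r big1// => i _; rewrite mxE mulr0.
Qed.

Lemma smooth_nform : smooth nform.
Proof.
have oT : open [set: V] by exact: openT.
apply: smoothD => //; first by apply: smoothZ => //; exact: smooth_coord.
by apply: smooth_sum => // i; apply: smoothZ => //; exact: smooth_coord.
Qed.

Lemma height_affine w h x : height (h *: w + x) = h * nform w + height x.
Proof. by rewrite /height nform_lin [RHS]addrA. Qed.

Lemma side_affine i w h x : side i (h *: w + x) = h * w 0 (lift ord0 i) + side i x.
Proof. by rewrite /side !mxE [RHS]addrA. Qed.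

Lemma smooth_height : smooth height.
Proof. by apply: smoothB; [exact: openT|exact: smooth_nform|apply: smooth_cst; exact: openT]. Qed.

Lemma smooth_side i : smooth (side i).
Proof. by apply: smoothB; [exact: openT|apply: smooth_coord; exact: openT|apply: smooth_cst; exact: openT]. Qed.

Definition linefactor i h a (x : V) : R := lineint (side i) height h a x.

(** Up to the factor [|c|^-1], the image of [line_fun hh aa] under [Xray_adjoint]. *)
Definition lineprod (hh aa : 'I_n -> R -> R) (x : V) : R := \prod_i linefactor i (hh i) (aa i) x.

Definition tame (h : R -> R) := smooth h /\ csupp h.

Lemma smooth_linefactor i h a : tame h -> tame a -> smooth (linefactor i h a).
Proof.
move=> [sh ch] [sa ca]; apply: smooth_lineint => //.
- by move=> x; exact: (smooth_continuous (smooth_side i)).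
- by move=> x; exact: (smooth_continuous smooth_height).
- by move=> w; exists (w 0 (lift ord0 i)); exact: side_affine.
- by move=> w; exists (nform w); exact: height_affine.
- exact: smooth_cont.
Qed.

Lemma smooth_lineprod hh aa : (forall i, tame (hh i)) -> (forall i, tame (aa i)) ->
  smooth (lineprod hh aa).
Proof. by move=> th ta; apply: smooth_prod => [|i]; [exact: openT|exact: smooth_linefactor]. Qed.

(* The point of a line at height 0 has side coordinates [u], and its direction,
   rescaled so that [nform] equals 1, has side coordinates [v]. *)
Definition slope i (l : V * V) : R := l.2 0 (lift ord0 i) * posinv (nform l.2).
Definition foot i (l : V * V) : R := side i l.1 - height l.1 * slope i l.

(** The weight compensates the density of surface measure in the slopes, and keeps only the lines
    oriented towards increasing height. *)
Definition line_fun (hh aa : 'I_n -> R -> R) (l : V * V) : R :=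
  posinv (nform l.2) ^+ n.+1 * \prod_i (hh i (foot i l) * aa i (slope i l)).

Lemma Xray_adjoint_line_fun hh aa y : (forall i, tame (hh i)) -> (forall i, tame (aa i)) ->
  Xray_adjoint (fun l => Complex (line_fun hh aa l) 0) y = Complex (`|c|^-1 * lineprod hh aa y) 0.
Proof.
move=> th ta; rewrite /Xray_adjoint /sphere_cintegral /=; congr Complex; last first.
  rewrite /sphere_integral (_ : (fun x => _) = fun=> 0) ?iter_integral0 ?mulr0//.
  by apply/funext=> x; rewrite if_same.
pose B i v := hh i (side i y - height y * v) * aa i v.
have bB i : bsm (B i).
  have [[sh ch] [sa ca]] := (th i, ta i).
  apply: csupp_bsm; last exact: csupp_mul.
  move=> v; apply: cvgM; last exact: smooth_cont.
  apply: (@continuous_comp _ _ _ (fun v => side i y - height y * v) (hh i)); last exact: smooth_cont.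
  by apply: cvgB; [exact: cvg_cst|apply: cvgM; [exact: cvg_cst|exact: cvg_id]].
have HM i : exists M : R, 0 <= M /\ forall x, `|B i x| <= M /\ (B i x != 0 -> `|x| <= M).
  by have [_ [M HM]] := bB i; exists M; split=> //; apply: le_trans (HM 0).1.
have [Mf HMf] := choice HM.
pose M := \sum_i Mf i.
have MfM i : Mf i <= M.
  by rewrite /M (bigD1 i)//= lerDl sumr_ge0// => j _; have [] := HMf j.
have M0 : 0 <= M by rewrite sumr_ge0// => j _; have [] := HMf j.
apply: (@sphere_integral_prod R n c m B M M c0 M0 M0).
- by move=> i; have [] := bB i.
- by move=> i v; apply: le_trans (MfM i); apply: ((HMf i).2 v).1.
- by move=> i v Bv; apply: le_trans (MfM i); apply: ((HMf i).2 v).2.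
- move=> x x1; rewrite /line_fun /= -/(nform x).
  have [x_gt0|x_le0] := ltP 0 (nform x); last first.
    by rewrite /posinv ltNge x_le0 /= expr0n !mul0r.
  congr (_ * _); apply: eq_bigr => i _.
  rewrite /B /slope /foot /=; congr (hh i _ * _).
  (* All points of a line give the same foot, so [y] may replace its projection orthogonal to the
     direction [x]. *)
  rewrite -[y - _]addrC -scaleNr side_affine height_affine /slope /=.
  have : nform x * posinv (nform x) = 1 by rewrite posinv_gt0// mulfV// gt_eqF.
  generalize (nform x) (posinv (nform x)) (x 0 (lift ord0 i)) (dot y x) (side i y) (height y).
  move=> s p X k S H sp.
  by rewrite mulrDl [- k * s * _]mulrACA sp mulr1 opprD addrACA subrr add0r.
Qed.

Lemma csmooth_real (W : set (V * V)) (g : V * V -> R) : open W -> smooth_on W g ->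
  csmooth_on W (fun l => Complex (g l) 0).
Proof. by move=> oW sg; split=> //=; exact: smooth_cst. Qed.

Lemma smooth_fst_coord (W : set (V * V)) i : open W -> smooth_on W (fun l : V * V => l.1 0 i).
Proof.
move=> oW; apply: smooth_affine => // [l|v].
  by apply: (@continuous_comp (V * V)%type V R fst (fun x : V => x 0 i) l); [exact: cvg_fst|exact: continuous_coord].
by exists (v.1 0 i) => l; apply: is_derive_affine => h; rewrite /= !mxE.
Qed.

Lemma smooth_snd_coord (W : set (V * V)) i : open W -> smooth_on W (fun l : V * V => l.2 0 i).
Proof.
move=> oW; apply: smooth_affine => // [l|v].
  by apply: (@continuous_comp (V * V)%type V R snd (fun x : V => x 0 i) l); [exact: cvg_snd|exact: continuous_coord].
by exists (v.2 0 i) => l; apply: is_derive_affine => h; rewrite /= !mxE.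
Qed.

Lemma smooth_nform_fst (W : set (V * V)) : open W -> smooth_on W (fun l : V * V => nform l.1).
Proof.
move=> oW; apply: smoothD => //; first by apply: smoothZ => //; exact: smooth_fst_coord.
by apply: smooth_sum => // i; apply: smoothZ => //; exact: smooth_fst_coord.
Qed.

Lemma smooth_nform_snd (W : set (V * V)) : open W -> smooth_on W (fun l : V * V => nform l.2).
Proof.
move=> oW; apply: smoothD => //; first by apply: smoothZ => //; exact: smooth_snd_coord.
by apply: smooth_sum => // i; apply: smoothZ => //; exact: smooth_snd_coord.
Qed.

Lemma open_nform_gt (r : R) : open [set l : V * V | r < nform l.2].
Proof.
apply: (@open_comp _ _ (fun l : V * V => nform l.2) [set z | r < z]); last exact: open_gt.
by move=> l _; exact: (smooth_continuous (smooth_nform_snd openT)).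
Qed.

Lemma open_nform_lt (r : R) : open [set l : V * V | nform l.2 < r].
Proof.
apply: (@open_comp _ _ (fun l : V * V => nform l.2) [set z | z < r]); last exact: open_lt.
by move=> l _; exact: (smooth_continuous (smooth_nform_snd openT)).
Qed.

Lemma smooth_line_fun hh aa : (forall i, tame (hh i)) -> (forall i, tame (aa i)) ->
  smooth_on [set l : V * V | 0 < nform l.2] (line_fun hh aa).
Proof.
move=> th ta; pose W := [set l : V * V | 0 < nform l.2].
have oW : open W by exact: open_nform_gt.
have sp : smooth_on W (fun l : V * V => posinv (nform l.2)).
  have H : forall l, W l -> (nform l.2)^-1 = posinv (nform l.2) by move=> l Wl; rewrite posinv_gt0.
  apply: (smooth_ext oW H); apply: smoothV => //; last exact: smooth_nform_snd.
  by move=> l; rewrite /W /= => h; rewrite gt_eqF.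
have ss i : smooth_on W (slope i) by apply: smoothM => //; exact: smooth_snd_coord.
have sf i : smooth_on W (foot i).
  apply: smoothB => //; first by apply: smoothB => //; [exact: smooth_fst_coord|exact: smooth_cst].
  apply: smoothM => //; apply: smoothB => //; [exact: smooth_nform_fst|exact: smooth_cst].
apply: smoothM => //; first exact: smoothX.
apply: smooth_prod => // i; apply: smoothM => //.
  by apply: (smooth_comp (W := setT) oW _ (th i).1).
by apply: (smooth_comp (W := setT) oW _ (ta i).1).
Qed.

Lemma line_fun_neq0 hh aa l : line_fun hh aa l != 0 ->
  0 < nform l.2 /\ forall i, hh i (foot i l) != 0 /\ aa i (slope i l) != 0.
Proof.
rewrite /line_fun mulf_eq0 negb_or => /andP[p0 P0]; split.
  by move: p0; rewrite /posinv; case: ifP => // _; rewrite expr0n eqxx.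
move=> i; move: P0; rewrite (bigD1 i)//= !mulf_eq0 !negb_or.
by move=> /andP[/andP[]].
Qed.

Lemma coord0_nform (x : V) : x 0 ord0 = (nform x - \sum_i m i * x 0 (lift ord0 i)) / c.
Proof. by rewrite /nform addrK mulrAC mulfV// mul1r. Qed.

(* A direction of bounded slope cannot be almost horizontal. *)
Lemma nform_lower_bound (L : R) : exists2 r, 0 < r & forall l : V * V, Lines l -> 0 < nform l.2 ->
  (forall i, `|slope i l| <= L) -> r <= nform l.2.
Proof.
(* With slopes at most [L], a unit vector satisfies [1 <= Q * s ^ 2], where [s] is its [nform]. The
   summand 1 ensures [Q >= 1], which turns this into [s >= 1 / Q]. *)
pose Q := ((1 + \sum_i `|m i| * L) / `|c|) ^+ 2 + \sum_(i < n) L ^+ 2 + 1.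
have Q1 : 1 <= Q by rewrite /Q lerDr addr_ge0 ?sqr_ge0// sumr_ge0// => i _; exact: sqr_ge0.
exists Q^-1 => [|l [l1 _] s0 sL]; first by rewrite invr_gt0 (lt_le_trans _ Q1).
set s := nform l.2 in s0 *.
have xL i : `|l.2 0 (lift ord0 i)| <= L * s.
  by rewrite -ler_pdivrMr//; have := sL i; rewrite /slope posinv_gt0// normrM [`|_^-1|]gtr0_norm ?invr_gt0.
have x0L : `|l.2 0 ord0| <= (1 + \sum_i `|m i| * L) / `|c| * s.
  rewrite coord0_nform normrM normfV -/s mulrAC ler_wpM2r ?invr_ge0//.
  rewrite (le_trans (ler_normB _ _))// mulrDl mul1r gtr0_norm// lerD2l.
  rewrite (le_trans (ler_norm_sum _ _ _))// mulr_suml ler_sum// => i _.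
  by rewrite normrM -mulrA ler_wpM2l.
have sq (a b : R) : `|a| <= b -> a ^+ 2 <= b ^+ 2.
  by move=> ab; rewrite -real_normK ?num_real// lerXn2r// nnegrE// (le_trans _ ab).
have H : 1 <= Q * s ^+ 2.
  have <- : dot l.2 l.2 = 1.
    have d0 : 0 <= dot l.2 l.2 by rewrite sumr_ge0// => i _; rewrite -expr2 sqr_ge0.
    by rewrite -(sqr_sqrtr d0) -/(enorm l.2) l1 expr1n.
  rewrite /dot big_ord_recl -expr2 /Q -addrA mulrDl -exprMn; apply: lerD; first exact: sq.
  rewrite mulrDl mul1r (@le_trans _ _ ((\sum_(i < n) L ^+ 2) * s ^+ 2))//; last first.
    by rewrite lerDl sqr_ge0.
  by rewrite mulr_suml ler_sum// => i _; rewrite -expr2 -exprMn; exact: sq.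
have Q0 : 0 < Q by rewrite (lt_le_trans _ Q1).
rewrite leNgt; apply/negP => sQ; move: H; apply/negP; rewrite -ltNge.
have sQ1 : Q * s < 1 by rewrite mulrC -ltr_pdivlMr ?div1r.
rewrite expr2 mulrA (@lt_le_trans _ _ (1 * s))// ?ltr_pM2r// mul1r.
by rewrite (le_trans (ltW sQ))// invf_le1.
Qed.

(** [posinv] is singular at 0, but by [nform_lower_bound] the factors [aa] already kill [line_fun]
    on lines whose [nform l.2] is below some [r > 0]; there the zero function is a smooth
    extension. *)
Lemma Lines_test_line_fun hh aa : (forall i, tame (hh i)) -> (forall i, tame (aa i)) ->
  Lines_test_fun (fun l => Complex (line_fun hh aa l) 0).
Proof.
move=> th ta l Ll; have [s0|s0] := ltP 0 (nform l.2).
  exists [set l : V * V | 0 < nform l.2], (fun l => Complex (line_fun hh aa l) 0); split=> //.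
    exact: open_nform_gt.
  by apply: csmooth_real; [exact: open_nform_gt|exact: smooth_line_fun].
have HL i : exists L, forall x, aa i x != 0 -> `|x| <= L by have [_ ca] := ta i.
have [Lf HLf] := choice HL.
have [r r0 Hr] := nform_lower_bound (\sum_i `|Lf i|).
exists [set l : V * V | nform l.2 < r], (fun=> Complex 0 0); split=> //.
- exact: open_nform_lt.
- by rewrite /=; apply: le_lt_trans s0 r0.
- by apply: csmooth_real; [exact: open_nform_lt|apply: smooth_cst; exact: open_nform_lt].
- move=> k kr Lk; congr Complex; apply/eqP; apply: contraTT (kr) => /line_fun_neq0[k0 Hk].
  rewrite -leNgt; apply: Hr => // i; have [_ /HLf h] := Hk i.
  rewrite (le_trans h)// (le_trans (ler_norm _))// (bigD1 i)//= lerDl sumr_ge0//.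
Qed.
End LineCoordinates.

Section RowContinuity.
Context {R : realType}.

Lemma continuous_rV {T : topologicalType} d (F : T -> 'rV[R]_d) p :
  (forall i, {for p, continuous (fun t => F t 0 i)}) -> {for p, continuous F}.
Proof.
move=> cF; apply/cvgrPdist_lt => e e0.
have H : \forall t \near p, forall i, `|F p 0 i - F t 0 i| < e.
  by apply: filter_forall => i; have /cvgrPdist_lt := cF i; exact.
by apply: filterS H => t Ht; apply: rV_norm_lt => // i; rewrite !mxE.
Qed.
End RowContinuity.

(** * The line with given foot and slope *)

Section LineAt.
Context {R : realType} {n : nat}.
Notation V := 'rV[R]_n.+1.
Notation P := ('rV[R]_n * 'rV[R]_n)%type.
Variables (x0 : V) (c : R) (m : 'I_n -> R).
Hypothesis c0 : c != 0.
Local Notation nform := (nform c m).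
Local Notation height := (height x0 c m).
Local Notation side := (side x0).
Local Notation slope := (slope c m).
Local Notation foot := (foot x0 c m).

Definition basept (p : P) : V := x0 + consV (- (\sum_i m i * p.1 0 i) / c) p.1.
Definition dirvec (p : P) : V := consV ((1 - \sum_i m i * p.2 0 i) / c) p.2.
(** Inverse of the coordinates [foot] and [slope]: the base point is projected orthogonally to the
    direction, and the direction normalized, as [Lines] requires. *)
Definition lineat (p : P) : V * V :=
  let D := dirvec p in let B := basept p in
  (B - (dot B D / dot D D) *: D, (enorm D)^-1 *: D).

Lemma nform_dirvec p : nform (dirvec p) = 1.
Proof.
rewrite /nform consV0 mulrCA mulfV// mulr1.
by under [X in _ + X]eq_bigr do rewrite consVS; rewrite subrK.
Qed.

Lemma rV_ext (x y : V) : nform x = nform y ->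
  (forall i, x 0 (lift ord0 i) = y 0 (lift ord0 i)) -> x = y.
Proof.
move=> Exy Ei; apply/rowP => i; case: (unliftP ord0 i) => [j ->//|->].
rewrite !(coord0_nform m c0) Exy; congr ((_ - _) / _).
by apply: eq_bigr => j _; rewrite Ei.
Qed.

Lemma height_basept p : height (basept p) = 0.
Proof.
rewrite /height /basept [x0 + _]addrC -[consV _ _]scale1r nform_lin mul1r addrK.
rewrite /nform consV0 mulrCA mulfV// mulr1.
by under [X in _ + X]eq_bigr do rewrite consVS; rewrite addrC subrr.
Qed.

Lemma side_basept p i : side i (basept p) = p.1 0 i.
Proof. by rewrite /side mxE consVS [LHS]addrC addKr. Qed.

Lemma dot_sq (x : V) : dot x x = enorm x ^+ 2.
Proof. by rewrite sqr_sqrtr// sumr_ge0// => i _; rewrite -expr2 sqr_ge0. Qed.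

Lemma enorm_dirvec_gt0 p : 0 < enorm (dirvec p).
Proof.
rewrite lt_neqAle sqrtr_ge0 andbT eq_sym; apply/eqP => E.
have : dot (dirvec p) (dirvec p) = 0 by rewrite dot_sq E expr0n.
move=> /eqP; rewrite psumr_eq0 => [/allP H|i _]; last by rewrite -expr2 sqr_ge0.
have D0 i : dirvec p 0 i = 0.
  by have := H i (mem_index_enum _); rewrite /= mulf_eq0 orbb => /eqP.
have := nform_dirvec p; rewrite /nform D0 mulr0 add0r big1 => [/eqP|i _].
  by rewrite eq_sym oner_eq0.
by rewrite D0 mulr0.
Qed.

Lemma dot_scale a (x y : V) : dot (a *: x) y = a * dot x y.
Proof. by rewrite /dot mulr_sumr; apply: eq_bigr => i _; rewrite mxE mulrA. Qed.

Lemma dotC (x y : V) : dot x y = dot y x.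
Proof. by apply: eq_bigr => i _; rewrite mulrC. Qed.

Lemma dotD (x y z : V) : dot (x + y) z = dot x z + dot y z.
Proof. by rewrite /dot -big_split /=; apply: eq_bigr => i _; rewrite mxE mulrDl. Qed.

Lemma Lines_lineat p : Lines (lineat p).
Proof.
have D0 := enorm_dirvec_gt0 p; have Dn : enorm (dirvec p) != 0 by rewrite gt_eqF.
split=> /=.
  rewrite {1}/enorm dot_scale dotC dot_scale dot_sq expr2 mulKf// mulVf//.
  by rewrite sqrtr1.
rewrite dotC dot_scale dotC dotD -scaleNr dot_scale mulNr divfK ?subrr ?mulr0//.
by rewrite dot_sq expf_neq0.
Qed.

Lemma line_pts_lineat (p : P) (y : V) : (forall i, side i y = p.1 0 i + height y * p.2 0 i) ->
  line_pts (lineat p) y.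
Proof.
move=> Hy; have D0 := enorm_dirvec_gt0 p; have Dn : enorm (dirvec p) != 0 by rewrite gt_eqF.
have -> : y = height y *: dirvec p + basept p.
  apply: rV_ext => [|i].
    rewrite nform_lin nform_dirvec mulr1.
    have := height_basept p; rewrite {1}/height => /eqP; rewrite subr_eq0 => /eqP ->.
    by rewrite subrK.
  have := Hy i; rewrite {1}/side => /eqP; rewrite subr_eq => /eqP ->.
  rewrite [RHS]mxE [X in _ = X + _]mxE consVS [X in _ = _ + X]mxE consVS.
  by rewrite [RHS]addrC -addrA addrC.
set k := dot (basept p) (dirvec p) / dot (dirvec p) (dirvec p).
exists ((height y + k) * enorm (dirvec p)) => //.
by rewrite /= -/k scalerA mulfK// scalerDl addrACA addNr addr0 addrC.
Qed.

Lemma lineat_coords (l : V * V) : Lines l -> 0 < nform l.2 ->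
  l = lineat (\row_i foot i l, \row_i slope i l).
Proof.
move=> [l1 l2] s0; set p := (_, _).
have sn : nform l.2 != 0 by rewrite gt_eqF.
have E2 : l.2 = nform l.2 *: dirvec p.
  apply: rV_ext => [|i]; first by rewrite nform_scale nform_dirvec mulr1.
  by rewrite [RHS]mxE consVS mxE /slope posinv_gt0// mulrCA mulfV// mulr1.
have E1 : l.1 = height l.1 *: dirvec p + basept p.
  apply: rV_ext => [|i].
    rewrite nform_lin nform_dirvec mulr1.
    have := height_basept p; rewrite {1}/height => /eqP; rewrite subr_eq0 => /eqP ->.
    by rewrite subrK.
  rewrite [RHS]mxE [X in _ = X + _]mxE consVS [X in _ = _ + X]mxE consVS !mxE.
  rewrite /foot /side; ring.
have D0 := enorm_dirvec_gt0 p; have Dn : enorm (dirvec p) != 0 by rewrite gt_eqF.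
have eZ (a : R) (x : V) : 0 <= a -> enorm (a *: x) = a * enorm x.
  move=> a0; rewrite /enorm dot_scale dotC dot_scale mulrA -expr2.
  by rewrite sqrtrM ?sqr_ge0// sqrtr_sqr ger0_norm.
have sE : nform l.2 = (enorm (dirvec p))^-1.
  have : enorm (nform l.2 *: dirvec p) = 1 by rewrite -E2.
  rewrite eZ ?(ltW s0)// => h; apply: (mulIf Dn); rewrite h mulVf//.
have dz : dot l.1 (dirvec p) = 0.
  move: l2; rewrite E2 dotC dot_scale => /eqP; rewrite mulf_eq0 (negbTE sn) /= dotC => /eqP //.
have hk : height l.1 = - (dot (basept p) (dirvec p) / dot (dirvec p) (dirvec p)).
  have dn : dot (dirvec p) (dirvec p) != 0 by rewrite dot_sq expf_neq0.
  apply: (mulIf dn); rewrite mulNr divfK//; move: dz; rewrite {1}E1 dotD dot_scale => /eqP.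
  by rewrite addr_eq0 => /eqP.
rewrite [l]surjective_pairing /lineat -/p; congr pair; last by rewrite {1}E2 sE.
by rewrite {1}E1 hk scaleNr addrC.
Qed.

(** Used to pull a neighborhood of a line back to a box of feet and slopes, and to map closed boxes
    to compact sets of lines. *)
Lemma continuous_lineat : continuous lineat.
Proof.
have oT : open [set: P] by exact: openT.
have su i : smooth (fun p : P => p.1 0 i).
  apply: smooth_affine => // [l|v].
    by apply: (@continuous_comp P _ R fst (fun x => x 0 i) l); [exact: cvg_fst|exact: continuous_coord].
  by exists (v.1 0 i) => l; apply: is_derive_affine => h; rewrite /= !mxE.
have sv i : smooth (fun p : P => p.2 0 i).
  apply: smooth_affine => // [l|v].
    by apply: (@continuous_comp P _ R snd (fun x => x 0 i) l); [exact: cvg_snd|exact: continuous_coord].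
  by exists (v.2 0 i) => l; apply: is_derive_affine => h; rewrite /= !mxE.
have sB j : smooth (fun p => basept p 0 j).
  have -> : (fun p => basept p 0 j) = (fun p => x0 0 j + consV (- (\sum_i m i * p.1 0 i) / c) p.1 0 j).
    by apply/funext=> p; rewrite mxE.
  apply: smoothD => //; first exact: smooth_cst.
  case: (unliftP ord0 j) => [k ->|->].
    by apply: (smooth_ext oT _ (su k)) => p _; rewrite consVS.
  apply: (@smooth_ext _ _ _ (fun p : P => c^-1 * (-1 * \sum_i m i * p.1 0 i))) => //.
    by move=> p _; rewrite consV0 mulN1r mulrC.
  by do 2 apply: smoothZ => //; apply: smooth_sum => // i; exact: smoothZ.
have sD j : smooth (fun p => dirvec p 0 j).
  case: (unliftP ord0 j) => [k ->|->].
    by apply: (smooth_ext oT _ (sv k)) => p _; rewrite consVS.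
  apply: (@smooth_ext _ _ _ (fun p : P => c^-1 * (1 - \sum_i m i * p.2 0 i))) => //.
    by move=> p _; rewrite consV0 mulrC.
  apply: smoothZ => //; apply: smoothB => //; first exact: smooth_cst.
  by apply: smooth_sum => // i; exact: smoothZ.
have sDD : smooth (fun p => dot (dirvec p) (dirvec p)).
  by apply: smooth_sum => // i; exact: smoothM.
have sBD : smooth (fun p => dot (basept p) (dirvec p)).
  by apply: smooth_sum => // i; exact: smoothM.
have D0 p : dot (dirvec p) (dirvec p) != 0.
  by rewrite dot_sq expf_neq0// gt_eqF// enorm_dirvec_gt0.
move=> p.
have c1 : {for p, continuous (fun p => (lineat p).1)}.
  apply: continuous_rV => i.
  pose F (p : P) := basept p 0 i - (dot (basept p) (dirvec p) * (dot (dirvec p) (dirvec p))^-1) * dirvec p 0 i.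
  have sF : smooth F.
    by apply: smoothB => //; apply: smoothM => //; apply: smoothM => //; exact: smoothV.
  rewrite (_ : (fun _ => _) = F); first exact: (smooth_continuous sF).
  by apply/funext=> q; rewrite /F !mxE.
have c2 : {for p, continuous (fun p => (lineat p).2)}.
  apply: continuous_rV => i.
  rewrite (_ : (fun _ => _) = fun p => (enorm (dirvec p))^-1 * dirvec p 0 i); last first.
    by apply/funext=> q; rewrite mxE.
  apply: cvgM; last exact: (smooth_continuous (sD i)).
  apply: cvgV; first by rewrite gt_eqF// enorm_dirvec_gt0.
  apply: (@continuous_comp _ _ _ (fun p => dot (dirvec p) (dirvec p)) (@Num.sqrt R)).
    exact: (smooth_continuous sDD).
  exact: sqrt_continuous.
exact: cvg_pair c1 c2.
Qed.
End LineAt.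

(** * Vanishing of [f] on line products *)

Section Vanishing.
Context {R : realType} {n : nat}.
Notation V := 'rV[R]_n.+1.
Notation P := ('rV[R]_n * 'rV[R]_n)%type.
Notation mu := (@lebesgue_measure R).
Variables (f : @cdistribution R n.+1) (x0 : V) (c : R) (m : 'I_n -> R).
Hypothesis c0 : c != 0.
Local Notation nform := (nform c m).
Local Notation height := (height x0 c m).
Local Notation side := (side x0).
Local Notation slope := (slope c m).
Local Notation foot := (foot x0 c m).
Local Notation lineat := (lineat x0 c m).
Local Notation lineprod := (lineprod x0 c m).
Local Notation linefactor := (linefactor x0 c m).

(** The local form of [Xf = 0] near the line of foot [q.1] and slope [q.2], for product test
    functions; it is expressed through their images under the adjoint. *)
Definition vanish_near (q : P) (e : R) : Prop := forall hh aa : 'I_n -> R -> R,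
  (forall i, tame (hh i)) -> (forall i, tame (aa i)) ->
  (forall i x, hh i x != 0 -> `|q.1 0 i - x| <= e) ->
  (forall i x, aa i x != 0 -> `|q.2 0 i - x| <= e) ->
  rpairing f (lineprod hh aa) = 0.

Lemma pair_coord1 (q : P) i : `|q.1 0 i| <= `|q|.
Proof. by apply: le_trans (rV_norm_coord _ _) _; rewrite [leRHS]prod_normE le_max lexx. Qed.

Lemma pair_coord2 (q : P) i : `|q.2 0 i| <= `|q|.
Proof. by apply: le_trans (rV_norm_coord _ _) _; rewrite [leRHS]prod_normE le_max lexx orbT. Qed.

Lemma vanish_near_mono (x y : P) e e' : vanish_near x e -> `|x - y| + e' <= e -> vanish_near y e'.
Proof.
move=> Hx xy hh aa th ta Hh Ha; apply: Hx => // i z.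
  move=> /Hh yz; rewrite (_ : x.1 0 i - z = (x.1 0 i - y.1 0 i) + (y.1 0 i - z)); last by ring.
  have := pair_coord1 (x - y) i; rewrite /= !mxE => h.
  by rewrite (le_trans (ler_normD _ _))//; lra.
move=> /Ha yz; rewrite (_ : x.2 0 i - z = (x.2 0 i - y.2 0 i) + (y.2 0 i - z)); last by ring.
have := pair_coord2 (x - y) i; rewrite /= !mxE => h.
by rewrite (le_trans (ler_normD _ _))//; lra.
Qed.

Lemma compact_pair_box (q : P) (e1 e2 : R) : compact [set p : P |
  (forall i, `|q.1 0 i - p.1 0 i| <= e1) /\ (forall i, `|q.2 0 i - p.2 0 i| <= e2)].
Proof.
have cB (u : 'rV[R]_n) e : compact [set v : 'rV[R]_n | forall i, `|u 0 i - v 0 i| <= e].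
  rewrite (_ : [set v | _] = [set v : 'rV[R]_n | forall i, `[u 0 i - e, u 0 i + e]%classic (v 0 i)]).
    by apply: (@rV_compact R n (fun i => `[u 0 i - e, u 0 i + e]%classic)) => i; exact: segment_compact.
  by apply/seteqP; split=> x /= h i; have := h i; rewrite in_itv /= ler_distlC.
have := compact_setX (cB q.1 e1) (cB q.2 e2).
by congr compact.
Qed.

(** A small closed box around [q] is mapped by [lineat] to a compact set inside [W], and contains
    the coordinates of all lines on which the test function is nonzero. *)
Lemma vanish_near_of_local (q : P) (W : set (V * V)) : open W -> W (lineat q) ->
  (forall eta, Lines_test_fun eta -> compact (Lines_fun_support eta) ->
     Lines_fun_support eta `<=` W -> Xray f eta = 0) ->
  exists2 e, 0 < e & vanish_near q e.
Proof.
move=> oW Wq HW.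
have /nbhs_ballP[e /= e0 He] : nbhs q (lineat @^-1` W).
  by apply: (continuous_lineat c0); exact: open_nbhs_nbhs.
exists (e / 2) => [|hh aa th ta Hh Ha]; first by rewrite divr_gt0.
pose eta l := Complex (line_fun x0 c m hh aa l) 0.
pose K := [set p : P |
  (forall i, `|q.1 0 i - p.1 0 i| <= e / 2) /\ (forall i, `|q.2 0 i - p.2 0 i| <= e / 2)].
have cK : compact (lineat @` K).
  apply: continuous_compact; last exact: compact_pair_box.
  by apply: continuous_subspaceT => p; exact: continuous_lineat.
have clK : closed (lineat @` K) by apply: compact_closed cK; exact: norm_hausdorff.
have sub : Lines_fun_support eta `<=` lineat @` K.
  rewrite (iffLR (closure_id _) clK); apply: closureS => l [Ll etal].
  have {}etal : line_fun x0 c m hh aa l != 0 by apply: contraNneq etal => h; rewrite /eta h.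
  have [s0 Hl] := line_fun_neq0 etal.
  exists (\row_i foot i l, \row_i slope i l); last by rewrite -lineat_coords.
  by split=> i /=; rewrite mxE; [apply: Hh (Hl i).1|apply: Ha (Hl i).2].
have KW : lineat @` K `<=` W.
  move=> _ [p [K1 K2] <-]; apply: He; rewrite -ball_normE /= prod_normE gt_max.
  apply/andP; split; apply: rV_norm_lt => // i; rewrite !mxE.
    by apply: le_lt_trans (K1 i) _; lra.
  by apply: le_lt_trans (K2 i) _; lra.
have := HW eta (Lines_test_line_fun x0 m c0 th ta) (subclosed_compact (@closed_closure _ _) cK sub)
  (subset_trans sub KW).
rewrite /Xray (_ : Xray_adjoint eta = fun y => Complex (`|c|^-1 * lineprod hh aa y) 0); last first.
  by apply/funext=> y; exact: Xray_adjoint_line_fun.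
have := rpairingZ f `|c|^-1 (smooth_lineprod x0 c m th ta); rewrite /rpairing => -> /eqP.
rewrite mulf_eq0 => /orP[|/eqP //].
by rewrite eq_complex /= eqxx andbT invr_eq0 normr_eq0 (negbTE c0).
Qed.

(** No line with foot and slope close to [q] comes near [C]: the discrepancy [D] has a positive
    minimum on the compact [C]. The product therefore vanishes on a neighborhood of [C], and the
    support of [f] does the rest. *)
Lemma vanish_near_of_miss (q : P) (C : set V) : compact C -> C !=set0 -> dsupport f `<=` C ->
  (forall y, C y -> ~ forall i, side i y = q.1 0 i + height y * q.2 0 i) ->
  exists2 e, 0 < e & vanish_near q e.
Proof.
move=> cC C0 fC Hq.
pose D (y : V) := \sum_i `|side i y - q.1 0 i - height y * q.2 0 i|.
have cD : continuous D.
  have cs i : continuous (fun y => side i y - q.1 0 i - height y * q.2 0 i).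
    have oT : open [set: V] by exact: openT.
    suff H : smooth (fun y => side i y - q.1 0 i - height y * q.2 0 i).
      by move=> y; exact: (smooth_continuous H).
    apply: smoothB => //; first by apply: smoothB => //; [exact: smooth_side|exact: smooth_cst].
    by apply: smoothM => //; [exact: smooth_height|exact: smooth_cst].
  have cn i : continuous (fun y => `|side i y - q.1 0 i - height y * q.2 0 i|).
    move=> y; apply: (@continuous_comp V R R (fun y => side i y - q.1 0 i - height y * q.2 0 i)
      (fun z => `|z|)); [exact: cs|exact: norm_continuous].
  rewrite /D; elim: (index_enum _) => [|i r IH].
    by under eq_fun do rewrite big_nil; exact: cst_continuous.
  under eq_fun do rewrite big_cons.
  by move=> y; exact: (cvgD (cn i y) (IH y)).
have [y0 Cy0 Hy0] := compact_EVT_min C0 cC (continuous_subspaceT cD).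
have ch : continuous height by move=> y; exact: (smooth_continuous (smooth_height x0 c m)).
have cah : continuous (fun y => `|height y|).
  by move=> y; apply: (@continuous_comp V R R height (fun z => `|z|)); [exact: ch|exact: norm_continuous].
have [y1 Cy1 Hy1] := compact_EVT_max C0 cC (continuous_subspaceT cah).
have D0 : 0 < D y0.
  rewrite lt_neqAle sumr_ge0// andbT eq_sym; apply/eqP => /eqP.
  rewrite psumr_eq0// => /allP H; apply: (Hq y0); first by move: Cy0; rewrite inE.
  move=> i; have := H i (mem_index_enum _); rewrite /= normr_eq0 subr_eq0 => /eqP h.
  by rewrite -h addrC subrK.
pose T := `|height y1| + 1.
(* Where the product is nonzero and [|height| < T], each term of [D] is at most [e * (1 + T)], so
   [D <= D y0 / 2]. The factor [n.+1] instead of [n] avoids a division by zero. *)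
pose e := D y0 / 2 / (n.+1%:R * (1 + T)).
have T0 : 0 < T by rewrite /T ltr_wpDl.
have e0 : 0 < e by rewrite !divr_gt0// mulr_gt0// ltr_wpDl.
exists e => // hh aa th ta Hh Ha.
pose O := [set y | D y0 / 2 < D y /\ `|height y| < T].
have oO : open O.
  apply: openI.
    by apply: (@open_comp _ _ D [set z | D y0 / 2 < z]); [move=> y _; exact: cD|exact: open_gt].
  by apply: (@open_comp _ _ (fun y => `|height y|) [set z | z < T]); [move=> y _; exact: cah|exact: open_lt].
apply: (rpairing_support fC oO); last exact: smooth_lineprod.
  move=> y Cy; split.
    by rewrite (@lt_le_trans _ _ (D y0))//; [lra|apply: Hy0; rewrite inE].
  by rewrite /T (@le_lt_trans _ _ `|height y1|)//; [apply: Hy1; rewrite inE|rewrite ltrDl].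
move=> y [Dy hy]; apply/eqP; apply: contraTT Dy => Py; rewrite -leNgt.
have Hi i : `|side i y - q.1 0 i - height y * q.2 0 i| <= e * (1 + T).
  have Fi : linefactor i (hh i) (aa i) y != 0.
    by move: Py; rewrite /lineprod (bigD1 i)//= mulf_eq0 negb_or => /andP[].
  have [v hv] : exists v, hh i (side i y - height y * v) * aa i v != 0.
    apply/not_existsP => H; move: Fi; rewrite /linefactor /lineint.
    rewrite (_ : (fun v => _) = fun=> 0) ?/Rintegral ?integral0 ?eqxx//.
    by apply/funext=> v; apply/eqP; apply: contra_notT (H v).
  move: hv; rewrite mulf_eq0 negb_or => /andP[/Hh h1 /Ha h2].
  rewrite (_ : _ - _ - _ = - (q.1 0 i - (side i y - height y * v)) - height y * (q.2 0 i - v)); last by ring.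
  rewrite (le_trans (ler_normB _ _))// normrN [leRHS]mulrDr mulr1 lerD// normrM mulrC ler_pM// ltW//.
rewrite (@le_trans _ _ (\sum_(i < n) e * (1 + T)))//; first exact: ler_sum.
have -> : \sum_(i < n) e * (1 + T) = e * (n%:R * (1 + T)).
  by rewrite sumr_const card_ord -[LHS]mulr_natr -mulrA; congr (_ * _); exact: mulrC.
rewrite (@le_trans _ _ (e * (n.+1%:R * (1 + T))))//.
  by rewrite ler_wpM2l ?(ltW e0)// ler_wpM2r ?ler_nat// addr_ge0// ltW.
by rewrite /e divfK// gt_eqF// mulr_gt0// ltr_wpDl.
Qed.

Lemma integrable_line i h a y : tame h -> tame a ->
  mu.-integrable setT (EFin \o (fun v => h (side i y - height y * v) * a v)).
Proof.
move=> [sh ch] [sa ca]; apply/bsm_integrable/csupp_bsm; last exact: csupp_mul.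
move=> v; apply: cvgM; last exact: smooth_cont.
apply: (@continuous_comp _ _ _ (fun v => side i y - height y * v) h); last exact: smooth_cont.
by apply: cvgB; [exact: cvg_cst|apply: cvgM; [exact: cvg_cst|exact: cvg_id]].
Qed.

Lemma Rintegral_sum J (r : seq J) (F : J -> R -> R) :
  (forall j, mu.-integrable setT (EFin \o F j)) ->
  mu.-integrable setT (EFin \o (fun v => \sum_(j <- r) F j v)) /\
  \int[mu]_v (\sum_(j <- r) F j v) = \sum_(j <- r) \int[mu]_v F j v.
Proof.
move=> iF; elim: r => [|j r [IH1 IH2]].
  rewrite big_nil; under [X in EFin \o X]eq_fun do rewrite big_nil.
  under eq_Rintegral do rewrite big_nil.
  by split; [exact: integrable0|rewrite /Rintegral integral0].
rewrite big_cons -IH2 -RintegralD//; under [X in EFin \o X]eq_fun do rewrite big_cons.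
split; last by apply: eq_Rintegral => v _; rewrite big_cons.
exact: (integrableD measurableT (iF j) IH1).
Qed.

Lemma linefactor_sum i (J K : finType) (h a : R -> R) (b : J -> R -> R) (b' : K -> R -> R) y :
  (forall j, tame (b j)) -> (forall j, tame (b' j)) ->
  (forall x, h x = \sum_j b j x) -> (forall x, a x = \sum_k b' k x) ->
  linefactor i h a y = \sum_(jk : J * K) linefactor i (b jk.1) (b' jk.2) y.
Proof.
move=> tb tb' hE aE.
have [_ <-] := Rintegral_sum (index_enum (J * K)%type)
  (fun jk => integrable_line i y (tb jk.1) (tb' jk.2)).
apply: eq_Rintegral => v _; rewrite hE aE mulr_suml.
rewrite -(pair_big xpredT xpredT (fun j k => b j (side i y - height y * v) * b' k v)) /=.
by apply: eq_bigr => j _; rewrite mulr_sumr.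
Qed.

Lemma tameM (h a : R -> R) : tame h -> smooth a -> tame (fun x => h x * a x).
Proof.
move=> [sh [L hL]] sa; split; first by apply: smoothM => //; exact: openT.
by exists L => x; rewrite mulf_eq0 negb_or => /andP[/hL].
Qed.

(** Compactness of the box gives one radius for all lines; every [hh i] and [aa i] is cut by a
    partition of that mesh, and expanding the product leaves terms each concentrated near one
    line. *)
Lemma lineprod_vanish (L1 L2 : R) :
  (forall q : P, (forall i, `|q.1 0 i| <= L1) -> (forall i, `|q.2 0 i| <= L2) ->
     exists2 e, 0 < e & vanish_near q e) ->
  forall hh aa, (forall i, tame (hh i)) -> (forall i, tame (aa i)) ->
  (forall i x, hh i x != 0 -> `|x| <= L1) -> (forall i x, aa i x != 0 -> `|x| <= L2) ->
  rpairing f (lineprod hh aa) = 0.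
Proof.
move=> HL hh aa th ta Hh Ha.
have cK := @compact_pair_box (0, 0) L1 L2.
have [q [K1 K2]|e e0 He] := @uniform_radius R _ _ vanish_near cK vanish_near_mono.
  by apply: HL => i; [have := K1 i|have := K2 i]; rewrite /= mxE sub0r normrN.
have [N [b [sb b1 _ bc]]] := smooth_partition (Num.max L1 L2) e0.
pose H (phi : {ffun 'I_n -> 'I_N * 'I_N}) i x := hh i x * b (phi i).1 x.
pose A (phi : {ffun 'I_n -> 'I_N * 'I_N}) i x := aa i x * b (phi i).2 x.
have tH phi i : tame (H phi i) by exact: tameM.
have tA phi i : tame (A phi i) by exact: tameM.
have split1 (h : R -> R) x : (forall x, h x != 0 -> `|x| <= Num.max L1 L2) -> h x = \sum_j h x * b j x.
  move=> hL; rewrite -mulr_sumr; have [->|/hL xL] := eqVneq (h x) 0; first by rewrite mul0r.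
  by rewrite b1// mulr1.
have -> : lineprod hh aa = fun y => \sum_phi lineprod (H phi) (A phi) y.
  apply/funext=> y.
  rewrite -(bigA_distr_bigA (fun i (jk : 'I_N * 'I_N) =>
    linefactor i (fun x => hh i x * b jk.1 x) (fun x => aa i x * b jk.2 x) y)).
  apply: eq_bigr => i _.
  apply: (@linefactor_sum i 'I_N 'I_N (hh i) (aa i) (fun j x => hh i x * b j x)
    (fun j x => aa i x * b j x) y).
  - by move=> j; exact: tameM.
  - by move=> j; exact: tameM.
  - by move=> x; apply: split1 => z /Hh h; rewrite le_max h.
  - by move=> x; apply: split1 => z /Ha h; rewrite le_max h orbT.
rewrite rpairing_sum => [|phi]; last exact: smooth_lineprod.
apply: big1 => phi _.
have [Hu|Hu] := pselect (forall i, exists uv : R * R, H phi i uv.1 != 0 /\ A phi i uv.2 != 0); last first.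
  suff -> : lineprod (H phi) (A phi) = fun=> 0 by exact: rpairing0.
  apply/funext=> y; move/existsNP : Hu => [i Hi].
  rewrite /lineprod (bigD1 i)//= [X in X * _](_ : _ = 0) ?mul0r//.
  rewrite /linefactor /lineint (_ : (fun v => _) = fun=> 0) ?/Rintegral ?integral0//.
  apply/funext=> v; apply/eqP; apply: contra_notT Hi; rewrite mulf_eq0 negb_or => /andP[h1 h2].
  by exists (side i y - height y * v, v).
(* The line around which the term is concentrated has its foot and slope at points where the pieces
   do not vanish. *)
have [uv Huv] := choice Hu.
pose q : P := (\row_i (uv i).1, \row_i (uv i).2).
have bnz (h : R -> R) j x : h x * b j x != 0 -> h x != 0 /\ b j x != 0.
  by rewrite mulf_eq0 negb_or => /andP.
apply: (He q) => //.
- split=> i; rewrite /= !mxE sub0r normrN.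
    by apply: Hh (bnz _ _ _ (Huv i).1).1.
  by apply: Ha (bnz _ _ _ (Huv i).2).1.
- move=> i x /bnz[_ bx]; rewrite /= mxE; apply/ltW; apply: bc bx.
  exact: (bnz _ _ _ (Huv i).1).2.
- move=> i x /bnz[_ bx]; rewrite /= mxE; apply/ltW; apply: bc bx.
  exact: (bnz _ _ _ (Huv i).2).2.
Qed.
End Vanishing.

(** * Convex geometry *)

Section Geometry.
Context {R : realType} {n : nat}.
Notation V := 'rV[R]_n.+1.
Variables (Omega Sigma : set V).
Hypothesis Omega_bounded : bounded_set Omega.
Hypothesis Omega_sconvex : strictly_convex Omega.
Hypothesis Sigma_open : relatively_open_in (boundary Omega) Sigma.
Local Notation C := (closure Omega).

Lemma compact_closure_Omega : compact C.
Proof.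
have [M [_ HM]] := Omega_bounded.
by apply: (@compact_closure_bounded _ _ (M + 1)) => y Oy; apply: HM => //; rewrite ltrDl.
Qed.

Lemma interior_sub_closure : Omega° `<=` C.
Proof. by move=> x /interior_subset /subset_closure. Qed.

Lemma closure_convex x y (t : R) : C x -> C y -> 0 <= t -> t <= 1 -> C ((1 - t) *: x + t *: y).
Proof.
move=> Cx Cy t0 t1; have [->|xy] := eqVneq x y.
  by rewrite -scalerDl subrK scale1r.
move: t0; rewrite le_eqVlt => /predU1P[<-|t0]; first by rewrite subr0 scale1r scale0r addr0.
move: t1; rewrite le_eqVlt => /predU1P[->|t1]; first by rewrite subrr scale0r add0r scale1r.
exact/interior_sub_closure/Omega_sconvex.
Qed.

(** Otherwise a ball around [p] lies in [C], and [p], as midpoint of two distinct points of that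
    ball, is interior by strict convexity. *)
Lemma boundary_exterior_point p (r : R) : boundary Omega p -> 0 < r ->
  exists2 x, `|p - x| < r & ~ C x.
Proof.
move=> [Cp nOp] r0; apply: contrapT => H.
have HC x : `|p - x| < r -> C x by move=> px; apply: contrapT => nC; apply: H; exists x.
apply: nOp; pose w : V := const_mx (r / 2).
have wn : `|w| < r.
  by apply: rV_norm_lt => // i; rewrite mxE ger0_norm ?divr_ge0 ?(ltW r0)//; lra.
have -> : p = (1 - 1 / 2) *: (p - w) + (1 / 2) *: (p + w).
  by apply/rowP => i; rewrite !mxE; field.
apply: (@Omega_sconvex (p - w) (p + w) (1 / 2)); [| | |lra|lra].
- by apply: HC; rewrite opprB addrC subrK.
- by apply: HC; rewrite opprD addrA subrr sub0r normrN.
- apply/eqP => /rowP /(_ ord0); rewrite !mxE => /eqP.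
  by rewrite (can2_eq (addKr _) (addNKr _)) addrA addNr add0r => /eqP; lra.
Qed.

(* Seen from an exterior point close enough to [p], the visible part of the
   boundary lies in a given neighborhood of [p]. *)
Lemma illuminating_ball : Sigma !=set0 -> exists (x0 : V) (r : R),
  [/\ 0 < r, ~ C x0 &
      forall y D s, `|x0 - y| < r -> C (s *: D + y) -> exists s', Sigma (s' *: D + y)].
Proof.
have [U [oU SU]] := Sigma_open.
move=> [p]; rewrite SU => -[bp Up].
have cC := compact_closure_Omega.
have clC : closed C by exact: closed_closure.
have /nbhs_ballP[r1 /= r10 Hr1] : nbhs p U by exact: open_nbhs_nbhs.
pose C' := C `&` [set a | r1 <= `|p - a|].
have cC' : compact C'.
  apply: (subclosed_compact _ cC) => [|x []//].
  apply: closedI => //.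
  apply: (@closed_comp _ _ (fun a : V => `|p - a|) [set z | r1 <= z]); last exact: closed_ge.
  move=> a _; apply: (@continuous_comp _ _ _ (fun a : V => p - a) (fun z : V => `|z|)).
    exact: (cvgB (cvg_cst p) (@cvg_id _ (nbhs a))).
  exact: norm_continuous.
(* By strict convexity the midpoint of [p] and a point [a] of [C] other than [p] is interior; this
   persists when both ends are perturbed, uniformly for [a] at distance at least [r1] from [p]. *)
pose Q (a : V) (e : R) := forall x a', `|p - x| <= e -> `|a - a'| <= e ->
  Omega° ((1 - 1 / 2) *: x + (1 / 2) *: a').
have [x y e e' Qx xy z a' pz ya'|a [Ca r1a]|e e0 He] := @uniform_radius R _ C' Q cC'.
- have e'e : e' <= e by apply: le_trans xy; rewrite lerDr.
  apply: Qx; first exact: le_trans e'e.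
  rewrite (_ : x - a' = (x - y) + (y - a')); last by rewrite addrA subrK.
  by apply: le_trans xy; rewrite (le_trans (ler_normD _ _))// lerD2l.
- have pa : p != a.
    by apply: contraTneq r1a => <-; rewrite subrr normr0 -ltNge.
  have Om : Omega° ((1 - 1 / 2) *: p + (1 / 2) *: a).
    by apply: (@Omega_sconvex p a (1 / 2) bp.1 Ca pa); lra.
  have /nbhs_ballP[e /= e0 Hb] : nbhs ((1 - 1 / 2) *: p + (1 / 2) *: a) (Omega°).
    by apply: open_nbhs_nbhs; split=> //; exact: open_interior.
  exists (e / 2); first by rewrite divr_gt0.
  move=> x a' px aa'; apply: Hb; rewrite -ball_normE /=.
  rewrite (_ : _ - _ = (1 - 1 / 2) *: (p - x) + (1 / 2) *: (a - a')); last first.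
    by apply/rowP => i; rewrite !mxE; ring.
  have half (u v : V) : `|(1 - 1 / 2) *: u + (1 / 2) *: v| <= (`|u| + `|v|) / 2.
    have E : 1 - 1 / 2 = 2^-1 :> R by lra.
    rewrite E div1r (le_trans (ler_normD _ _))// !normrZ gtr0_norm ?invr_gt0//.
    by rewrite -mulrDr mulrC.
  by apply: (le_lt_trans (half _ _)); lra.
have [x0 px0 nCx0] := boundary_exterior_point bp e0.
have /nbhs_ballP[r /= r0 Hr] : nbhs x0 (~` C `&` ball p e).
  apply: open_nbhs_nbhs; split; last by split=> //; rewrite -ball_normE.
  by apply: openI; [exact: closed_openC|exact: ball_open].
exists x0, r; split=> // y D s0 x0y Cs0.
have [nCy] : (~` C `&` ball p e) y by apply: Hr; rewrite -ball_normE.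
rewrite -ball_normE /= => py.
(* The parameter of least absolute value whose point lies in [C] marks a point of [C] on the line
   closest to [y]. It is shown to be on the boundary and near [p]. *)
pose K := [set s : R | `[- `|s0|, `|s0|]%classic s] `&` [set s | C (s *: D + y)].
have caff : continuous (fun s : R => s *: D + y).
  by move=> s; apply: cvgD; [apply: cvgZr_tmp; exact: cvg_id|exact: cvg_cst].
have cK : compact K.
  apply: (subclosed_compact _ (@segment_compact R (- `|s0|) `|s0|)) => [|x []//].
  apply: closedI; first exact: itv_closed.
  exact: (@closed_comp R V (fun s : R => s *: D + y) C (fun s _ => caff s) clC).
have K0 : K !=set0 by exists s0; split=> //=; rewrite in_itv /= -ler_norml.
have [s1] := compact_EVT_min K0 cK (continuous_subspaceT (@norm_continuous R R)).
move=> /set_mem[/= s1s0 Cs1] Hmin.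
have s1_min s : C (s *: D + y) -> `|s1| <= `|s|.
  move=> Cs; have [ss0|/ltW ss0] := leP `|s| `|s0|.
    by apply: Hmin; apply: mem_set; split=> //=; rewrite in_itv /= -ler_norml.
  by apply: le_trans ss0; move: s1s0; rewrite in_itv /= -ler_norml.
have s1n0 : 0 < `|s1|.
  rewrite normr_gt0; apply/eqP => s10; apply: nCy.
  by move: Cs1; rewrite s10 scale0r add0r.
exists s1; split; last first.
  (* If this point were far from [p], its midpoint with [y] would lie in [C] and be closer to
     [y]. *)
  apply: Hr1; rewrite -ball_normE /= ltNge; apply/negP => r1s.
  have H := He (s1 *: D + y) (conj Cs1 r1s) y (s1 *: D + y) (ltW py).
  have /interior_sub_closure : Omega° ((1 - 1 / 2) *: y + (1 / 2) *: (s1 *: D + y)).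
    by apply: H; rewrite subrr normr0 ltW.
  have -> : (1 - 1 / 2) *: y + (1 / 2) *: (s1 *: D + y) = (s1 / 2) *: D + y.
    by apply/rowP => i; rewrite !mxE; field.
  by move=> /s1_min; rewrite normrM [`|2^-1|]ger0_norm ?invr_ge0//; lra.
split=> // Os1.
have /nbhs_ballP[q /= q0 Hq] : nbhs (s1 *: D + y) (Omega°).
  by apply: open_nbhs_nbhs; split=> //; exact: open_interior.
(* If the point were interior, moving it towards [y] by a small proportion [h] would not leave [C],
   against minimality. *)
pose h := Num.min (1 / 2) (q / 2 / (`|s1| * `|D| + 1)).
have d0 : 0 < `|s1| * `|D| + 1 by rewrite ltr_wpDl// mulr_ge0.
have h0 : 0 < h by rewrite /h lt_min !divr_gt0.
have hh : h <= 1 / 2 by rewrite /h ge_min lexx.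
have hq : h * (`|s1| * `|D| + 1) <= q / 2.
  by rewrite -ler_pdivlMr// /h ge_min lexx orbT.
have /interior_sub_closure/s1_min : Omega° (((1 - h) * s1) *: D + y).
  apply: Hq; rewrite -ball_normE /=.
  rewrite (_ : _ - _ = (h * s1) *: D); last by apply/rowP => i; rewrite !mxE; ring.
  rewrite normrZ normrM gtr0_norm//.
  have : h * `|s1| * `|D| <= h * (`|s1| * `|D| + 1) by rewrite -mulrA ler_wpM2l ?(ltW h0)// lerDl.
  lra.
rewrite normrM ger0_norm; last lra.
by rewrite -[leLHS]mul1r ler_pM2r//; lra.
Qed.

(** The direction [g] from [x0] to its nearest point in [C] separates with margin [dot g g]. Its
    first coordinate may be 0, whereas the coordinates on lines require [c != 0]: a perturbation [k]
    of this coordinate costs at most half of the margin. *)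
Lemma separating_form x0 : C !=set0 -> ~ C x0 -> exists (c : R) (m : 'I_n -> R) (t0 : R),
  [/\ c != 0, 0 < t0 & forall y, C y -> t0 <= height x0 c m y].
Proof.
move=> C0 nCx0; have cC := compact_closure_Omega.
pose q (y : V) := dot (y - x0) (y - x0).
have oT : open [set: V] by exact: openT.
have sc i : smooth (fun y : V => (y - x0) 0 i).
  have : smooth (fun y : V => y 0 i - x0 0 i) by apply: smoothB => //; [exact: smooth_coord|exact: smooth_cst].
  by apply: smooth_ext => // y _; rewrite !mxE.
have sq : smooth q by apply: smooth_sum => // i; exact: smoothM.
have cq : continuous q by move=> y; exact: (smooth_continuous sq).
have [z] := compact_EVT_min C0 cC (continuous_subspaceT cq).
move=> /set_mem Cz zmin; pose g := z - x0.
have dot_ge0 (x : V) : 0 <= dot x x by rewrite sumr_ge0// => i _; rewrite -expr2 sqr_ge0.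
have g0 : 0 < dot g g.
  rewrite lt_neqAle dot_ge0 andbT eq_sym; apply/eqP => /eqP.
  rewrite psumr_eq0 => [/allP H|i _]; last by rewrite -expr2 sqr_ge0.
  apply: nCx0; suff -> : x0 = z by [].
  apply/rowP => i; have := H i (mem_index_enum _); rewrite /= mulf_eq0 orbb !mxE subr_eq0.
  by move=> /eqP.
have dotDr (x y w : V) : dot w (x + y) = dot w x + dot w y.
  by rewrite dotC dotD !(dotC w).
have dotZr a (x w : V) : dot w (a *: x) = a * dot w x by rewrite dotC dot_scale dotC.
have dot_expand (u w : V) t :
    dot (u + t *: w) (u + t *: w) = dot u u + (2 * (t * dot u w) + t * (t * dot w w)).
  rewrite dotD !dotDr !dotZr !dot_scale (dotC w u).
  by rewrite mulr_natl mulr2n !addrA.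
have Hg y : C y -> dot g g <= dot g (y - x0).
  move=> Cy; have -> : y - x0 = g + (y - z) by rewrite /g [RHS]addrC addrA subrK.
  rewrite dotDr lerDl leNgt; apply/negP => gneg.
  pose a := - dot g (y - z); pose b := dot (y - z) (y - z).
  have a0 : 0 < a by rewrite oppr_gt0.
  have b0 : 0 <= b by exact: dot_ge0.
  (* Short enough for the quadratic term [t * (t * b)] to stay below the gain [t * (2 * a)]: moving
     from [z] towards [y] would bring the point closer to [x0]. *)
  pose t := Num.min 1 (a / (b + 1)).
  have b10 : 0 < b + 1 by rewrite ltr_wpDl.
  have t0 : 0 < t by rewrite lt_min ltr01 divr_gt0.
  have t1 : t <= 1 by rewrite ge_min lexx.
  have ta : t * (b + 1) <= a by rewrite -ler_pdivlMr// ge_min lexx orbT.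
  have Ct : C ((1 - t) *: z + t *: y) by apply: closure_convex => //; exact: ltW.
  have := zmin _ (mem_set Ct); rewrite /q.
  have -> : (1 - t) *: z + t *: y - x0 = g + t *: (y - z).
    by apply/rowP => i; rewrite !mxE; ring.
  rewrite dot_expand -/b (_ : dot g (y - z) = - a); last by rewrite opprK.
  rewrite -/g lerDl => H.
  have H2 : t * (2 * a) <= t * (t * b) by lra.
  by move: H2; rewrite ler_pM2l// => H2; nra.
have [B B0 HB] := compact_norm_bounded cC.
pose B' := B + `|x0| + 1.
have B'0 : 0 < B' by rewrite /B'; have := normr_ge0 x0; lra.
pose k := if g 0 ord0 == 0 then dot g g / 2 / B' else 0.
have k0 : 0 <= k by rewrite /k; case: ifP => // _; rewrite !divr_ge0// ltW.
have kB : k * B' <= dot g g / 2.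
  by rewrite /k; case: ifP => _; [rewrite divfK// gt_eqF|rewrite mul0r divr_ge0].
exists (g 0 ord0 + k), (fun i => g 0 (lift ord0 i)), (dot g g / 2); split.
- rewrite /k; case: ifP => [/eqP ->|/negbT]; last by rewrite addr0.
  by rewrite add0r gt_eqF// !divr_gt0.
- by rewrite divr_gt0.
move=> y Cy.
have -> : height x0 (g 0 ord0 + k) (fun i => g 0 (lift ord0 i)) y =
    dot g (y - x0) + k * (y - x0) 0 ord0.
  have hi i : (y - x0) 0 i = y 0 i - x0 0 i by rewrite !mxE.
  have hs : \sum_(i < n) g 0 (lift ord0 i) * (y - x0) 0 (lift ord0 i) =
    \sum_(i < n) g 0 (lift ord0 i) * y 0 (lift ord0 i) -
    \sum_(i < n) g 0 (lift ord0 i) * x0 0 (lift ord0 i).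
    by rewrite -sumrB; apply: eq_bigr => i _; rewrite hi mulrBr.
  rewrite /height /nform /dot [in RHS]big_ord_recl hs hi; ring.
have h1 := Hg _ Cy.
have h2 : `|(y - x0) 0 ord0| <= B'.
  rewrite (le_trans (rV_norm_coord _ _))// (le_trans (ler_normB _ _))//.
  by rewrite /B'; have := HB _ Cy; lra.
have h3 : - (k * B') <= k * (y - x0) 0 ord0.
  rewrite -mulrN ler_wpM2l//; move: h2; rewrite ler_norml => /andP[] //.
lra.
Qed.
End Geometry.

(** * Annihilation of polynomials *)

Section Moments.
Context {R : realType}.
Notation mu := (@lebesgue_measure R).
Let oT : open [set: R] := @openT _.

Lemma Rintegral_derive_csupp (F : R -> R) : smooth F -> csupp F -> \int[mu]_x 'D_1 F x = 0.
Proof.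
move=> sF [L0 hL0]; pose L := `|L0| + 1.
have L_gt0 : 0 < L by rewrite /L ltr_wpDl.
have hL x : F x != 0 -> `|x| < L.
  by move=> /hL0 h; rewrite (le_lt_trans h)// /L (le_lt_trans (ler_norm _))// ltrDl.
have F0 x : L <= `|x| -> F x = 0.
  by move=> Lx; apply/eqP; apply: contraTT Lx => /hL; rewrite -ltNge.
have dF (x : R) : is_derive x (1 : R) F ('D_1 F x) := smooth_is_derive (1 : R) sF I.
transitivity (\int[mu]_(x in `[- L, L]) 'D_1 F x).
  rewrite [RHS]Rintegral_mkcond; apply: eq_Rintegral => x _.
  rewrite patchE; case: ifPn => //; rewrite notin_setE /= in_itv /= -ler_norml => /negP xL.
  apply/eqP; apply: contraNT xL => /(csupp_derive (fun y Fy => ltW (hL y Fy))) //.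
rewrite (Rintegral_derive (F := F)) ?F0 ?subrr//; last exact/smooth_cont/smooth_derive.
- by rewrite normrN ger0_norm// ltW.
- by rewrite ger0_norm// ltW.
- lra.
Qed.

Lemma Rintegral_gt0 (h : R -> R) : continuous h -> csupp h -> (forall x, 0 <= h x) ->
  0 < h 0 -> 0 < \int[mu]_x h x.
Proof.
move=> ch sh h0 h00; have ih := bsm_integrable (csupp_bsm ch sh).
have h20 : 0 < h 0 / 2 by rewrite divr_gt0.
have /cvgrPdist_lt /(_ _ h20) /nbhs_ballP[r /= r0 Hr] := ch 0.
pose B := (`[- (r / 2), r / 2]%classic : set R).
have mB : measurable B by exact: measurable_itv.
have iB : mu.-integrable B (EFin \o cst (h 0 / 2)).
  apply: measurable_bounded_integrable; [exact: measurable_itv| |exact: measurable_cst|].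
    exact/compact_finite_measure/segment_compact.
  by exists (h 0 / 2); split; [rewrite num_real|move=> x Mx y _ /=; rewrite ger0_norm ?ltW// (ltW h20)].
have E : \int[mu]_(x in B) (h 0 / 2) = h 0 / 2 * r.
  rewrite Rintegral_cst//; congr (_ * _).
  rewrite [X in fine X](_ : _ = r%:E)//.
  apply: (etrans (lebesgue_measure_itv _)); rewrite /= lte_fin ifT; last lra.
  by rewrite -EFinB; congr EFin; lra.
apply: (@lt_le_trans _ _ (h 0 / 2 * r)); first exact: mulr_gt0.
rewrite -E; apply: (@le_trans _ _ (\int[mu]_(x in B) h x)).
  apply: le_Rintegral => //; first exact: (integrableS measurableT).
  move=> x; rewrite /B /= in_itv /= => /andP[x1 x2].
  have : `|h 0 - h x| < h 0 / 2 by apply: Hr; rewrite -ball_normE /= sub0r normrN ltr_norml; lra.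
  by rewrite ltr_norml => /andP[_ H]; lra.
have ihB : mu.-integrable B (EFin \o h) by apply: (integrableS measurableT).
have /(_ ihB) := (integrable_mkcond (mu:=mu) (EFin \o h) mB).1; rewrite restrict_EFin => ihB'.
rewrite Rintegral_mkcond; apply: le_Rintegral => //.
by move=> x _; rewrite patchE; case: ifP.
Qed.

Definition bump (e x : R) : R := sstep (e - x) * sstep (x + e).

Lemma smooth_bump e : smooth (bump e).
Proof.
apply: smoothM => //; apply: (smooth_comp (W := setT) oT _ smooth_sstep) => //.
  by apply: (smooth_ext oT _ (smooth_affine1 (-1) e)) => x _; rewrite mulN1r addrC.
by apply: (smooth_ext oT _ (smooth_affine1 1 e)) => x _; rewrite mul1r.
Qed.

Lemma bump_neq0 e x : bump e x != 0 -> `|x| <= e.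
Proof.
apply: contraNT; rewrite ler_norml negb_and -!ltNge /bump => /orP[h|h].
  by rewrite (@sstep0 _ (x + e)) ?mulr0//; lra.
by rewrite sstep0 ?mul0r//; lra.
Qed.

Definition bumpD e l : R -> R := iter l (fun h => 'D_(1 : R) h) (bump e).

Lemma smooth_bumpD e l : smooth (bumpD e l).
Proof. by elim: l => [|l IH]; [exact: smooth_bump|exact: smooth_derive]. Qed.

Lemma bumpD_neq0 e l x : bumpD e l x != 0 -> `|x| <= e.
Proof. by elim: l x => [|l IH] x; [exact: bump_neq0|exact: csupp_derive]. Qed.

Definition moment j (h : R -> R) : R := \int[mu]_u (u ^+ j * h u).

Lemma smooth_exprn j : smooth (fun u : R => u ^+ j).
Proof. by apply: smoothX => //; exact: smooth_id. Qed.

Lemma moment_integrable j h : tame h -> mu.-integrable setT (EFin \o (fun u => u ^+ j * h u)).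
Proof.
move=> [sh ch]; apply/bsm_integrable/csupp_bsm; last exact: csupp_mul.
by apply: smooth_cont; apply: smoothM => //; exact: smooth_exprn.
Qed.

(** Integration by parts: differentiation shifts the moments by one, so that the [l]-th derivative
    of a bump has no moment of order below [l]. *)
Lemma moment_derive j h : tame h -> moment j ('D_1 h) = - (j%:R * moment j.-1 h).
Proof.
move=> th; have [sh ch] := th; have sF : smooth (fun u : R => u ^+ j * h u).
  by apply: smoothM => //; exact: smooth_exprn.
have tD : tame ('D_1 h).
  by split; [exact: smooth_derive|have [L hL] := ch; exists L; exact: csupp_derive].
have D (u : R) : 'D_1 (fun u : R => u ^+ j * h u) u = u ^+ j * 'D_1 h u + j%:R * (u ^+ j.-1 * h u).
  have dX : is_derive u (1 : R) (fun x : R => x ^+ j) (j%:R * u ^+ j.-1).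
    by apply: DeriveDef; [exact: exprn_derivable|rewrite exp_derive [_ *: 1]mulr1].
  have [_ ->] := is_derive_mul dX (smooth_is_derive (1 : R) sh I).
  by rewrite [h u * _]mulrC -mulrA.
have := Rintegral_derive_csupp sF (csupp_mul _ ch).
under eq_Rintegral do rewrite D.
have i2 := moment_integrable j.-1 th.
rewrite RintegralD//; [|exact: moment_integrable|].
  by rewrite RintegralZl// => /eqP; rewrite addr_eq0 => /eqP.
have := integrableZl measurableT j%:R i2.
by apply: eq_integrable => // x _ /=; rewrite EFinM.
Qed.

Lemma tame_bumpD e l : tame (bumpD e l).
Proof. by split; [exact: smooth_bumpD|exists e; exact: bumpD_neq0]. Qed.

Lemma moment_bumpD_lt e j l : (j < l)%N -> moment j (bumpD e l) = 0.
Proof.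
elim: l j => // l IH [|j] jl; rewrite [moment _ _](moment_derive _ (tame_bumpD e l)).
  by rewrite mul0r oppr0.
by rewrite IH// mulr0 oppr0.
Qed.

Lemma moment_bumpD_eq e l : 0 < e -> moment l (bumpD e l) != 0.
Proof.
move=> e0; elim: l => [|l IH].
  rewrite gt_eqF//; have [sb cb] := tame_bumpD e 0.
  have -> : moment 0 (bumpD e 0) = \int[mu]_u bump e u.
    by apply: eq_Rintegral => u _; rewrite expr0 mul1r.
  apply: Rintegral_gt0 => //; first exact: smooth_cont.
    by move=> x; rewrite mulr_ge0// sstep_ge0.
  by rewrite /bump subr0 add0r mulr_gt0// sstep_gt0.
by rewrite [moment _ _](moment_derive _ (tame_bumpD e l)) oppr_eq0 mulf_neq0// pnatr_eq0.
Qed.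

Lemma momentZ j a h : tame h -> moment j (fun u => a * h u) = a * moment j h.
Proof.
move=> th; rewrite /moment -RintegralZl//; last exact: moment_integrable.
by apply: eq_Rintegral => u _; rewrite mulrCA.
Qed.

Lemma tameD h g : tame h -> tame g -> tame (fun x : R => h x + g x).
Proof.
move=> [sh [L hL]] [sg [L' gL]]; split; first exact: smoothD.
exists (Num.max L L') => x hg; rewrite le_max.
have [hx|/hL ->//] := eqVneq (h x) 0.
by move: hg; rewrite hx add0r => /gL ->; rewrite orbT.
Qed.

Lemma tameZ a h : tame h -> tame (fun x : R => a * h x).
Proof. by move=> [sh ch]; split; [exact: smoothZ|exact: csupp_mul]. Qed.

Lemma momentD j h g : tame h -> tame g ->
  moment j (fun u => h u + g u) = moment j h + moment j g.
Proof.
move=> th tg; rewrite /moment -RintegralD//; [|exact: moment_integrable|exact: moment_integrable].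
by apply: eq_Rintegral => u _; rewrite mulrDr.
Qed.

Lemma tame0 : tame (fun=> 0 : R).
Proof. by split; [exact: smooth_cst|exists 0 => x; rewrite eqxx]. Qed.

Lemma moment0 j : moment j (fun=> 0) = 0.
Proof. by rewrite /moment; under eq_Rintegral do rewrite mulr0; rewrite /Rintegral integral0. Qed.

Lemma moment_sum j I (r : seq I) (a : I -> R) (h : I -> R -> R) : (forall i, tame (h i)) ->
  tame (fun u => \sum_(i <- r) a i * h i u) /\
  moment j (fun u => \sum_(i <- r) a i * h i u) = \sum_(i <- r) a i * moment j (h i).
Proof.
move=> th; elim: r => [|i r [IH1 IH2]].
  under eq_fun do rewrite big_nil; rewrite big_nil moment0; split=> //; exact: tame0.
under eq_fun do rewrite big_cons; rewrite big_cons -IH2 -momentZ// -momentD//; last exact: tameZ.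
by split=> //; apply: tameD => //; exact: tameZ.
Qed.

(* The moments of the successive derivatives of a bump form a triangular system. *)
Lemma prescribed_moments e b : 0 < e -> exists h : 'I_b.+1 -> R -> R, forall l,
  [/\ tame (h l), forall x, h l x != 0 -> `|x| <= e &
      forall j : 'I_b.+1, moment j (h l) = (j == l)%:R].
Proof.
move=> e0.
(* Downward induction on [l]: the derivative of order [l] of the bump has the right moments below
   [l] and a nonzero one at [l]; those above are removed with the functions found for larger
   indices. *)
suff H k : forall l : 'I_b.+1, (b - l < k)%N -> exists h : R -> R, [/\ tame h,
    forall x, h x != 0 -> `|x| <= e & forall j : 'I_b.+1, moment j h = (j == l)%:R].
  have [h Hh] := choice (fun l : 'I_b.+1 => H b.+1 l (leq_subr _ _ : (b - l < b.+1)%N)).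
  by exists h.
elim: k => // k IH l lk.
have : forall j : 'I_b.+1, exists h : R -> R, (l < j)%N -> [/\ tame h,
    forall x, h x != 0 -> `|x| <= e & forall i : 'I_b.+1, moment i h = (i == j)%:R].
  move=> j; have [lj|lj] := boolP (l < j)%N; last by exists (fun=> 0).
  have [|h Hh] := IH j; first by have := ltn_ord j; lia.
  by exists h.
move=> /choice[hs Hs].
pose hs' (j : 'I_b.+1) := if (l < j)%N then hs j else fun=> 0.
have ths j : tame (hs' j).
  by rewrite /hs'; case: ifP => [/Hs[]//|_]; exact: tame0.
have mhs (i j : 'I_b.+1) : moment i (hs' j) = ((l < j)%N && (i == j))%:R.
  by rewrite /hs'; case: ifP => [/Hs[_ _ ->]//|_]; exact: moment0.
pose q := moment l (bumpD e l); have q0 : q != 0 by exact: moment_bumpD_eq.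
pose a (j : 'I_b.+1) := - moment j (bumpD e l).
have [ts _] := moment_sum 0 (index_enum 'I_b.+1) a ths.
have tt := tameD (tame_bumpD e l) ts.
exists (fun u => q^-1 * (bumpD e l u + \sum_j a j * hs' j u)); split.
- exact: tameZ.
- move=> x; apply: contraNT => xe.
  have -> : bumpD e l x = 0 by apply/eqP; apply: contraNT xe => /bumpD_neq0.
  rewrite big1 ?addr0 ?mulr0// => j _; rewrite (_ : hs' j x = 0) ?mulr0//.
  rewrite /hs'; case: ifP => // lj; apply/eqP; apply: contraNT xe.
  by have [_ h _] := Hs _ lj; exact: h.
- move=> j; rewrite momentZ// momentD//; last exact: tame_bumpD.
  have [_ ->] := moment_sum j (index_enum 'I_b.+1) a ths.
  rewrite (bigD1 j)//= big1 ?addr0 => [|i ij]; last first.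
    by rewrite mhs eq_sym (negbTE ij) andbF mulr0.
  rewrite mhs eqxx andbT /a.
  have [lj|jl|jl] := ltngtP l j.
  - by rewrite mulr1 subrr mulr0 -val_eqE /= gtn_eqF.
  - by rewrite moment_bumpD_lt// add0r mulr0 mulr0 -val_eqE /= ltn_eqF.
  - have -> : j = l by apply/val_inj.
    by rewrite mulr0 addr0 mulVf// eqxx.
Qed.
End Moments.

Section Clamp.
Context {R : realType}.
Let oT : open [set: R] := @openT _.

(* A function bounded below by [k] that agrees with [t] for [t >= 2 k]: composed
   with [height] it is invertible everywhere, not only near the support. *)
Definition clamp (k t : R) : R := k + sstep ((t - k) / k) * (t - k).

Lemma clamp_id k t : 0 < k -> 2 * k <= t -> clamp k t = t.
Proof.
by move=> k0 kt; rewrite /clamp sstep1 ?mul1r ?subrKC// ler_pdivlMr// mul1r; lra.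
Qed.

Lemma clamp_ge k t : 0 < k -> k <= clamp k t.
Proof.
move=> k0; rewrite /clamp lerDl; have [tk|kt] := leP t k.
  by rewrite sstep0 ?mul0r// pmulr_lle0 ?invr_gt0// subr_le0.
by rewrite mulr_ge0 ?sstep_ge0// subr_ge0 ltW.
Qed.

Lemma smooth_clamp k : smooth (clamp k).
Proof.
apply: smoothD; [exact: oT|exact: smooth_cst|apply: smoothM; first exact: oT].
  apply: (smooth_comp (W := setT) oT _ smooth_sstep) => //.
  by apply: (smooth_ext oT _ (smooth_affine1 k^-1 (- (k / k)))) => x _; rewrite mulrBl [k^-1 * _]mulrC.
by apply: (smooth_ext oT _ (smooth_affine1 1 (- k))) => x _; rewrite mul1r.
Qed.
End Clamp.

Section LineMonomials.
Context {R : realType}.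
Notation mu := (@lebesgue_measure R).

Lemma tame_exprn_plateau b (L : R) : tame (fun v : R => v ^+ b * plateau L v).
Proof.
split; first by apply: smoothM; [exact: openT|exact: smooth_exprn|exact: smooth_plateau].
by apply: csupp_mul; exists (L + 1) => v; exact: plateau_neq0.
Qed.

(* Substitute [u = s - t v] and expand [((s - u) / t) ^+ b]. *)
Lemma Rintegral_line_monomial (h : R -> R) b (s t : R) : tame h -> 0 < t ->
  \int[mu]_v (h (s - t * v) * v ^+ b) =
  t^-1 ^+ b.+1 * \sum_(l < b.+1) ((-1) ^+ l * s ^+ (b - l) *+ 'C(b, l) * moment l h).
Proof.
move=> th t0; have tn0 : - t != 0 by rewrite oppr_eq0 gt_eqF.
pose F (u : R) := h u * ((s - u) / t) ^+ b.
pose G (l : 'I_b.+1) (u : R) := (-1) ^+ l * s ^+ (b - l) *+ 'C(b, l) * (u ^+ l * h u).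
have FE u : F u = t^-1 ^+ b * \sum_l G l u.
  rewrite /F exprMn exprBn mulrA mulrC; congr (_ * _).
  rewrite mulr_sumr; apply: eq_bigr => l _.
  by rewrite /G mulrnAl mulrnAr; congr (_ *+ _); ring.
have iG l : mu.-integrable setT (EFin \o G l).
  have := integrableZl measurableT ((-1) ^+ l * s ^+ (b - l) *+ 'C(b, l)) (moment_integrable l th).
  by apply: eq_integrable => // x _ /=; rewrite EFinM.
have [iS ES] := Rintegral_sum (index_enum 'I_b.+1) iG.
have iF : mu.-integrable setT (EFin \o F).
  have := integrableZl measurableT (t^-1 ^+ b) iS.
  by apply: eq_integrable => // x _ /=; rewrite FE EFinM.
have := Rintegral_affine s tn0 iF; rewrite normrN gtr0_norm// => E.
have -> : \int[mu]_v (h (s - t * v) * v ^+ b) = t^-1 * \int[mu]_x F x.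
  rewrite E mulKf ?gt_eqF//; apply: eq_Rintegral => v _; rewrite /F.
  have -> : - t * v + s = s - t * v by rewrite mulNr addrC.
  by rewrite subKr [t * v]mulrC mulfK// gt_eqF.
under eq_Rintegral do rewrite FE.
rewrite RintegralZl// ES exprS -mulrA; congr (_ * (_ * _)); apply: eq_bigr => l _.
by rewrite RintegralZl//; exact: moment_integrable.
Qed.
End LineMonomials.

Section LineFactorMonomial.
Context {R : realType} {n : nat}.
Notation mu := (@lebesgue_measure R).
Variables (x0 : 'rV[R]_n.+1) (c : R) (m : 'I_n -> R).

(** With slope weight [v ^ (b + l)] and a foot function whose only nonzero moment of order at most
    [b + l] is that of order [l], a single term of the binomial expansion survives. The free
    parameter [l] raises the power of the inverse height without changing that of the side. *)
Lemma linefactor_monomial i (e Z t0 : R) b l : 0 < e -> 0 < t0 -> 0 <= Z ->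
  exists L (h a : R -> R) (q : R), [/\ tame h, tame a,
    forall x, h x != 0 -> `|x| <= e, forall x, a x != 0 -> `|x| <= L &
    q != 0 /\ forall x, `|side x0 i x| <= Z -> t0 <= height x0 c m x ->
      linefactor x0 c m i h a x = q * ((height x0 c m x)^-1 ^+ (b + l).+1 * side x0 i x ^+ b)].
Proof.
move=> e0 t00 Z0; have [h Hh] := prescribed_moments (b + l) e0.
(* Bound for the slope of a line joining a foot of size at most [e] to a point with side at most [Z]
   and height at least [t0]; truncating the monomial beyond it changes nothing. *)
pose L := (e + Z) / t0.
have lb : (l < (b + l).+1)%N by rewrite ltnS leq_addl.
pose l' := Ordinal lb; have [th hs hm] := Hh l'.
exists (L + 1), (h l'), (fun v => v ^+ (b + l) * plateau L v), ((-1) ^+ l *+ 'C(b + l, l)); split=> //.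
- exact: tame_exprn_plateau.
- by move=> x; rewrite mulf_eq0 negb_or => /andP[_ /plateau_neq0].
split; first by rewrite -mulr_natr mulf_neq0 ?signr_eq0// pnatr_eq0 -lt0n bin_gt0 leq_addl.
move=> x xZ xt; have x0' : 0 < height x0 c m x by exact: lt_le_trans xt.
transitivity (\int[mu]_v (h l' (side x0 i x - height x0 c m x * v) * v ^+ (b + l))).
  apply: eq_Rintegral => v _.
  have [->|/hs hv] := eqVneq (h l' (side x0 i x - height x0 c m x * v)) 0; first by rewrite !mul0r.
  rewrite plateau1 ?mulr1// /L ler_pdivlMr//.
  apply: (@le_trans _ _ (`|v| * height x0 c m x)); first by rewrite ler_wpM2l.
  rewrite -(gtr0_norm x0') -normrM mulrC.
  rewrite (_ : height x0 c m x * v = side x0 i x - (side x0 i x - height x0 c m x * v)); last first.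
    by rewrite subKr.
  by rewrite (le_trans (ler_normB _ _))// addrC lerD.
rewrite Rintegral_line_monomial//.
rewrite (bigD1 l')//= big1 ?addr0 => [|j jl]; last by rewrite hm (negbTE jl) mulr0.
have -> : moment l (h l') = 1 by rewrite (hm l') eqxx.
by rewrite mulr1 addnK -mulrnAl mulrCA.
Qed.
End LineFactorMonomial.

(** * Derivatives of high powers *)

Section GeometricBounds.
Context {R : realType} {d : nat}.
Implicit Types (g : 'rV[R]_d -> R) (K : set 'rV[R]_d).

(** A mean value inequality for powers, through which the factor coming from the derivative of a
    high power is absorbed by a larger base. *)
Lemma exprn_succ_bound (a b : R) j : 0 <= a -> a <= b ->
  j.+1%:R * a ^+ j * (b - a) <= b ^+ j.+1 - a ^+ j.+1.
Proof.
move=> a0 ab; elim: j => [|j IH]; first by rewrite !expr1 expr0 mulr1 mul1r.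
have -> : b ^+ j.+2 - a ^+ j.+2 = b * (b ^+ j.+1 - a ^+ j.+1) + a ^+ j.+1 * (b - a).
  by rewrite !exprS; ring.
have H0 : 0 <= j.+1%:R * a ^+ j * (b - a) by rewrite !mulr_ge0 ?exprn_ge0 ?subr_ge0.
apply: (@le_trans _ _ (a * (j.+1%:R * a ^+ j * (b - a)) + a ^+ j.+1 * (b - a))).
  by rewrite -(natr1 j.+1) exprS le_eqVlt; apply/orP; left; apply/eqP; ring.
by rewrite lerD2r; apply: ler_pM.
Qed.

Lemma partialZ s (a : R) g : smooth g ->
  partial s (fun x => a * g x) = (fun x => a * partial s g x).
Proof.
move=> sg; elim: s => //= i s ->; apply/funext=> x.
by have [_ ->] := is_derive_scale a (smooth_is_derive (delta_mx 0 i) (smooth_partial s sg) (I : [set: 'rV[R]_d] x)).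
Qed.

Lemma bounded_partialsZ N K (a : R) g e : smooth g ->
  bounded_partials N K g e -> bounded_partials N K (fun x => a * g x) (`|a| * e).
Proof.
by move=> sg Hg s sN x Kx; rewrite partialZ// normrM ler_wpM2l//; exact: Hg.
Qed.

Lemma derive_exprn g v j : smooth g ->
  'D_v (fun x => g x ^+ j.+1) = (fun x => j.+1%:R * (g x ^+ j * 'D_v g x)).
Proof.
move=> sg; apply/funext=> x.
have [_ E] := is_deriveX j.+1 (smooth_is_derive v sg (I : [set: 'rV[R]_d] x)).
have -> : (fun x => g x ^+ j.+1) = g ^+ j.+1 by apply/funext=> y; rewrite fctE.
by rewrite E mulrA.
Qed.

(** Each derivative of [g ^+ j] brings a factor of order [j], absorbed by enlarging the base from
    [e] to [b]. Up to [N] of them occur, so the induction lets the base [b > a] vary. *)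
Lemma bounded_partials_exprn N K g (a b : R) : compact K -> smooth g -> 0 <= a -> a < b ->
  (forall x, K x -> `|g x| <= a) ->
  exists2 A, 0 <= A & forall j, bounded_partials N K (fun x => g x ^+ j) (A * b ^+ j).
Proof.
move=> cK sg a0; elim: N b => [|N IH] b ab ga.
  exists 1 => // j s; rewrite leqn0 size_eq0 => /eqP -> x Kx /=.
  by rewrite mul1r normrX lerXn2r ?nnegrE// ?(le_trans (ga _ Kx) (ltW ab))// ltW// (le_lt_trans a0).
have b0 : 0 < b by exact: le_lt_trans ab.
pose e := (a + b) / 2.
have ae : a < e by rewrite /e; lra.
have eb : e < b by rewrite /e; lra.
have e0 : 0 < e by exact: le_lt_trans ae.
have [A A0 HA] := IH e ae ga.
have [M M0 HM] := smooth_bounded_partials N.+1 cK sg.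
pose B := 2 ^+ N * (A * M) / (b - e).
have ba0 : 0 < b - e by rewrite subr_gt0.
have B0 : 0 <= B by rewrite /B divr_ge0 ?(ltW ba0)// mulr_ge0 ?exprn_ge0// mulr_ge0.
exists (1 + B) => [|j s]; first by rewrite addr_ge0.
case/lastP: s => [_ x Kx /=|s i].
  rewrite normrX mulrDl mul1r; apply: (@le_trans _ _ (b ^+ j)).
    by rewrite lerXn2r ?nnegrE// ?(le_trans (ga _ Kx) (ltW ab))// ltW.
  by rewrite lerDl mulr_ge0// exprn_ge0// ltW.
rewrite size_rcons ltnS partial_rcons => sN x Kx.
case: j => [|j].
  have -> : partial s ('D_('e_i) (fun x => g x ^+ 0)) x = 0; last first.
    by rewrite normr0 mulr_ge0 ?exprn_ge0 ?(ltW b0)// addr_ge0.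
  by apply: (@partial_on_eq0 _ _ s _ setT openT) => // y _; exact: derive_cst.
rewrite derive_exprn//.
have sD := smooth_derive (delta_mx 0 i) sg.
have sX : smooth (fun x => g x ^+ j) by apply: smoothX => //; exact: openT.
have H := bounded_partialsM sX sD (mulr_ge0 A0 (exprn_ge0 j (ltW e0))) (HA j) (bounded_partials_derive i HM).
have {H} := bounded_partialsZ j.+1%:R (smoothM openT sX sD) H => /(_ s sN x Kx) H.
apply: (le_trans H); rewrite ger0_norm//.
have := exprn_succ_bound j (ltW e0) (ltW eb) => H1.
have H2 : j.+1%:R * e ^+ j <= b ^+ j.+1 / (b - e).
  by rewrite ler_pdivlMr// (le_trans H1)// gerBl exprn_ge0// ltW.
have Q0 : 0 <= 2 ^+ N * (A * M) by rewrite mulr_ge0 ?exprn_ge0// mulr_ge0.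
have Q1 : 0 <= b ^+ j.+1 by rewrite exprn_ge0// ltW.
apply: (@le_trans _ _ (B * b ^+ j.+1)); last by rewrite ler_wpM2r// lerDr.
have -> : B * b ^+ j.+1 = 2 ^+ N * (A * M) * (b ^+ j.+1 / (b - e)) by rewrite /B mulrAC -!mulrA.
have -> : j.+1%:R * (2 ^+ N * (A * e ^+ j * M)) = 2 ^+ N * (A * M) * (j.+1%:R * e ^+ j).
  by move: (2 ^+ N) (e ^+ j) j.+1%:R => u v w; ring.
by rewrite ler_wpM2l.
Qed.
End GeometricBounds.

(** * From inverse powers of the height to polynomials *)

Section Annihilation.
Context {R : realType} {n : nat}.
Notation V := 'rV[R]_n.+2.
Variables (f : @cdistribution R n.+2) (x0 : V) (c : R) (m : 'I_n.+1 -> R).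
Variables (k Z e : R) (C O : set V).
Hypothesis c0 : c != 0.
Hypothesis k0 : 0 < k.
Hypothesis Z0 : 0 <= Z.
Hypothesis e0 : 0 < e.
Hypothesis fC : dsupport f `<=` C.
Hypothesis oO : open O.
Hypothesis CO : C `<=` O.
Hypothesis Ok : forall x, O x -> 2 * k <= height x0 c m x.
Hypothesis OZ : forall x, O x -> forall i, `|side x0 i x| <= Z.
Hypothesis fvanish : forall L hh aa, (forall i, tame (hh i)) -> (forall i, tame (aa i)) ->
  (forall i x, hh i x != 0 -> `|x| <= e) -> (forall i x, aa i x != 0 -> `|x| <= L) ->
  rpairing f (lineprod x0 c m hh aa) = 0.
Let oT : open [set: V] := @openT _.
Notation rp := (rpairing f).

Lemma rpairing_ext g h : smooth g -> smooth h -> (forall x, O x -> g x = h x) -> rp g = rp h.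
Proof.
move=> sg sh gh.
have -> : g = (fun x => (g x - h x) + h x) by apply/funext=> x; rewrite subrK.
rewrite rpairingD//; last exact: smoothB.
rewrite (rpairing_support fC oO CO) ?add0r//; last exact: smoothB.
by move=> x /gh ->; rewrite subrr.
Qed.

Let S (x : V) : R := clamp k (height x0 c m x).
Let sides (b : 'I_n.+1 -> nat) (x : V) : R := \prod_i side x0 i x ^+ b i.

Let sS : smooth S.
Proof.
apply: (smooth_comp (W := setT) oT _ (smooth_clamp k)) => //.
exact: smooth_height.
Qed.

Let S_ge x : k <= S x. Proof. exact: clamp_ge. Qed.

Let S_neq0 x : S x != 0. Proof. by rewrite gt_eqF// (lt_le_trans k0). Qed.

Let SE x : O x -> S x = height x0 c m x.
Proof. by move=> Ox; rewrite /S clamp_id//; exact: Ok. Qed.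

Let sSV j : smooth (fun x => (S x)^-1 ^+ j).
Proof. by apply: smoothX => //; apply: smoothV. Qed.

Let ssides b : smooth (sides b).
Proof. by apply: smooth_prod => // i; apply: smoothX => //; exact: smooth_side. Qed.

(** Each side coordinate brings at least the power [(b i).+1] of the inverse height, whence the
    threshold on [j]. *)
Lemma rpairing_height_inv b j : (\sum_i (b i).+1 <= j)%N ->
  rp (fun x => (S x)^-1 ^+ j * sides b x) = 0.
Proof.
move=> bj; pose s := (j - \sum_i (b i).+1)%N.
(* The whole excess [s] is put on index 0; such an index exists since the dimension [n.+2] is at
   least 2. *)
pose l (i : 'I_n.+1) := if i == ord0 then s else 0%N.
have k20 : 0 < 2 * k by rewrite mulr_gt0.
have H i := linefactor_monomial x0 c m i (b i) (l i) e0 k20 Z0.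
have [Lf /choice[hh /choice[aa /choice[q Hq]]]] := choice H.
pose L := \sum_i `|Lf i|.
have LL i : Lf i <= L.
  by rewrite /L (bigD1 i)//= (le_trans (ler_norm _))// lerDl sumr_ge0.
have th i : tame (hh i) by have [] := Hq i.
have ta i : tame (aa i) by have [] := Hq i.
have := @fvanish L hh aa th ta.
have -> : rp (lineprod x0 c m hh aa) = rp (fun x => (\prod_i q i) * ((S x)^-1 ^+ j * sides b x)).
  apply: rpairing_ext.
  - exact: smooth_lineprod.
  - by apply: smoothZ => //; exact: smoothM.
  move=> x Ox; rewrite SE// /lineprod /sides.
  have -> : j = (\sum_i (b i + l i).+1)%N.
    rewrite (eq_bigr (fun i => (b i).+1 + l i)%N) => [|i _]; last by rewrite -addSn.
    rewrite big_split /= [X in (_ + X)%N](_ : _ = s) ?subnKC//.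
    by rewrite (bigD1 ord0)//= /l eqxx big1 ?addn0// => i /negbTE ->.
  rewrite -prodrXr -!big_split /=; apply: eq_bigr => i _.
  by have [_ _ _ _ [_ ->]] := Hq i; [|exact: OZ|exact: Ok].
move=> E; have {E} : rp (fun x => (\prod_i q i) * ((S x)^-1 ^+ j * sides b x)) = 0.
  by apply: E => [i x|i x]; have [_ _ hs as' _] := Hq i; [exact: hs|move/as' => /le_trans; exact].
rewrite rpairingZ; last exact: smoothM.
move/eqP; rewrite mulf_eq0 => /orP[|/eqP//].
rewrite eq_complex /= => /andP[/eqP q0 _]; exfalso; move/eqP: q0; apply/negP.
by apply/prodf_neq0 => i _; have [_ _ _ _ []] := Hq i.
Qed.

(* On a compact set that controls [f], [r] stays below some [a < 1], so that
   [r ^+ j] tends to 0 with all its derivatives. *)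
Lemma rpairing_height b l : rp (fun x => S x ^+ l * sides b x) = 0.
Proof.
(* Multiplying [S ^+ l] by [S ^- K] leaves the inverse power [\sum_i (b i).+1], the first one
   covered by [rpairing_height_inv]. *)
pose K := (\sum_i (b i).+1 + l)%N.
pose r x := 1 - k ^+ K * (S x)^-1 ^+ K.
have sr : smooth r by apply: smoothB => //; [exact: smooth_cst|exact: smoothZ].
have srX i : smooth (fun x => r x ^+ i) by exact: smoothX.
have Hr i j : (\sum_i (b i).+1 <= j)%N -> rp (fun x => (S x)^-1 ^+ j * sides b x * r x ^+ i) = 0.
  elim: i j => [|i IH] j bj.
    by under eq_fun do rewrite expr0 mulr1; exact: rpairing_height_inv.
  have E : (fun x => (S x)^-1 ^+ j * sides b x * r x ^+ i.+1) =
      (fun x => - k ^+ K * ((S x)^-1 ^+ (j + K) * sides b x * r x ^+ i) + (S x)^-1 ^+ j * sides b x * r x ^+ i).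
    apply/funext=> x; rewrite exprS {1}/r exprD.
    by move: (k ^+ K) (_ ^+ K) (_ ^+ j) (sides b x) (r x ^+ i) => u v w y z; ring.
  rewrite E rpairing_lin; [|by do !apply: smoothM..].
  by rewrite IH ?(leq_trans bj (leq_addr _ _))// mulr0 IH// add0r.
have E j : rp (fun x => S x ^+ l * sides b x) = rp (fun x => S x ^+ l * sides b x * r x ^+ j).
  elim: j => [|j IH]; first by congr rp; apply/funext=> x; rewrite expr0 mulr1.
  rewrite IH.
  have -> : (fun x => S x ^+ l * sides b x * r x ^+ j) = (fun x =>
      k ^+ K * ((S x)^-1 ^+ (\sum_i (b i).+1) * sides b x * r x ^+ j) + S x ^+ l * sides b x * r x ^+ j.+1).
    apply/funext=> x; rewrite exprS {3}/r /K !exprD.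
    have : (S x)^-1 ^+ l * S x ^+ l = 1 by rewrite -exprMn mulVf// expr1n.
    move: (S x ^+ l) ((S x)^-1 ^+ l) ((S x)^-1 ^+ (\sum_i (b i).+1)) (k ^+ (\sum_i (b i).+1)) (k ^+ l) (sides b x) (r x ^+ j).
    move=> p q w u v y z qp.
    have -> : p * y * ((1 - u * v * (w * q)) * z) = p * y * z - u * v * w * (q * p) * y * z by ring.
    by rewrite qp mulr1 -!mulrA addrC subrK.
  rewrite rpairing_lin; [|by do !apply: smoothM => //; exact: smoothX..].
  by rewrite Hr// mulr0 add0r.
have [Kc [N [M [cptK M0 HM]]]] := rpairing_continuous f.
have [B B0 HB] := smooth_bounded_partials 0 cptK sS.
have SB x : Kc x -> S x <= B.
  by move=> Kx; apply: le_trans (ler_norm _) _; exact: (HB [::] _ x Kx).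
(* [S] lies between [k] and [B'] on the compact set, so [0 <= r <= 1 - (k / B') ^+ K < 1] there;
   adding [k] ensures [k / B' <= 1]. *)
pose B' := B + k; have B'0 : 0 < B' by rewrite ltr_wpDl.
pose a := 1 - k ^+ K * B'^-1 ^+ K.
have kB : 0 <= k / B' <= 1.
  by rewrite divr_ge0 ?(ltW k0) ?(ltW B'0)//= ler_pdivrMr// mul1r lerDr.
have kS x : 0 <= k / S x <= 1.
  have S0 : 0 < S x by exact: lt_le_trans (S_ge x).
  by rewrite divr_ge0 ?(ltW k0) ?(ltW S0)//= ler_pdivrMr// mul1r.
have ra x : Kc x -> `|r x| <= a.
  move=> Kx; have S0 : 0 < S x by exact: lt_le_trans (S_ge x).
  rewrite /r /a -!exprMn ger0_norm; last by rewrite subr_ge0; apply: exprn_ile1; case/andP: (kS x).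
  rewrite lerB// lerXn2r// ?nnegrE; [by case/andP: kB|by case/andP: (kS x)|].
  by rewrite ler_wpM2l ?(ltW k0)// lef_pV2 ?posrE// (le_trans (SB _ Kx))// lerDl ltW.
have a1 : a < 1 by rewrite /a gtrBl mulr_gt0 ?exprn_gt0 ?invr_gt0.
have a0 : 0 <= a.
  by rewrite /a -exprMn subr_ge0; apply: exprn_ile1; case/andP: kB.
pose a' := (a + 1) / 2.
have aa' : a < a' by rewrite /a'; lra.
have a'1 : a' < 1 by rewrite /a'; lra.
have [A A0 HA] := bounded_partials_exprn N cptK sr a0 aa' ra.
have sP : smooth (fun x => S x ^+ l * sides b x) by apply: smoothM => //; exact: smoothX.
have [D D0 HD] := smooth_bounded_partials N cptK sP.
pose q := M * (2 ^+ N * (D * A)).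
have q0 : 0 <= q by rewrite mulr_ge0// mulr_ge0 ?exprn_ge0// mulr_ge0.
apply: Normc.eq0_normc; apply/le_anti/andP; split; last first.
  by case: (rp _) => u v; exact: sqrtr_ge0.
have Hj j : Normc.normc (rp (fun x => S x ^+ l * sides b x)) <= q * a' ^+ j.
  rewrite (E j) /q -mulrA.
  have -> : 2 ^+ N * (D * A) * a' ^+ j = 2 ^+ N * (D * (A * a' ^+ j)) by rewrite !mulrA.
  apply: HM; first exact: smoothM.
    by rewrite mulr_ge0 ?exprn_ge0// mulr_ge0// mulr_ge0// exprn_ge0// (le_trans a0)// ltW.
  exact: bounded_partialsM.
have cv : (fun j => q * a' ^+ j) @ \oo --> (0 : R).
  by apply: cvg_geometric; rewrite ger0_norm// (le_trans a0)// ltW.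
rewrite -(cvg_lim (@norm_hausdorff _ _) cv); apply: limr_ge; first by apply/cvg_ex; exists 0.
by apply: nearW.
Qed.

(** The property that passes through multiplication by coordinates: with arbitrary powers of [S] and
    of the sides carried along, each coordinate can be absorbed into them. *)
Let good g := smooth g /\ forall b l, rp (fun x => g x * (S x ^+ l * sides b x)) = 0.

Let sSs l b : smooth (fun x => S x ^+ l * sides b x).
Proof. by apply: smoothM => //; exact: smoothX. Qed.

Let goodM_lift g (i : 'I_n.+1) : good g -> good (fun x : V => x 0 (lift ord0 i) * g x).
Proof.
move=> [sg Hg]; split=> [|b l]; first by apply: smoothM => //; exact: smooth_coord.
pose b' j := (b j + (j == i))%N.
have -> : (fun x : V => x 0 (lift ord0 i) * g x * (S x ^+ l * sides b x)) =
    (fun x => x0 0 (lift ord0 i) * (g x * (S x ^+ l * sides b x)) + g x * (S x ^+ l * sides b' x)).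
  apply/funext=> x; have -> : sides b' x = side x0 i x * sides b x.
    rewrite /sides (bigD1 i)//= [in RHS](bigD1 i)//= /b' eqxx addn1 exprS -mulrA.
    congr (_ * (_ * _)); apply: eq_bigr => j ji.
    by rewrite (negbTE ji) addn0.
  rewrite /side; move: (S x ^+ l) (sides b x) (g x) => p q u; ring.
by rewrite rpairing_lin; [rewrite !Hg mulr0 addr0|exact: smoothM..].
Qed.

(** The first coordinate is recovered from the height: [c * x 0 ord0] is the height plus a constant
    minus a combination of the other coordinates. As [S] is known to be the height on [O] only, the
    identity is used through [rpairing_ext]. *)
Let goodM_ord0 g : good g -> good (fun x : V => x 0 ord0 * g x).
Proof.
move=> gg; have [sg Hg] := gg; split=> [|b l]; first by apply: smoothM => //; exact: smooth_coord.
have gl (i : 'I_n.+1) := goodM_lift i gg.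
have sm i : smooth (fun x : V => - m i * (x 0 (lift ord0 i) * g x * (S x ^+ l * sides b x))).
  by apply: smoothZ => //; apply: smoothM => //; have [] := gl i.
have sS' := smooth_sum (index_enum 'I_n.+1) oT sm.
have sL := smoothM oT sg (sSs l b).
have sL' := smoothD oT (smoothZ (nform c m x0) oT sL) sS'.
have sG := smoothD oT (smoothM oT sg (sSs l.+1 b)) sL'.
have G0 := rpairingD f (smoothM oT sg (sSs l.+1 b)) sL'.
rewrite Hg add0r (rpairing_lin f _ sL sS') Hg mulr0 add0r (rpairing_sum f _ sm) big1 in G0; last first.
  move=> i _; have := rpairingZ f (- m i) (smoothM oT (gl i).1 (sSs l b)).
  by rewrite (gl i).2 mulr0.
have := rpairingZ f c^-1 sG; rewrite {}G0 mulr0 => <-; apply: rpairing_ext.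
- by do !apply: smoothM => //; exact: smooth_coord.
- exact: smoothZ.
move=> x Ox; rewrite exprS [X in X * S x ^+ l]SE//.
rewrite (_ : \sum_i _ = - (\sum_i m i * x 0 (lift ord0 i)) * (g x * (S x ^+ l * sides b x))); last first.
  rewrite -sumrN mulr_suml; apply: eq_bigr => i _.
  by rewrite mulNr mulNr !mulrA.
rewrite /height [X in X - nform c m x0]/nform; move: (nform _ _ _) (\sum_i _) => p q.
by move: (S x ^+ l) (sides b x) (g x) (x 0 ord0) => u v w y; field.
Qed.

Lemma rpairing_monomial (b : 'I_n.+2 -> nat) : rp (fun x : V => \prod_j x 0 j ^+ b j) = 0.
Proof.
have gM j g : good g -> good (fun x : V => x 0 j * g x).
  by move=> gg; case: (unliftP ord0 j) => [i|] ->; [exact: goodM_lift|exact: goodM_ord0].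
have gX j a g : good g -> good (fun x : V => x 0 j ^+ a * g x).
  move=> gg; elim: a => [|a IH].
    by rewrite (_ : (fun x => _) = g)//; apply/funext=> x; rewrite expr0 mul1r.
  rewrite (_ : (fun x => _) = (fun x : V => x 0 j * (x 0 j ^+ a * g x))); first exact: gM.
  by apply/funext=> x; rewrite exprS mulrA.
have gP (s : seq 'I_n.+2) : good (fun x : V => \prod_(j <- s) x 0 j ^+ b j).
  elim: s => [|j s IH].
    split=> [|b' l].
      by apply: (smooth_ext oT _ (smooth_cst 1 oT)) => x _; rewrite big_nil.
    rewrite (_ : (fun x => _) = (fun x => S x ^+ l * sides b' x)); first exact: rpairing_height.
    by apply/funext=> x; rewrite big_nil mul1r.
  rewrite (_ : (fun x => _) = (fun x : V => x 0 j ^+ b j * \prod_(j <- s) x 0 j ^+ b j)); first exact: gX.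
  by apply/funext=> x; rewrite big_cons.
have [_ /(_ (fun=> 0%N) 0%N)] := gP (index_enum 'I_n.+2).
move=> <-; congr rp; apply/funext=> x.
by rewrite expr0 mul1r [sides _ _]big1 ?mulr1.
Qed.
End Annihilation.

(** * Density of polynomials *)

Section BernsteinMean.
Context {R : realType}.
Implicit Types (p : R) (F G : nat -> R).

(* The mean of [F] under the binomial distribution of parameters [M] and [p]. *)
Fixpoint bernstein_mean p (M : nat) F : R :=
  if M is M'.+1 then (1 - p) * bernstein_mean p M' F + p * bernstein_mean p M' (F \o succn)
  else F 0%N.

Lemma bernstein_mean_lin p M (a : R) F G :
  bernstein_mean p M (fun i => a * F i + G i) = a * bernstein_mean p M F + bernstein_mean p M G.
Proof.
elim: M F G => //= M IH F G.
by rewrite IH (IH (F \o succn) (G \o succn)); ring.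
Qed.

Lemma bernstein_mean_le p M F G : 0 <= p <= 1 -> (forall i, (i <= M)%N -> F i <= G i) ->
  bernstein_mean p M F <= bernstein_mean p M G.
Proof.
move=> /andP[p0 p1]; elim: M F G => [|M IH] F G FG /=; first exact: FG.
apply: lerD; apply: ler_wpM2l; rewrite ?subr_ge0//; apply: IH => i iM; apply: FG => //.
exact: leq_trans iM _.
Qed.

Lemma bernstein_mean_eq p M F G : (forall i, (i <= M)%N -> F i = G i) ->
  bernstein_mean p M F = bernstein_mean p M G.
Proof.
elim: M F G => [|M IH] F G FG /=; first exact: FG.
congr (_ * _ + _ * _); apply: IH => i iM; apply: FG => //.
exact: leq_trans iM _.
Qed.

Lemma bernstein_mean_cst p M (a : R) : bernstein_mean p M (fun=> a) = a.
Proof.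
elim: M => //= M IH; rewrite (_ : (fun=> a) \o succn = fun=> a)// IH; ring.
Qed.

Lemma bernstein_mean0 p M : bernstein_mean p M (fun=> 0) = 0.
Proof. exact: bernstein_mean_cst. Qed.

Lemma bernstein_mean_sum p M J (r : seq J) (a : J -> R) (F : J -> nat -> R) :
  bernstein_mean p M (fun i => \sum_(j <- r) a j * F j i) = \sum_(j <- r) a j * bernstein_mean p M (F j).
Proof.
elim: r => [|j r IH].
  rewrite big_nil -[RHS](bernstein_mean0 p M); congr bernstein_mean; apply/funext=> i.
  by rewrite big_nil.
rewrite big_cons -IH -bernstein_mean_lin; congr bernstein_mean; apply/funext=> i.
by rewrite big_cons.
Qed.

(** The shift [a] makes the induction work: conditioning on one trial changes it by [- p] or
    [1 - p]. *)
Lemma bernstein_variance p M (a : R) :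
  bernstein_mean p M (fun j => (j%:R - M%:R * p + a) ^+ 2) = M%:R * p * (1 - p) + a ^+ 2.
Proof.
elim: M a => [|M IH] a /=; first by rewrite !mul0r subrr !add0r.
have E1 : (fun j : nat => (j%:R - M.+1%:R * p + a) ^+ 2) = (fun j : nat => (j%:R - M%:R * p + (a - p)) ^+ 2).
  by apply/funext=> j; rewrite -natr1; congr (_ ^+ 2); ring.
have E2 : (fun j : nat => (j%:R - M.+1%:R * p + a) ^+ 2) \o succn =
    (fun j : nat => (j%:R - M%:R * p + (a + (1 - p))) ^+ 2).
  by apply/funext=> j /=; rewrite -!natr1; congr (_ ^+ 2); ring.
by rewrite E2 E1 !IH -natr1; ring.
Qed.

(** Since [|u| <= K + u ^ 2 / K], the mean distance is bounded by [K] plus the variance divided by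
    [K]. With [K ^ 2] trials the standard deviation is at most [K], and no square root appears. *)
Lemma bernstein_mean_dist p K F b (L : R) : 0 <= p <= 1 -> (0 < K)%N -> 0 <= L ->
  (forall j, (j <= K ^ 2)%N -> `|b - F j| <= L * `|j%:R - (K ^ 2)%:R * p|) ->
  `|b - bernstein_mean p (K ^ 2) F| <= 2 * L * K%:R.
Proof.
move=> p01 K0 L0 HF; set M := (K ^ 2)%N.
have KR : 0 < K%:R :> R by rewrite ltr0n.
pose G (j : nat) := L * (K%:R + (j%:R - M%:R * p) ^+ 2 / K%:R).
have FG j : (j <= M)%N -> `|b - F j| <= G j.
  move=> /HF /le_trans; apply; rewrite ler_wpM2l//.
  set u := j%:R - _; have [uK|Ku] := leP `|u| K%:R.
    by rewrite (le_trans uK)// lerDl divr_ge0 ?sqr_ge0// ltW.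
  rewrite -real_normK ?num_real//.
  have : `|u| <= `|u| ^+ 2 / K%:R by rewrite ler_pdivlMr// expr2 ler_wpM2l// ltW.
  by move/le_trans; apply; rewrite lerDr ltW.
have GE : bernstein_mean p M G <= 2 * L * K%:R.
  have -> : G = (fun j : nat => L / K%:R * (j%:R - M%:R * p + 0) ^+ 2 + L * K%:R).
    by apply/funext=> j; rewrite /G addr0 mulrDr addrC; congr (_ + _); rewrite [RHS]mulrAC -mulrA.
  rewrite bernstein_mean_lin bernstein_variance bernstein_mean_cst expr0n addr0.
  rewrite (_ : 2 * L * K%:R = L / K%:R * M%:R + L * K%:R); last first.
    by rewrite /M natrX; field; rewrite gt_eqF.
  rewrite lerD2r ler_wpM2l ?divr_ge0 ?(ltW KR)// -mulrA ler_piMr// ?ler0n//.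
  by case/andP: p01 => p0 p1; rewrite mulr_ile1// ?subr_ge0// lerBlDr lerDl.
have E : b - bernstein_mean p M F = bernstein_mean p M (fun j => b - F j).
  have := bernstein_mean_lin p M (-1) F (fun=> b); rewrite bernstein_mean_cst mulN1r addrC => <-.
  by apply: bernstein_mean_eq => i _; rewrite mulN1r addrC.
rewrite E ler_norml -lerNl; apply/andP; split; last first.
  apply: le_trans GE; apply: bernstein_mean_le => // j /FG; apply: le_trans.
  exact: ler_norm.
apply: le_trans GE; have := bernstein_mean_lin p M (-1) (fun j => b - F j) (fun=> 0).
rewrite bernstein_mean0 addr0 mulN1r => <-; apply: bernstein_mean_le => // j /FG; apply: le_trans.
by rewrite addr0 mulN1r -normrN ler_norm.
Qed.
End BernsteinMean.

Section BernsteinPolynomials.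
Context {R : realType}.

(** The probability of [j] successes in [M] independent trials, where the success probability [P] is
    itself a polynomial. *)
Fixpoint bernstein_poly (P : {poly R}) (M j : nat) : {poly R} :=
  if M is M'.+1 then (1 - P) * bernstein_poly P M' j +
    P * (if j is j'.+1 then bernstein_poly P M' j' else 0)
  else (j == 0%N)%:R.

Lemma horner_bernstein_poly P M j t :
  (bernstein_poly P M j).[t] = bernstein_mean P.[t] M (fun i => (i == j)%:R).
Proof.
elim: M j => [|M IH] j /=.
  by rewrite eq_sym; case: eqP => _; rewrite hornerE.
rewrite !hornerE IH; case: j => [|j].
  by rewrite (_ : _ \o succn = fun=> 0)// bernstein_mean0 horner0.
by rewrite IH.
Qed.

Lemma bernstein_mean_poly P M F t :
  bernstein_mean P.[t] M F = \sum_(j < M.+1) F j * (bernstein_poly P M j).[t].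
Proof.
under eq_bigr do rewrite horner_bernstein_poly.
rewrite -(bernstein_mean_sum _ _ _ (fun j : 'I_M.+1 => F j)); apply: bernstein_mean_eq => i iM.
have iM' : (i < M.+1)%N by rewrite ltnS.
rewrite (bigD1 (Ordinal iM'))//= eqxx mulr1 big1 ?addr0// => j.
by rewrite -val_eqE /= eq_sym => /negbTE ->; rewrite mulr0.
Qed.

Lemma poly_primitive (q : {poly R}) (a : R) : exists Q : {poly R}, Q^`() = q /\ Q.[a] = 0.
Proof.
pose Q := \poly_(i < (size q).+1) (q`_i.-1 / i%:R).
have QE : Q^`() = q.
  apply/polyP => i; rewrite coef_deriv coef_poly ltnS /=.
  have [iq|qi] := ltnP i (size q).
    by rewrite -[LHS]mulr_natr mulfVK// pnatr_eq0.
  by rewrite mul0rn nth_default.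
exists (Q - (Q.[a])%:P); rewrite derivB derivC subr0 QE; split=> //.
by rewrite hornerD hornerN hornerC subrr.
Qed.

Definition iter_derive k (h : R -> R) : R -> R := iter k (fun h => 'D_(1 : R) h) h.

Lemma smooth_iter_derive k h : smooth h -> smooth (iter_derive k h).
Proof. by move=> sh; elim: k => //= k IH; exact: smooth_derive. Qed.

Lemma poly_iter_primitive N (q : {poly R}) (a : R) : exists Q : {poly R},
  iter_derive N (horner Q) = horner q /\ forall k, (k < N)%N -> iter_derive k (horner Q) a = 0.
Proof.
elim: N q => [|N IH] q; first by exists q.
have [Q0 [Q0q Q0a]] := poly_primitive q a; have [Q [QQ Qa]] := IH Q0.
exists Q; rewrite /iter_derive iterS -/(iter_derive _ _) QQ; split.
  apply/funext=> x; have [_ ->] := is_derive_poly Q0 x; by rewrite Q0q.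
move=> k; rewrite ltnS leq_eqVlt => /orP[/eqP ->|/Qa//].
by rewrite -/(iter_derive _ _) QQ.
Qed.

Lemma smooth_horner (Q : {poly R}) : smooth (horner Q).
Proof.
pose P (h : R -> R) := exists q : {poly R}, h = horner q.
apply: (@smooth_coind _ _ P); [exact: openT| |by exists Q].
move=> _ [q ->]; split=> [x _|v]; first exact: continuous_horner.
exists (fun x => v * q^`().[x]) => [|x _].
  by exists (v *: q^`()); apply/funext=> x; rewrite hornerZ.
by rewrite mulrC; exact: (is_derive_dir v (is_derive_poly q x)).
Qed.
End BernsteinPolynomials.

(** * Approximation in one variable with all derivatives up to order [N] *)

Section OneVariableApproximation.
Context {R : realType}.
Variables (Y : R) (N K : nat) (Q : nat -> {poly R}).
Hypothesis Y1 : 1 <= Y.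
Hypothesis K0 : (0 < K)%N.

Definition node j : R := - Y + 2 * Y / (K ^ 2)%:R * j%:R.

(** Affine map of [[- Y, Y]] onto [[0, 1]]: the success probability at [t]. *)
Definition node_poly : {poly R} := (2 * Y)^-1 *: ('X + Y%:P).

Hypothesis QN : forall j, iter_derive N (horner (Q j)) = horner (bernstein_poly node_poly (K ^ 2) j).
Hypothesis Q0 : forall j k, (k < N)%N -> iter_derive k (horner (Q j)) (- Y) = 0.

(** The [N]-th derivative is what is sampled, and [Q j] is an [N]-th primitive of a Bernstein
    polynomial, vanishing to order [N] at [- Y]: lower derivatives of the error are then controlled
    by integration. *)
Definition bernstein_lift (h : R -> R) t : R :=
  \sum_(j < (K ^ 2).+1) iter_derive N h (node j) * (Q j).[t].

Lemma node_bound j : (j <= K ^ 2)%N -> `|node j| <= Y.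
Proof.
have Y0 : 0 < Y := lt_le_trans ltr01 Y1.
have M0 : 0 < (K ^ 2)%:R :> R by rewrite ltr0n expn_gt0 K0.
move=> jM; have Y20 : 0 <= 2 * Y by rewrite mulr_ge0// ltW.
rewrite /node; set q := _ / _ * _.
have q0 : 0 <= q by rewrite /q mulr_ge0// divr_ge0// ltW.
have q1 : q <= 2 * Y by rewrite /q mulrAC ler_pdivrMr// ler_wpM2l// ler_nat.
by rewrite ler_norml; apply/andP; split; move: q q0 q1 => q q0 q1; lra.
Qed.

Lemma iter_derive_sum k J (r : seq J) (a : J -> R) (F : J -> R -> R) : (forall j, smooth (F j)) ->
  iter_derive k (fun t => \sum_(j <- r) a j * F j t) = (fun t => \sum_(j <- r) a j * iter_derive k (F j) t).
Proof.
move=> sF; have oT : open [set: R] by exact: openT.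
elim: k => //= k ->; apply/funext=> t.
have : is_derive t (1 : R) (fun t => \sum_(j <- r) a j * iter_derive k (F j) t)
    (\sum_(j <- r) a j * 'D_1 (iter_derive k (F j)) t); last by case.
elim: r => [|j r IH].
  rewrite big_nil (_ : (fun t => _) = fun=> 0); first exact: is_derive_cst.
  by apply/funext=> x; rewrite big_nil.
rewrite big_cons (_ : (fun t => _) = (fun t => a j * iter_derive k (F j) t + \sum_(j <- r) a j * iter_derive k (F j) t)).
  apply: is_derive_add => //; apply: is_derive_scale; apply: (smooth_is_derive (U := setT)) => //.
  exact: smooth_iter_derive.
by apply/funext=> x; rewrite big_cons.
Qed.

Lemma iter_derive_sub k (g h : R -> R) : smooth g -> smooth h ->
  iter_derive k (fun t => g t - h t) = (fun t => iter_derive k g t - iter_derive k h t).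
Proof.
move=> sg sh; elim: k => //= k ->; apply/funext=> t.
have [_ ->] // := is_deriveB (smooth_is_derive (1 : R) (smooth_iter_derive k sg) (I : [set: R] t))
  (smooth_is_derive (1 : R) (smooth_iter_derive k sh) (I : [set: R] t)).
Qed.

(** At order [N] the Bernstein estimate with spacing [2 * Y / K ^ 2] and Lipschitz constant [L]
    gives [4 * Y * L / K]. Each step down in order starts from the value 0 at [- Y] and costs a
    factor of at most [2 * Y]; as [2 * Y >= 1], one power serves all orders. *)
Lemma bernstein_lift_error (h : R -> R) (L : R) : smooth h -> 0 <= L ->
  (forall k, (k < N)%N -> iter_derive k h (- Y) = 0) ->
  (forall t, `|t| <= Y -> `|iter_derive N.+1 h t| <= L) ->
  forall k t, (k <= N)%N -> `|t| <= Y ->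
  `|iter_derive k (fun t => h t - bernstein_lift h t) t| <= (2 * Y) ^+ N * (4 * Y * L / K%:R).
Proof.
move=> sh L0 h0 hL.
have Y0 : 0 < Y := lt_le_trans ltr01 Y1.
have KR : 0 < K%:R :> R by rewrite ltr0n.
have sE : smooth (fun t => h t - bernstein_lift h t).
  apply: smoothB; [exact: openT|by []|apply: smooth_sum => [|j]; first exact: openT].
  by apply: smoothZ; [exact: openT|exact: smooth_horner].
have EE k : iter_derive k (fun t => h t - bernstein_lift h t) = (fun t => iter_derive k h t -
    \sum_(j < (K ^ 2).+1) iter_derive N h (node j) * iter_derive k (horner (Q j)) t).
  rewrite iter_derive_sub//; last first.
    by apply: smooth_sum => [|j]; [exact: openT|apply: smoothZ; [exact: openT|exact: smooth_horner]].
  by rewrite (iter_derive_sum k (index_enum 'I_(K ^ 2).+1) (fun j : 'I__ => iter_derive N h (node j))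
    (F := fun j : 'I__ => horner (Q j)) (fun j => smooth_horner (Q j))).
set e := 4 * Y * L / K%:R.
have e0 : 0 <= e by rewrite /e divr_ge0 ?mulr_ge0// ltW.
have lip s t : `|s| <= Y -> `|t| <= Y -> `|iter_derive N h t - iter_derive N h s| <= L * `|t - s|.
  wlog st : s t / s <= t => [W|]; first have [st|ts] := leP s t; first exact: W.
    by move=> sY tY; rewrite distrC [`|t - s|]distrC; apply: W => //; exact: ltW.
  move=> /[dup] /ler_normlP[s1 s2] _ /[dup] /ler_normlP[t1 t2] _.
  have ts0 : 0 <= t - s by rewrite subr_ge0.
  have [u /andP[u0 us]] := smooth_mvt s (1 : R) (smooth_iter_derive N sh) ts0.
  rewrite ![_ *: (1 : R)]mulr1 subrK => ->; rewrite normrM (ger0_norm ts0) ler_wpM2r//.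
  by apply: hL; rewrite ler_norml; lra.
have top t : `|t| <= Y -> `|iter_derive N (fun t => h t - bernstein_lift h t) t| <= e.
  move=> tY; rewrite EE; under eq_bigr do rewrite QN.
  rewrite -(bernstein_mean_poly _ _ (fun j => iter_derive N h (node j))).
  have pE : node_poly.[t] = (t + Y) / (2 * Y) by rewrite /node_poly !hornerE mulrC.
  rewrite pE; set p := _ / _; have M0 : 0 < (K ^ 2)%:R :> R by rewrite ltr0n expn_gt0 K0.
  have p01 : 0 <= p <= 1.
    move: tY; rewrite ler_norml => /andP[t1 t2].
    rewrite /p divr_ge0 ?mulr_ge0 ?(ltW Y0)//=; last by lra.
    by rewrite ler_pdivrMr ?mulr_gt0//; lra.
  have Lp0 : 0 <= L * (2 * Y / (K ^ 2)%:R) by rewrite mulr_ge0// divr_ge0 ?mulr_ge0// ltW.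
  have := @bernstein_mean_dist _ p K (fun j => iter_derive N h (node j)) (iter_derive N h t) _ p01 K0 Lp0.
  have -> : 2 * (L * (2 * Y / (K ^ 2)%:R)) * K%:R = e.
    by rewrite /e natrX; field; rewrite gt_eqF.
  apply => j jM; apply: (le_trans (lip _ _ (node_bound jM) tY)).
  rewrite -mulrA ler_wpM2l//.
  have -> : t - node j = - (2 * Y / (K ^ 2)%:R * (j%:R - (K ^ 2)%:R * p)).
    rewrite /node /p; move: M0; move: (K ^ 2)%:R j%:R => u v u0; field.
    by rewrite !gt_eqF.
  by rewrite normrN normrM ger0_norm// divr_ge0 ?mulr_ge0 ?(ltW M0)// ltW.
move=> k t kN.
suff H i : (i <= N)%N -> forall t, `|t| <= Y -> `|iter_derive (N - i) (fun t => h t - bernstein_lift h t) t| <= (2 * Y) ^+ i * e.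
  move=> tY; have := H (N - k)%N (leq_subr _ _) t tY; rewrite subKn// => /le_trans; apply.
  by rewrite ler_wpM2r// ler_weXn2l ?leq_subr//; have := Y1; lra.
elim: i {t k kN} => [|i IH] iN t tY; first by rewrite subn0 expr0 mul1r; exact: top.
have iN' : (N - i.+1 < N)%N by rewrite ltn_subrL /= (leq_ltn_trans _ iN).
have at0 : iter_derive (N - i.+1) (fun t => h t - bernstein_lift h t) (- Y) = 0.
  by rewrite EE h0// big1 ?subrr// => j _; rewrite Q0// mulr0.
have := tY; rewrite ler_norml => /andP[t1 t2].
have tY0 : 0 <= t + Y by lra.
have [u /andP[u0 us]] := smooth_mvt (- Y) (1 : R) (smooth_iter_derive (N - i.+1) sE) tY0.
rewrite at0 subr0 ![_ *: (1 : R)]mulr1 addrK => ->.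
rewrite normrM (ger0_norm tY0) exprSr mulrAC; apply: ler_pM => //; last by lra.
have uY : `|u - Y| <= Y by rewrite ler_norml; lra.
by have := IH (ltnW iN) _ uY; rewrite -(subnSK iN).
Qed.
End OneVariableApproximation.

(** * Approximation in a single coordinate of a function of several *)

Section CoordinateLift.
Context {R : realType} {d : nat}.
Notation V := 'rV[R]_d.
Implicit Types (g : V -> R) (x y : V) (i : 'I_d).
Let oT : open [set: V] := @openT _.

Definition set_coord i x (t : R) : V := t *: delta_mx 0 i + (x - x 0 i *: delta_mx 0 i).

Lemma set_coordE i x t j : set_coord i x t 0 j = if j == i then t else x 0 j.
Proof.
rewrite /set_coord !mxE eqxx /=; case: eqP => [->|_]; last by rewrite !mulr0 subr0 add0r.
by rewrite !mulr1 subrr addr0.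
Qed.

Lemma set_coord_id i x : set_coord i x (x 0 i) = x.
Proof. by apply/rowP => j; rewrite set_coordE; case: eqP => // ->. Qed.

Lemma set_coord2 i x s t : set_coord i (set_coord i x s) t = set_coord i x t.
Proof. by apply/rowP => j; rewrite !set_coordE; case: eqP. Qed.

Lemma derive_eq_at (v : V) g x y : (forall h : R, g (h *: v + x) = g (h *: v + y)) ->
  'D_v g x = 'D_v g y.
Proof.
move=> H; have E : g x = g y by have := H 0; rewrite !scale0r !add0r.
rewrite /derive.
have -> : (fun h : R => h^-1 *: ((g \o shift x) (h *: v) - g x)) =
    (fun h : R => h^-1 *: ((g \o shift y) (h *: v) - g y)).
  by apply/funext=> h /=; rewrite H E.
by [].
Qed.

Lemma partial_set_coord i x k g : smooth g ->
  iter_derive k (fun t => g (set_coord i x t)) = (fun t => partial (nseq k i) g (set_coord i x t)).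
Proof.
move=> sg; elim: k => //= k ->; apply/funext=> t.
have H := smooth_is_derive (delta_mx 0 i) (smooth_partial (nseq k i) sg) (I : [set: V] (set_coord i x t)).
by have [_ ->] := (is_derive_line _ _ _ _ _).1 H.
Qed.

Lemma continuous_set_coord i t : continuous (fun x => set_coord i x t).
Proof.
move=> x; apply: continuous_rV => j.
have -> : (fun y => set_coord i y t 0 j) = (fun y => if j == i then t else y 0 j).
  by apply/funext=> y; rewrite set_coordE.
by case: eqP => _; [exact: cst_continuous|exact: continuous_coord].
Qed.

Lemma smooth_along g (v y : V) : smooth g -> smooth (fun t : R => g (t *: v + y)).
Proof.
move=> sg; pose P (h : R -> R) := exists g', smooth g' /\ h = (fun t : R => g' (t *: v + y)).
apply: (@smooth_coind _ _ P); [exact: openT| |by exists g].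
move=> _ [{}g [{}sg ->]].
have D (t : R) : is_derive t (1 : R) (fun t : R => g (t *: v + y)) ('D_v g (t *: v + y)).
  by apply: (is_derive_line _ _ _ _ _).1; exact: (smooth_is_derive v sg (I : [set: V] _)).
split=> [t _|r].
  by apply/differentiable_continuous/derivable1_diffP; have [] := D t.
exists (fun t => r * 'D_v g (t *: v + y)) => [|t _]; last by rewrite mulrC; exact: is_derive_dir.
exists (fun x => r * 'D_v g x); split=> //; apply: smoothZ => //; exact: smooth_derive.
Qed.

Lemma is_derive_set_coord i t g x (v : V) : smooth g ->
  is_derive x v (fun x => g (set_coord i x t)) ('D_(v - v 0 i *: delta_mx 0 i) g (set_coord i x t)).
Proof.
move=> sg; set w := _ - _.
have H : is_derive (0 : R) 1 (fun s : R => g (s *: w + set_coord i x t)) ('D_w g (set_coord i x t)).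
  apply: (is_derive_line g (set_coord i x t) w 0 _).1.
  by rewrite scale0r add0r; exact: (smooth_is_derive w sg (I : [set: V] _)).
have : is_derive (0 *: v + x) v (fun x => g (set_coord i x t)) ('D_w g (set_coord i x t)).
  apply: (is_derive_line (fun x => g (set_coord i x t)) x v 0 _).2.
  rewrite (_ : (fun s => _) = (fun s : R => g (s *: w + set_coord i x t)))//.
  apply/funext=> s; congr g; apply/rowP => j; rewrite /w /set_coord !mxE eqxx /=.
  by move: (v 0 i) (x 0 i) (v 0 j) (x 0 j) (j == i)%:R => p q r u z; ring.
by rewrite scale0r add0r.
Qed.

Lemma smooth_set_coord i t g : smooth g -> smooth (fun x => g (set_coord i x t)).
Proof.
move=> sg; pose P (h : V -> R) := exists g', smooth g' /\ h = (fun x => g' (set_coord i x t)).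
apply: (@smooth_coind _ _ P) => //; last by exists g.
move=> _ [{}g [{}sg ->]]; split=> [x _|v].
  apply: (@continuous_comp V V R (fun x => set_coord i x t) g x); first exact: continuous_set_coord.
  exact: (smooth_continuous sg).
exists (fun x => 'D_(v - v 0 i *: delta_mx 0 i) g (set_coord i x t)).
  by exists ('D_(v - v 0 i *: delta_mx 0 i) g); split=> //; exact: smooth_derive.
by move=> x _; exact: is_derive_set_coord.
Qed.

Lemma partial_cat s1 s2 g : partial (s1 ++ s2) g = partial s1 (partial s2 g).
Proof. exact: foldr_cat. Qed.

Lemma derive_partial_comm (v : V) s g : smooth g -> 'D_v (partial s g) = partial s ('D_v g).
Proof.
move=> sg; elim: s => [//|j s IH].
exact: (etrans (smooth_schwarz v (delta_mx 0 j) (smooth_partial s sg))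
  (congr1 (fun h => 'D_(delta_mx 0 j) h) IH)).
Qed.

(** By symmetry of mixed derivatives, those in the direction [i] are moved outermost, where the
    one-variable estimate applies. *)
Lemma partial_split i s g : smooth g ->
  partial s g = partial (nseq (count_mem i s) i) (partial [seq j <- s | j != i] g).
Proof.
move=> sg; elim: s => //= j s ->; have [->|ji] //= := eqVneq j i.
by rewrite add0n derive_partial_comm//; exact: smooth_partial.
Qed.

Section Lift.
Variables (Y : R) (N K : nat) (Q : nat -> {poly R}) (i : 'I_d).

(* The Bernstein approximation of the [N]-th derivative in the [i]-th coordinate,
   integrated [N] times from [- Y]. *)
Definition coord_lift g x : R := bernstein_lift Y N K Q (fun t => g (set_coord i x t)) (x 0 i).

Lemma coord_liftE g x : smooth g -> coord_lift g x =
  \sum_(j < (K ^ 2).+1) partial (nseq N i) g (set_coord i x (node Y K j)) * (Q j).[x 0 i].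
Proof. by move=> sg; rewrite /coord_lift /bernstein_lift partial_set_coord. Qed.

Let sQ j : smooth (fun x : V => (Q j).[x 0 i]).
Proof. exact/smooth_coord_comp/smooth_horner. Qed.

Lemma smooth_coord_lift g : smooth g -> smooth (coord_lift g).
Proof.
move=> sg; apply: (smooth_ext oT (fun x _ => esym (coord_liftE x sg))).
by apply: smooth_sum => // j; apply: smoothM => //; apply: smooth_set_coord; exact: smooth_partial.
Qed.

(** The lift acts through the [i]-th coordinate alone: neither the freezing of that coordinate at a
    node nor the factor [Q j] is affected by a derivative in another direction. *)
Lemma derive_coord_lift g l : l != i -> smooth g ->
  'D_(delta_mx 0 l) (coord_lift g) = coord_lift ('D_(delta_mx 0 l) g).
Proof.
move=> li sg; apply/funext=> x; set v : V := delta_mx 0 l.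
have vi : v 0 i = 0 by rewrite mxE eqxx /= eq_sym (negbTE li).
rewrite coord_liftE; last exact: smooth_derive.
have -> : coord_lift g = (fun x => \sum_(j < (K ^ 2).+1) partial (nseq N i) g (set_coord i x (node Y K j)) * (Q j).[x 0 i]).
  by apply/funext=> y; exact: coord_liftE.
have : is_derive x v
    (fun x => \sum_(j < (K ^ 2).+1) partial (nseq N i) g (set_coord i x (node Y K j)) * (Q j).[x 0 i])
    (\sum_(j < (K ^ 2).+1) partial (nseq N i) ('D_v g) (set_coord i x (node Y K j)) * (Q j).[x 0 i]); last by case.
elim: (index_enum _) => [|j r IH].
  rewrite big_nil (_ : (fun x => _) = fun=> 0); first exact: is_derive_cst.
  by apply/funext=> y; rewrite big_nil.
rewrite big_cons; set a := _ * _; set A := \sum_(_ <- _) _ in IH *.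
rewrite (_ : (fun x => _) = (fun x => partial (nseq N i) g (set_coord i x (node Y K j)) * (Q j).[x 0 i] +
    \sum_(j <- r) partial (nseq N i) g (set_coord i x (node Y K j)) * (Q j).[x 0 i])); last first.
  by apply/funext=> y; rewrite big_cons.
apply: is_derive_add => //.
have D1 := is_derive_set_coord i (node Y K j) x v (smooth_partial (nseq N i) sg).
rewrite vi scale0r subr0 in D1.
rewrite -(derive_partial_comm v (nseq N i) sg) in a *.
have D2 : is_derive x v (fun x : V => (Q j).[x 0 i]) 0.
  by apply: is_derive_affine => h; rewrite [(h *: v + x) 0 i]mxE [(h *: v) 0 i]mxE vi !mulr0 !add0r.
by have := is_derive_mul D1 D2; rewrite mulr0 add0r mulrC.
Qed.

Lemma partial_coord_lift s g : i \notin s -> smooth g ->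
  partial s (coord_lift g) = coord_lift (partial s g).
Proof.
elim: s => //= j s IH; rewrite inE negb_or eq_sym => /andP[ji si] sg.
by rewrite IH// derive_coord_lift//; exact: smooth_partial.
Qed.

Hypothesis Y1 : 1 <= Y.
Hypothesis K0 : (0 < K)%N.
Hypothesis QN : forall j, iter_derive N (horner (Q j)) = horner (bernstein_poly (node_poly Y) (K ^ 2) j).
Hypothesis Q0 : forall j k, (k < N)%N -> iter_derive k (horner (Q j)) (- Y) = 0.

(** The order [N.+1 + N] accounts for up to [N] derivatives in the other coordinates, which commute
    with the lift, and [N.+1] in the [i]-th, for the Lipschitz constant of the sampled derivative.
    Vanishing below [- Y'] provides the zero values at [- Y]. *)
Lemma coord_lift_error g (L Y' : R) : smooth g -> 0 <= L -> Y' < Y ->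
  (forall x, x 0 i < - Y' -> g x = 0) ->
  bounded_partials (N.+1 + N) [set x : V | forall j, `|x 0 j| <= Y] g L ->
  bounded_partials N [set x : V | forall j, `|x 0 j| <= Y] (fun x => g x - coord_lift g x)
    ((2 * Y) ^+ N * (4 * Y * L / K%:R)).
Proof.
move=> sg L0 YY g0 gL s sN x xY.
have scl := smooth_coord_lift sg.
have sE : smooth (fun x => g x - coord_lift g x) by exact: smoothB.
rewrite (partial_split i s sE).
set k := count_mem i s; set s' := [seq j <- s | j != i].
have kN : (k <= N)%N by rewrite (leq_trans _ sN)// count_size.
have s'N : (size s' <= N)%N by rewrite (leq_trans _ sN)// size_filter count_size.
pose p := partial s' g; have sp : smooth p by exact: smooth_partial.
have -> : partial s' (fun x => g x - coord_lift g x) = (fun x => p x - coord_lift p x).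
  have -> : (fun x => g x - coord_lift g x) = (fun x => g x + (-1) * coord_lift g x).
    by apply/funext=> y; rewrite mulN1r.
  rewrite partialD//; last exact: smoothZ.
  rewrite partialZ// partial_coord_lift//; first by apply/funext=> y; rewrite mulN1r.
  by rewrite mem_filter /= eqxx.
have scp := smooth_coord_lift sp.
have := congr1 (fun F => F (x 0 i)) (partial_set_coord i x k (smoothB oT sp scp)).
rewrite [RHS]/= set_coord_id => <-.
have -> : (fun t => p (set_coord i x t) - coord_lift p (set_coord i x t)) =
    (fun t => p (set_coord i x t) - bernstein_lift Y N K Q (fun t => p (set_coord i x t)) t).
  apply/funext=> t; congr (_ - _); rewrite /coord_lift set_coordE eqxx; congr bernstein_lift.
  by apply/funext=> u; rewrite set_coord2.
have inbox t : `|t| <= Y -> forall j, `|set_coord i x t 0 j| <= Y.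
  by move=> tY j; rewrite set_coordE; case: eqP.
apply: bernstein_lift_error => //.
- rewrite (_ : (fun t => _) = (fun t : R => p (t *: delta_mx 0 i + (x - x 0 i *: delta_mx 0 i))))//.
  exact: smooth_along.
- move=> l lN; rewrite partial_set_coord//.
  have oU : open [set y : V | y 0 i < - Y'].
    apply: (@open_comp V R (fun y : V => y 0 i) [set t | t < - Y']); last exact: open_lt.
    by move=> y _; exact: continuous_coord.
  rewrite -partial_cat; apply: (partial_on_eq0 _ oU) => [y|]; first exact: g0.
  by rewrite /= set_coordE eqxx ltrN2.
- move=> t tY; rewrite partial_set_coord// -partial_cat; apply: gL; last exact: inbox.
  by rewrite size_cat size_nseq leq_add.
Qed.
End Lift.
End CoordinateLift.

(** * A distribution that kills monomials kills compactly supported functions *)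

Section Density.
Context {R : realType} {d : nat} (f : @cdistribution R d).
Notation V := 'rV[R]_d.
Notation rp := (rpairing f).
Let oT : open [set: V] := @openT _.

Definition monomial (b : 'I_d -> nat) (x : V) : R := \prod_j x 0 j ^+ b j.

Lemma smooth_monomial b : smooth (monomial b).
Proof. by apply: smooth_prod => // j; apply: smoothX => //; exact: smooth_coord. Qed.

Lemma monomialM (i : 'I_d) a b (x : V) : x 0 i ^+ a * monomial b x = monomial (fun j => b j + (j == i) * a)%N x.
Proof.
rewrite /monomial (bigD1 i)//= [RHS](bigD1 i)//= eqxx mul1n addnC exprD mulrA; congr (_ * _).
by apply: eq_bigr => j /negbTE ->; rewrite mul0n addn0.
Qed.

Lemma rpairing_horner_monomial (G : V -> R) (i : 'I_d) (p : {poly R}) b : smooth G ->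
  (forall b, rp (fun x => G x * monomial b x) = 0) ->
  rp (fun x : V => G x * p.[x 0 i] * monomial b x) = 0.
Proof.
move=> sG HG.
have sM b' : smooth (fun x => G x * monomial b' x) by apply: smoothM => //; exact: smooth_monomial.
pose b' (a : nat) j := (b j + (j == i) * a)%N.
have -> : (fun x : V => G x * p.[x 0 i] * monomial b x) =
    (fun x => \sum_(a < size p) p`_a * (G x * monomial (b' a) x)).
  apply/funext=> x; rewrite horner_coef mulr_sumr mulr_suml; apply: eq_bigr => a _.
  by rewrite /b' -monomialM; move: (x 0 i ^+ a) => u; ring.
rewrite rpairing_sum => [|a]; last exact: smoothZ.
by rewrite big1// => a _; rewrite rpairingZ// HG mulr0.
Qed.

Definition depends_from (i : nat) (g : V -> R) := forall x y : V,
  (forall j : 'I_d, (i <= j)%N -> x 0 j = y 0 j) -> g x = g y.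

Lemma depends_from_derive i g v : depends_from i g -> depends_from i ('D_v g).
Proof.
move=> gi x y xy; apply: derive_eq_at => h; apply: gi => j ij.
by rewrite !mxE xy.
Qed.

Lemma depends_from_partial i g s : depends_from i g -> depends_from i (partial s g).
Proof. by move=> gi; elim: s => //= j s IH; exact: depends_from_derive. Qed.

Lemma partial_coord_support s g (j : 'I_d) (L : R) : (forall x : V, g x != 0 -> `|x 0 j| <= L) ->
  forall x : V, partial s g x != 0 -> `|x 0 j| <= L.
Proof.
move=> gL x; apply: contraNT; rewrite -ltNge => xL.
have oU : open [set y : V | L < `|y 0 j|].
  apply: (@open_comp V R (fun y : V => `|y 0 j|) [set t | L < t]); last exact: open_gt.
  move=> y _; apply: (@continuous_comp V R R (fun y : V => y 0 j) (fun t => `|t|)); last exact: norm_continuous.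
  exact: continuous_coord.
apply/eqP; apply: (partial_on_eq0 _ oU _ xL) => y Ly; apply/eqP.
by apply: contraTT Ly => /gL; rewrite /= -leNgt.
Qed.

(* One coordinate at a time is replaced by polynomials: by downward induction on
   [i], the products of a monomial and of a function of the coordinates of index
   at least [i] are killed. *)
Lemma rpairing_dense g : (forall b, rp (monomial b) = 0) -> smooth g ->
  (exists L, forall x, g x != 0 -> `|x| <= L) -> rp g = 0.
Proof.
move=> rp0 sg [L gL].
have [Kc [N [M [cptK M0 HM]]]] := rpairing_continuous f.
have [Z Z0 KZ] := compact_norm_bounded cptK.
(* The box of half-side [Y] contains the compact set that controls [f], and [g] vanishes near its
   faces. *)
pose Y := `|L| + Z + 1.
have Y1 : 1 <= Y by rewrite /Y lerDr addr_ge0.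
have LY : L < Y by rewrite (le_lt_trans (ler_norm L))// /Y -addrA ltrDl ltr_wpDl.
pose box := [set x : V | forall j, `|x 0 j| <= Y].
have Kbox : Kc `<=` box.
  move=> x /KZ xZ j; rewrite (le_trans (rV_norm_coord _ _))// (le_trans xZ)// /Y.
  by have := normr_ge0 L; lra.
have cbox : compact box by exact: compact_box.
have HQ (K : nat) : exists Q : nat -> {poly R}, forall j,
    iter_derive N (horner (Q j)) = horner (bernstein_poly (node_poly Y) (K ^ 2) j) /\
    forall k, (k < N)%N -> iter_derive k (horner (Q j)) (- Y) = 0.
  have [Q HQ] := choice (fun j : nat => poly_iter_primitive N (bernstein_poly (node_poly Y) (K ^ 2) j) (- Y)).
  by exists Q.
(* [k] counts the coordinates on which the function may still depend. *)
suff H k i : (i + k)%N = d -> forall g, smooth g -> depends_from i g ->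
    (forall x, g x != 0 -> forall j : 'I_d, (i <= j)%N -> `|x 0 j| <= L) ->
    forall b, rp (fun x => g x * monomial b x) = 0.
  have := H d 0%N (add0n d) g sg _ _ (fun=> 0%N).
  rewrite (_ : (fun x => _) = g); first apply.
  - by move=> x y xy; congr g; apply/rowP => j; apply: xy.
  - by move=> x /gL xL j _; rewrite (le_trans (rV_norm_coord _ _)).
  by apply/funext=> x; rewrite /monomial big1 ?mulr1.
elim: k i {g sg gL} => [|k IH] i ik g sg gi gL b.
  have -> : (fun x => g x * monomial b x) = (fun x => g 0 * monomial b x).
    apply/funext=> x; congr (_ * _); apply: gi => j.
    by rewrite leqNgt -(addn0 i) ik ltn_ord.
  by rewrite rpairingZ ?rp0 ?mulr0//; exact: smooth_monomial.
have id' : (i < d)%N by rewrite -ik addnS ltnS leq_addr.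
pose io := Ordinal id'.
have [W W0 HW] := smooth_bounded_partials N cptK (smooth_monomial b).
have [B B0 HB] := smooth_bounded_partials (N.+1 + N) cbox sg.
(* The error of the lift without its factor [1 / K], multiplied by the constants of the Leibniz
   rule, of the monomial and of the continuity of [f]. *)
pose A := M * (2 ^+ N * ((2 * Y) ^+ N * (4 * Y * B) * W)).
have Y0 : 0 <= Y by exact: le_trans Y1.
have A0 : 0 <= A by rewrite !mulr_ge0 ?exprn_ge0 ?mulr_ge0.
suff HK (K : nat) : (0 < K)%N -> Normc.normc (rp (fun x => g x * monomial b x)) <= A / K%:R.
  apply: Normc.eq0_normc; apply/le_anti/andP; split; last first.
    by case: (rp _) => u v; exact: sqrtr_ge0.
  rewrite leNgt; apply/negP; set t := Normc.normc _ in HK * => t0.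
  have := HK (Num.trunc (A / t)).+1 (ltn0Sn _); rewrite leNgt => /negP; apply.
  rewrite ltr_pdivrMr ?ltr0n// mulrC -ltr_pdivrMr//.
  exact: truncnS_gt.
move=> K0; have [Q HQK] := HQ K.
have QN j := (HQK j).1; have Q0 j := (HQK j).2.
pose cl := coord_lift Y N K Q io g.
have scl : smooth cl by exact: smooth_coord_lift.
have smb := smooth_monomial b.
have cl0 : rp (fun x => cl x * monomial b x) = 0.
  have E : (fun x => cl x * monomial b x) = (fun x => \sum_(j < (K ^ 2).+1)
      partial (nseq N io) g (set_coord io x (node Y K j)) * (Q j).[x 0 io] * monomial b x).
    by apply/funext=> x; rewrite /cl coord_liftE// mulr_suml.
  have sG j : smooth (fun x => partial (nseq N io) g (set_coord io x (node Y K j))).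
    by apply: smooth_set_coord; exact: smooth_partial.
  rewrite E rpairing_sum => [|j]; last first.
    by apply: smoothM => //; apply: smoothM => //; exact/smooth_coord_comp/smooth_horner.
  rewrite big1// => j _; apply: (rpairing_horner_monomial io (Q j) b (sG j)) => b'.
  (* Evaluation at a node freezes coordinate [i], so the coefficient depends only on coordinates
     from [i.+1] on. *)
  apply: (IH i.+1) => //; first by rewrite addSnnS.
    move=> x y xy; apply: (depends_from_partial _ gi) => l; rewrite leq_eqVlt => /orP[/eqP il|il].
      by rewrite !set_coordE -val_eqE /= -il eqxx.
    by rewrite !set_coordE -val_eqE /= gtn_eqF// xy.
  move=> x xn0 j' ij'; have := partial_coord_support (L := L) (j := j') _ xn0.
  rewrite set_coordE -val_eqE /= gtn_eqF//; apply => z /gL; apply; exact: ltnW.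
have -> : (fun x => g x * monomial b x) =
    (fun x => (g x - cl x) * monomial b x + cl x * monomial b x).
  by apply/funext=> x; rewrite -mulrDl subrK.
have sE : smooth (fun x => g x - cl x) by exact: smoothB.
rewrite rpairingD; [|exact: smoothM|exact: smoothM]; rewrite cl0 addr0.
pose e := (2 * Y) ^+ N * (4 * Y * B / K%:R).
have e0 : 0 <= e by rewrite mulr_ge0 ?exprn_ge0 ?mulr_ge0// invr_ge0 ler0n.
have HE : bounded_partials N box (fun x => g x - cl x) e.
  apply: (coord_lift_error Y1 K0 QN Q0 sg B0 LY _ HB) => x xL.
  apply/eqP; apply: contraTT xL => /gL /(_ io (leqnn _)); rewrite ler_norml -leNgt.
  by case/andP.
have -> : A / K%:R = M * (2 ^+ N * (e * W)).
  by rewrite /A /e; move: (2 ^+ N) ((2 * Y) ^+ N) K%:R^-1 => u v w; ring.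
apply: HM; first exact: smoothM.
  by apply: mulr_ge0; [exact: exprn_ge0|exact: mulr_ge0].
apply: bounded_partialsM => //.
by move=> s sN x /Kbox; exact: HE.
Qed.
End Density.

(** * The support theorem *)

Section SupportTheorem.
Context {R : realType} {n : nat}.
Notation V := 'rV[R]_n.+2.
Variables (Omega Sigma : set V).
Hypothesis Omega_bounded : bounded_set Omega.
Hypothesis Omega_sconvex : strictly_convex Omega.
Hypothesis Sigma_open : relatively_open_in (boundary Omega) Sigma.
Hypothesis Sigma_nonempty : Sigma !=set0.
Variable f : @cdistribution R n.+2.
Hypothesis f_supp : dsupport f `<=` closure Omega.
Hypothesis Xf_vanishes : forall l, lines_meeting Sigma l -> ~ Lines_dsupport (Xray f) l.
Local Notation C := (closure Omega).

Lemma line_point (x0 : V) (c : R) m (q : 'rV[R]_n.+1 * 'rV[R]_n.+1) (z : V) : c != 0 ->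
  (forall i, side x0 i z = q.1 0 i + height x0 c m z * q.2 0 i) ->
  z = height x0 c m z *: dirvec c m q + basept x0 c m q.
Proof.
move=> c0 zq; apply: (rV_ext (m := m) c0).
  rewrite nform_lin nform_dirvec// mulr1.
  have := height_basept x0 m c0 q; rewrite /height => /eqP; rewrite subr_eq0 => /eqP ->.
  by rewrite subrK.
move=> i; apply: (addIr (- x0 0 (lift ord0 i))).
rewrite -/(side x0 i z) zq -/(side x0 i _) side_affine side_basept /dirvec consVS addrC//.
Qed.

(** Either the line misses [C], hence the support of [f], or its base point close to [x0] forces it
    to meet [Sigma], and then [Xf] vanishes near it. *)
Lemma illuminated_vanish_near (x0 : V) (c : R) m r (q : 'rV[R]_n.+1 * 'rV[R]_n.+1) : c != 0 ->
  (forall y D s, `|x0 - y| < r -> C (s *: D + y) -> exists s', Sigma (s' *: D + y)) ->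
  `|x0 - basept x0 c m q| < r -> exists2 e, 0 < e & vanish_near f x0 c m q e.
Proof.
move=> c0 ill qr.
have C0 : C !=set0.
  by have [p Sp] := Sigma_nonempty; have [U [_ SU]] := Sigma_open; exists p; move: Sp; rewrite SU => -[[]].
have [[y [Cy yq]]|miss] := pselect (exists y, C y /\
    forall i, side x0 i y = q.1 0 i + height x0 c m y * q.2 0 i); last first.
  apply: (vanish_near_of_miss (compact_closure_Omega Omega_bounded) C0 f_supp) => y Cy yq.
  by apply: miss; exists y.
move: Cy; rewrite (line_point c0 yq) => /(ill _ _ _ qr) [s Ss].
set z := s *: _ + _ in Ss.
have zs : height x0 c m z = s by rewrite /z height_affine nform_dirvec// height_basept// mulr1 addr0.
have Lz : line_pts (lineat x0 c m q) z.
  by apply: line_pts_lineat => // i; rewrite zs /z side_affine side_basept /dirvec consVS addrC.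
have Lq := Lines_lineat x0 m c0 q.
have nsupp : ~ Lines_dsupport (Xray f) (lineat x0 c m q).
  by apply: Xf_vanishes; split=> //; exists z.
have [W [oW Wq HW]] : exists W, [/\ open W, W (lineat x0 c m q) & forall eta, Lines_test_fun eta ->
    compact (Lines_fun_support eta) -> Lines_fun_support eta `<=` W -> Xray f eta = 0].
  by apply: contrapT => h; apply: nsupp; split.
exact: (vanish_near_of_local c0 oW Wq HW).
Qed.

Lemma cdist_eq0_of_Xray : cdist_eq0 f.
Proof.
have cC := compact_closure_Omega Omega_bounded.
have C0 : C !=set0.
  by have [p Sp] := Sigma_nonempty; have [U [_ SU]] := Sigma_open; exists p; move: Sp; rewrite SU => -[[]].
have [x0 [r [r0 Cx0 ill]]] := illuminating_ball Omega_bounded Omega_sconvex Sigma_open Sigma_nonempty.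
have [c [m [t0 [c0 t00 Ct0]]]] := separating_form Omega_bounded Omega_sconvex C0 Cx0.
(* A foot [u] displaces the first coordinate of the base point by [- (\sum_i m i * u_i) / c]; feet
   of size at most [e = r / 2 / A] keep it within [r / 2] of [x0]. *)
pose A := 1 + \sum_i `|m i| / `|c|.
have A1 : 1 <= A by rewrite /A lerDl sumr_ge0// => i _; rewrite divr_ge0.
have A0 : 0 < A by exact: lt_le_trans A1.
pose e := r / 2 / A; have e0 : 0 < e by rewrite !divr_gt0.
have near (q : 'rV[R]_n.+1 * 'rV[R]_n.+1) : (forall i, `|q.1 0 i| <= e) -> `|x0 - basept x0 c m q| < r.
  move=> qe; rewrite /basept opprD addrA subrr add0r normrN.
  apply: (@le_lt_trans _ _ (r / 2)); last by lra.
  have eA : e * A = r / 2 by rewrite /e divfK// gt_eqF.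
  apply: rV_norm_le => [|j]; first by rewrite divr_ge0// ltW.
  case: (unliftP ord0 j) => [i ->|->].
    by rewrite consVS (le_trans (qe i))// -eA ler_peMr// ltW.
  rewrite consV0 mulNr normrN normrM normfV ler_pdivrMr ?normr_gt0//.
  apply: (@le_trans _ _ (\sum_i `|m i| * e)).
    rewrite (le_trans (ler_norm_sum _ _ _))//; apply: ler_sum => i _.
    by rewrite normrM ler_wpM2l.
  have Ac : A * `|c| = `|c| + \sum_i `|m i|.
    by rewrite /A mulrDl mul1r -mulr_suml divfK// normr_eq0.
  by rewrite -eA -mulrA Ac mulrDr -mulr_suml mulrC lerDr mulr_ge0// ltW.
have fvanish L hh aa : (forall i, tame (hh i)) -> (forall i, tame (aa i)) ->
    (forall i x, hh i x != 0 -> `|x| <= e) -> (forall i x, aa i x != 0 -> `|x| <= L) ->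
    rpairing f (lineprod x0 c m hh aa) = 0.
  (* No bound on the slopes enters: small feet alone bring the base point close to [x0], for every
     [L]. *)
  apply: lineprod_vanish => q /near qr _; exact: illuminated_vanish_near ill qr.
have [Y Y0 CY] := compact_norm_bounded cC.
(* The clamping level is [k = t0 / 4]: the height is at least [t0] on [C], so the region where it
   exceeds [2 * k] is a neighborhood of [C]. *)
pose O : set V := ball 0 (Y + 1) `&` [set x | 2 * (t0 / 4) < height x0 c m x].
have oO : open O.
  apply: openI; first exact: ball_open.
  apply: (@open_comp V R (height x0 c m) [set t | 2 * (t0 / 4) < t]); last exact: open_gt.
  by move=> y _; exact: (smooth_continuous (smooth_height x0 c m)).
have OY x : O x -> `|x| <= Y + 1.
  by move=> [+ _]; rewrite -ball_normE /= sub0r normrN => /ltW.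
have CO : C `<=` O.
  move=> x Cx; split; last by rewrite /=; have := Ct0 _ Cx; lra.
  by rewrite -ball_normE /= sub0r normrN (le_lt_trans (CY _ Cx))// ltrDl.
have Ok x : O x -> 2 * (t0 / 4) <= height x0 c m x by move=> [_ /ltW].
have OZ x : O x -> forall i, `|side x0 i x| <= Y + 1 + `|x0|.
  move=> /OY xY i; rewrite (le_trans (ler_normB _ _))// lerD// ?(le_trans (rV_norm_coord _ _))//.
have k0 : 0 < t0 / 4 by rewrite divr_gt0.
have Z0 : 0 <= Y + 1 + `|x0| by rewrite !addr_ge0.
have mono b : rpairing f (monomial b) = 0.
  exact: (rpairing_monomial c0 k0 Z0 e0 f_supp oO CO Ok OZ fvanish).
apply: rpairing_cdist_eq0 => g sg.
(* [chi] is 1 on [O], so multiplying by it does not change the pairing, and it provides the compact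
   support that density requires. *)
pose chi (x : V) := \prod_j plateau (Y + 1) (x 0 j).
have schi : smooth chi by apply: smooth_prod => [|j]; [exact: openT|exact/smooth_coord_comp/smooth_plateau].
have sp : smooth (fun x => g x * chi x) by apply: smoothM => //; exact: openT.
rewrite (rpairing_ext f_supp oO CO sg sp) => [|x /OY xY]; last first.
  by rewrite /chi big1 ?mulr1// => j _; rewrite plateau1// (le_trans (rV_norm_coord _ _)).
apply: rpairing_dense => //; exists (Y + 1 + 1) => x gx.
apply: rV_norm_le => [|j]; first by rewrite !addr_ge0.
apply: plateau_neq0; apply: contraNneq gx => pj.
by rewrite /chi (bigD1 j)//= pj mul0r mulr0.
Qed.
End SupportTheorem.

Theorem corollary1p4 (R : realType) (d : nat) (d_ge2 : (2 <= d)%N)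
    (Omega Sigma : set 'rV[R]_d)
    (Omega_bounded : bounded_set Omega)
    (Omega_smooth : smooth_hypersurface (boundary Omega))
    (Omega_sconvex : strictly_convex Omega)
    (Sigma_open : relatively_open_in (boundary Omega) Sigma)
    (Sigma_nonempty : Sigma !=set0)
    (f : @cdistribution R d)
    (f_supp : dsupport f `<=` closure Omega)
    (Xf_vanishes : forall l, lines_meeting Sigma l ->
       ~ Lines_dsupport (Xray f) l) :
  cdist_eq0 f.
Proof.
case: d d_ge2 Omega Sigma Omega_bounded Omega_smooth Omega_sconvex Sigma_open Sigma_nonempty
  f f_supp Xf_vanishes => [|[|n]] // _ Omega Sigma Ob _ Os So S0 f fs Xf.
exact: (cdist_eq0_of_Xray Ob Os So S0 fs Xf).
Qed.
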